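(* Assume that $\lim_{t\to+\infty}\rho(t)=+\infty$, $\lim_{t\to+\infty}\frac{\dot\rho(t)}{\rho(t)}=k\ge0$, $\Omega_0$ is convex, and $J$ is compactly supported with $\int_{\mathbb R^n}J(x)x\,\mathrm dx=0$. Let $A=-nkI+\mathcal Df(0)$, where $I$ is the identity matrix, and let $s(A)$ be the maximal real part of its eigenvalues. Consider $$\frac{\partial u}{\partial t}=D\int_{\Omega_0}J_{\frac1{\rho(t)}}(y-z)u(t,z)\,\mathrm dz-Du-\frac{n\dot\rho(t)}{\rho(t)}u+f(u),\quad t>0,\ y\in\overline\Omega_0,\qquad u(0,y)=u_0(y).\qquad (\ast)$$ (1) If $s(A)\le0$, then $0$ is globally asymptotically stable for $(\ast)$ in $X_+^v$. (2) If $s(A)>0$, then for each $u_0\in X_+^v\setminus\{0\}$ the solution $u(t,y;u_0)$ of $(\ast)$ satisfies $\lim_{t\to+\infty}u(t,y;u_0)=w_e$ uniformly for $y$ in any compact subset of $\Omega_0$, where $w_e$ is the unique positive equilibrium in $\mathbb M$ of $\frac{\mathrm dw}{\mathrm dt}=-nkw+f(w)$.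
   Context: Setting. $m,n\ge1$ are integers; $\Omega_0\subset\mathbb R^n$ is a bounded, simply connected domain with smooth boundary; $D=\mathrm{diag}\{d_1,\dots,d_m\}$ with all $d_i>0$; $\rho:[0,\infty)\to(0,\infty)$ is smooth with $\rho(0)=1$; $u=(u_1,\dots,u_m)^T$. For $r>0$, $J_{\frac1r}(y):=r^nJ(ry)$. Inequalities between vectors in $\mathbb R^m$: $a\ge b$ means $a-b\in\mathbb R^m_+$; $a>b$ means $a\ge b$ and $a\ne b$; $a\gg b$ means $a-b\in\mathrm{Int}(\mathbb R^m_+)$. Fix $v\in\mathrm{Int}(\mathbb R^m_+)$ and let $\mathbb M=\{u\in\mathbb R^m:0\le u\le v\}$. A matrix is cooperative if its off-diagonal entries are nonnegative. Assumption on $J$: $J:\mathbb R^n\to\mathbb R$ is continuous and nonnegative, $J(0)>0$, $\int_{\mathbb R^n}J(x)\,\mathrm dx=1$. Assumption on $f$: $f\in C^1(\mathbb R^m,\mathbb R^m)$; the Jacobian $\mathcal Df(u)=(\partial f_i(u)/\partial u_j)_{m\times m}$ is cooperative and irreducible for $u\in\mathbb M$; $f(0)=0$; there is $\sigma>0$ such that for each $1\le i\le m$, $f_i(u)-n\frac{\dot\rho(t)}{\rho(t)}v_i\le-\sigma$ whenever $t\ge0$ and $u\in\mathbb M$ with $u_i=v_i$; and $\alpha f(u)<f(\alpha u)$ for all $u\in\mathbb M\cap\mathrm{Int}(\mathbb R^m_+)$ and $\alpha\in(0,1)$. Spaces. $X=C(\overline\Omega_0,\mathbb R^m)$ with the sup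 norm, $X_+^v=\{\varphi\in X:0\le\varphi(x)\le v,\ x\in\overline\Omega_0\}$. If $s(A)>0$, the system $\frac{\mathrm dw}{\mathrm dt}=-nkw+f(w)$ has a unique positive equilibrium $w_e$ in $\mathbb M$, and it attracts all solutions starting in $\mathbb M\setminus\{0\}$. Stability. $0$ is globally asymptotically stable in $S\subset X$ if $\lim_{t\to\infty}\|u(t,\cdot;\varphi)\|_X=0$ for all $\varphi\in S$ and, for every $\varepsilon>0$, there is $\delta>0$ such that $\varphi\in S$, $\|\varphi\|_X<\delta$ imply $\|u(t,\cdot;\varphi)\|_X<\varepsilon$ for all $t\ge0$, where $u(t,\cdot;\varphi)$ is the solution with $u(0,\cdot)=\varphi$. *)

(* Defs.v *)
From HB Require Import structures.
From mathcomp Require Import all_boot all_order all_algebra.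
From mathcomp Require Import complex.
From mathcomp Require Import all_classical all_reals all_analysis.

Set Implicit Arguments.
Unset Strict Implicit.
Unset Printing Implicit Defensive.

Import Order.TTheory GRing.Theory Num.Theory.
Import numFieldNormedType.Exports.

Local Open Scope classical_set_scope.
Local Open Scope ring_scope.

(** R^n is ['rV[R]_n], with the sigma-algebra generated by the coordinates,
    which is the Borel sigma-algebra. Its Lebesgue measure is the image of the
    n-fold product of [lebesgue_measure]. *)

Section measurable_rV.
Context {d} {T : measurableType d}.
Variable n : nat.

Definition rV_coord (i : 'I_n) (x : 'rV[T]_n) : T := x ord0 i.

Let rV_set0 : g_sigma_preimage rV_coord set0.
Proof. exact: sigma_algebra0. Qed.

Let rV_setC A : g_sigma_preimage rV_coord A -> g_sigma_preimage rV_coord (~` A).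
Proof. exact: sigma_algebraC. Qed.

Let rV_bigcup (F : _^nat) : (forall i, g_sigma_preimage rV_coord (F i)) ->
  g_sigma_preimage rV_coord (\bigcup_i (F i)).
Proof. exact: sigma_algebra_bigcup. Qed.

HB.instance Definition _ := @isMeasurable.Build (measure_tuple_display d)
  'rV[T]_n (g_sigma_preimage rV_coord) rV_set0 rV_setC rV_bigcup.

Definition rV_of_tuple (t : n.-tuple T) : 'rV[T]_n := \row_i tnth t i.

Lemma measurable_rV_of_tuple : measurable_fun [set: n.-tuple T] rV_of_tuple.
Proof.
move=> _ A mA; rewrite setTI.
suff : g_sigma_preimage (fun i => rV_coord i \o rV_of_tuple)
    (rV_of_tuple @^-1` A).
  congr (g_sigma_preimage _ _); apply/funext => i; apply/funext => t /=.
  by rewrite /rV_coord /rV_of_tuple mxE.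
by rewrite g_sigma_preimage_comp; exists A => //; rewrite setTI.
Qed.

End measurable_rV.

Section lebesgue_rV.
Local Open Scope ereal_scope.
Context {R : realType}.
Let RT := measurableTypeR R.

Definition tuple_snoc n (p : (n.-tuple RT * RT)%type) : n.+1.-tuple RT :=
  [the n.+1.-tuple RT of p.2 :: p.1].

Lemma measurable_tuple_snoc n :
  measurable_fun [set: (n.-tuple RT * RT)%type] (@tuple_snoc n).
Proof. exact: measurable_cons. Qed.

Definition image_measure d1 d2 (T1 : measurableType d1)
    (T2 : measurableType d2) (mu : {measure set T1 -> \bar R}) (g : T1 -> T2)
    (mg : measurable_fun [set: T1] g) : {measure set T2 -> \bar R} :=
  measure_function_pushforward__canonical__measure_function_Measure mu mg.

Fixpoint lebesgue_tuple n : {measure set (n.-tuple RT) -> \bar R} :=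
  if n is n'.+1 return {measure set (n.-tuple RT) -> \bar R} then
    image_measure (lebesgue_tuple n' \x (@lebesgue_measure R))
      (@measurable_tuple_snoc n')
  else \d_([tuple]).

Definition lebesgue_rV n : {measure set 'rV[RT]_n -> \bar R} :=
  image_measure (lebesgue_tuple n) (@measurable_rV_of_tuple _ RT n).

End lebesgue_rV.

Definition Rint_rV {R : realType} {n : nat} (Om : set 'rV[R]_n)
    (g : 'rV[R]_n -> R) : R :=
  \int[@lebesgue_rV R n]_(x in Om) g x.

(** The cone R^m_+ and the orders it induces on R^m. *)

Section orders.
Context {R : realType} {m : nat}.
Implicit Types a b : 'cV[R]_m.

Definition nonneg_cone : set 'cV[R]_m := [set a | forall i, 0 <= a i ord0].

Definition vle a b : Prop := nonneg_cone (b - a).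
Definition vlt a b : Prop := vle a b /\ a <> b.

Definition order_interval (v : 'cV[R]_m) : set 'cV[R]_m :=
  [set a | vle 0 a /\ vle a v].

End orders.

Section matrices.
Context {R : realType} {m : nat}.

Definition cooperative (A : 'M[R]_m) : Prop :=
  forall i j, i != j -> 0 <= A i j.

Definition irreducible (A : 'M[R]_m) : Prop :=
  forall S : {set 'I_m}, S != finset.set0 -> S != [set: 'I_m]%SET ->
    exists i j, [/\ i \in S, j \notin S & A i j != 0].

(** The set of eigenvalues is finite, and nonempty if [0 < m], so that the
    supremum is a maximum. *)
Definition spectral_bound (A : 'M[R]_m) : R :=
  sup [set complex.Re z | z in
    [set z : complex R |
      eigenvalue (map_mx (real_complex R) A) z]].

End matrices.

Section differentiability.
Context {R : realType}.

(** Functions of class C^k on the space of p x q matrices: all partial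
    derivatives up to order k exist and are continuous. *)
Fixpoint class_C {p q : nat} (k : nat) (g : 'M[R]_(p, q) -> R) : Prop :=
  continuous g /\
  if k is k'.+1 then
    forall i j, (forall x, derivable g x (delta_mx i j)) /\
      class_C k' (fun x => 'D_(delta_mx i j) g x)
  else True.

Definition smooth {p q : nat} (g : 'M[R]_(p, q) -> R) : Prop :=
  forall k, class_C k g.

Definition class_C1 {m : nat} (f : 'cV[R]_m -> 'cV[R]_m) : Prop :=
  forall i, class_C 1 (fun w => f w i ord0).

Definition Jacobian {m : nat} (f : 'cV[R]_m -> 'cV[R]_m) (w : 'cV[R]_m) :
    'M[R]_m :=
  \matrix_(i, j) 'D_(delta_mx j ord0) (fun z => f z i ord0) w.

(** Derivatives of functions on [0, +oo[, one-sided at 0. *)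
Definition ray_slope (r : R -> R) (t s : R) : R := (r s - r t) / (s - t).

Definition ray_dnbhs (t : R) : set_system R := within [set s | 0 <= s] t^'.

Definition ray_derive (r : R -> R) (t : R) : R :=
  lim (ray_slope r t @ ray_dnbhs t).

Definition ray_smooth (r : R -> R) : Prop :=
  forall k t, 0 <= t -> cvg (ray_slope (iter k ray_derive r) t @ ray_dnbhs t).

End differentiability.

Section domains.
Context {R : realType} {n : nat}.
Implicit Types Om : set 'rV[R]_n.

Definition domain Om : Prop := [/\ open Om, connected Om & Om !=set0].

Definition path_connected Om : Prop :=
  forall x y, Om x -> Om y -> exists g : R -> 'rV[R]_n,
    [/\ {within `[0, 1], continuous g}, g @` `[0, 1] `<=` Om,
        g 0 = x & g 1 = y].

Definition simply_connected Om : Prop :=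
  path_connected Om /\
  forall g : R -> 'rV[R]_n,
    {within `[0, 1], continuous g} -> g @` `[0, 1] `<=` Om -> g 0 = g 1 ->
    exists H : R * R -> 'rV[R]_n,
      [/\ {within `[0, 1] `*` `[0, 1], continuous H},
          H @` (`[0, 1] `*` `[0, 1]) `<=` Om,
          forall s, s \in `[0, 1] -> H (0, s) = g s,
          forall s, s \in `[0, 1] -> H (1, s) = g 0 &
          forall t, t \in `[0, 1] -> H (t, 0) = g 0 /\ H (t, 1) = g 0].

(** Near each of its boundary points, the open set is the sublevel set of a
    smooth function whose gradient does not vanish at that point. *)
Definition smooth_boundary Om : Prop :=
  forall x, (closure Om `\` interior Om) x ->
    exists g : 'rV[R]_n -> R,
      [/\ smooth g, exists i, 'D_(delta_mx ord0 i) g x != 0 &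
          \forall y \near x, Om y <-> g y < 0].

End domains.

Definition compactly_supported {R : realType} {n : nat} (J : 'rV[R]_n -> R) :
    Prop :=
  compact (closure [set x | J x != 0]).

Definition dispersal_kernel {R : realType} {n : nat} (J : 'rV[R]_n -> R) :
    Prop :=
  [/\ continuous J, forall x, 0 <= J x, 0 < J 0 &
      (\int[@lebesgue_rV R n]_x (J x)%:E = 1)%E].

Definition reaction_term {R : realType} {m : nat} (n : nat) (rho : R -> R)
    (v : 'cV[R]_m) (f : 'cV[R]_m -> 'cV[R]_m) : Prop :=
  [/\ class_C1 f,
      forall w, order_interval v w ->
        cooperative (Jacobian f w) /\ irreducible (Jacobian f w),
      f 0 = 0,
      exists2 sigma : R, 0 < sigma &
        forall i t w, 0 <= t -> order_interval v w ->
          w i ord0 = v i ord0 ->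
          f w i ord0 - n%:R * (ray_derive rho t / rho t) * v i ord0 <= - sigma &
      forall w (alpha : R), (order_interval v `&` interior nonneg_cone) w ->
        0 < alpha < 1 -> vlt (alpha *: f w) (f (alpha *: w))].

Section problem.
Context {R : realType} {m n : nat}.
Variables (Om : set 'rV[R]_n) (d : 'rV[R]_m) (rho : R -> R).
Variables (J : 'rV[R]_n -> R) (f : 'cV[R]_m -> 'cV[R]_m).

(** Elements of X = C(closure Om, R^m) are represented by functions on R^n, of
    which only the values on [closure Om] matter. *)
Definition sup_norm (phi : 'rV[R]_n -> 'cV[R]_m) : R :=
  sup [set `|phi y| | y in closure Om].

Definition X_interval (v : 'cV[R]_m) : set ('rV[R]_n -> 'cV[R]_m) :=
  [set phi | {within closure Om, continuous phi} /\
             forall y, closure Om y -> order_interval v (phi y)].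

(** J_{1/r} *)
Definition rescaled (r : R) (y : 'rV[R]_n) : R := r ^+ n * J (r *: y).

Definition dispersal (t : R) (w : 'rV[R]_n -> 'cV[R]_m) (y : 'rV[R]_n) :
    'cV[R]_m :=
  \col_i Rint_rV Om (fun z => rescaled (rho t) (y - z) * w z i ord0).

Definition rhs (t : R) (w : 'rV[R]_n -> 'cV[R]_m) (y : 'rV[R]_n) : 'cV[R]_m :=
  diag_mx d *m dispersal t w y - diag_mx d *m w y
  - (n%:R * ray_derive rho t / rho t) *: w y + f (w y).

(** Joint continuity on [0, +oo[ x closure Om is continuity of t |-> u(t, .)
    from [0, +oo[ to X, since [closure Om] is compact for bounded [Om]. *)
Definition is_solution (phi : 'rV[R]_n -> 'cV[R]_m)
    (u : R -> 'rV[R]_n -> 'cV[R]_m) : Prop :=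
  [/\ {within [set ty : R * 'rV[R]_n | 0 <= ty.1 /\ closure Om ty.2],
         continuous (fun ty => u ty.1 ty.2)},
      forall y, closure Om y -> u 0 y = phi y &
      forall (t : R) y, 0 < t -> closure Om y ->
        is_derive t (1 : R) (fun s => u s y) (rhs t (u t) y)].

Definition zero_globally_asymptotically_stable
    (S : set ('rV[R]_n -> 'cV[R]_m)) : Prop :=
  (forall phi u, S phi -> is_solution phi u ->
     sup_norm (u t) @[t --> +oo] --> (0 : R)) /\
  (forall eps : R, 0 < eps -> exists2 delta : R, 0 < delta &
     forall phi u, S phi -> sup_norm phi < delta -> is_solution phi u ->
       forall t : R, 0 <= t -> sup_norm (u t) < eps).

End problem.

(** For [dw/dt = - n k w + f(w)]. *)
Definition positive_equilibrium {R : realType} {m : nat} (n : nat) (k : R)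
    (v : 'cV[R]_m) (f : 'cV[R]_m -> 'cV[R]_m) (w : 'cV[R]_m) : Prop :=
  [/\ order_interval v w, vlt 0 w & - (n%:R * k) *: w + f w = 0].

(* Main.v *)
Require Import Defs.
From HB Require Import structures.
From mathcomp Require Import all_boot all_order all_algebra.
From mathcomp Require Import complex.
From mathcomp Require Import all_classical all_reals all_analysis.
From mathcomp Require Import measurable_realfun.
From mathcomp Require Import ring lra.

Set Implicit Arguments.
Unset Strict Implicit.
Unset Printing Implicit Defensive.

Import Order.TTheory GRing.Theory Num.Theory.
Import numFieldNormedType.Exports.

Local Open Scope classical_set_scope.
Local Open Scope ring_scope.

(** The dispersal operator spreads mass at the scale 1 / rho(t), which tends to
    0, so that in the interior of the domain the system behaves more and more
    like its kinetics dw/dt = f(w) - kappa w with kappa = n k. These kinetics are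
    cooperative, irreducible and subhomogeneous. By Perron's theorem ([perron],
    [spectral_boundE]) the number s(A) is the eigenvalue of a positive vector
    phi, and its sign decides between two regimes. If s(A) <= 0, there are
    arbitrarily small vectors p >> 0 at which the kinetic vector field is
    negative ([subcritical_barrier]). If s(A) > 0, there is a unique positive
    equilibrium w_e, and arbitrarily close to it there are vectors with a
    negative vector field as well as vectors with a positive one
    ([unique_equilibrium]).

    Such vectors yield barriers for the solutions of the full problem, by the
    argument of a first touching time ([first_touching]). All solutions stay in
    the order interval M ([solution_invariant]). Let p be a vector with negative
    vector field. Dispersal never raises a function above its maximum and
    subhomogeneity bounds f(alpha p) by alpha f(p) for alpha >= 1, so that
    alpha(t) p is an upper barrier as soon as the dilution rate is close to
    kappa, where alpha decreases exponentially to 1 ([upper_barrier]). This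
    gives convergence to 0 and stability in the first regime, and an asymptotic
    upper bound by w_e in the second one.

    Let now p have positive vector field. Dispersal loses mass through the
    boundary, so a constant is no lower barrier. It is replaced by
    alpha(t) s(y) p, where s is a paraboloid cut off at 0 ([cap]) around an
    interior point and alpha increases to 1 ([lower_barrier]). The point is
    that dispersal at a small scale loses at most a small fraction of s,
    uniformly up to the edge of its support ([disperse_cap]): a centred kernel
    lowers a paraboloid only by a constant of the order of the square of the
    scale, and close to the edge, where s itself is that small, the part of the
    kernel directed towards the centre yields a gain of the order of the scale.
    The barrier can be put below a solution that is bounded away from 0, and
    every nonzero solution is so at positive times: the zero set of a component
    is open and closed in the closure of the domain, since the kernel is
    positive near 0, and irreducibility excludes that only some of the
    components vanish ([strongly_positive]). As s is close to 1 near its centre,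
    covering a compact set by finitely many neighbourhoods of centres gives the
    asymptotic lower bound by w_e ([uniform_limit]). *)

(** * Functions of class C1 on R^m *)

Lemma continuous_sum_at {R : realType} {T : topologicalType} (I : finType)
    (F : I -> T -> R) (x : T) : (forall i, {for x, continuous (F i)}) ->
  {for x, continuous (fun y => \sum_i F i y)}.
Proof.
by move=> cF; apply: (@cvg_big R I +%R 0 xpredT _ _ _ _ F (F ^~ x)) => [|i _];
  [exact: add_continuous|exact: cF].
Qed.

Section coordinates.
Context {R : realType} {m : nat}.
Local Notation cV := 'cV[R]_m.
Implicit Types (w a b x : cV) (g : cV -> R).

Definition unit_cV (j : 'I_m) : cV := delta_mx j ord0.

Lemma unit_cVE j i : unit_cV j i ord0 = (i == j)%:R.
Proof. by rewrite mxE eqxx andbT. Qed.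

Lemma ball_cVE (c : cV) (e : R) : 0 < e ->
  ball c e = [set x | forall i, `|c i ord0 - x i ord0| < e].
Proof.
move=> e0; apply/seteqP; split => x; first by move=> [_ h] i; exact: h.
by move=> h; split => // i j; rewrite ord1; exact: h.
Qed.

Lemma continuous_cV_at (T : topologicalType) (h : T -> cV) (t : T) :
  (forall i, {for t, continuous (fun s => h s i ord0)}) ->
  {for t, continuous h}.
Proof.
move=> ch; apply/cvg_ballP => e e0; rewrite ball_cVE//=.
apply: filter_forall => i; have /cvg_ballP/(_ e e0) := ch i; exact.
Qed.

Lemma cV_box_compact (lo hi : 'I_m -> R) :
  compact [set w : cV | forall i, lo i <= w i ord0 <= hi i].
Proof.
pose B := [set w : 'rV[R]_m | forall i, `[lo i, hi i]%classic (w ord0 i)].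
have cB : compact B.
  apply: (@rV_compact R m (fun i => `[lo i, hi i]%classic)) => i.
  exact: segment_compact.
rewrite (_ : [set w | _] = trmx @` B).
  apply: continuous_compact cB; apply: continuous_subspaceT => w.
  apply: continuous_cV_at => i.
  rewrite (_ : (fun s => _) = (fun s : 'rV[R]_m => s ord0 i)).
    exact: coord_continuous.
  by apply/funext => s; rewrite mxE.
apply/seteqP; split => w /=.
  move=> h; exists w^T; last by rewrite trmxK.
  by move=> i; rewrite /= in_itv/= mxE.
by move=> [x h <-] i; rewrite mxE; have := h i; rewrite /= in_itv.
Qed.

Section partial.
Variable g : cV -> R.
Hypothesis g_C1 : class_C 1 g.

Definition partial j w : R := 'D_(unit_cV j) g w.

Lemma class_C1_continuous : continuous g. Proof. by case: g_C1. Qed.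

Lemma continuous_partial j : continuous (partial j).
Proof. by case: g_C1 => _ /(_ j ord0) [_ []]. Qed.

Lemma is_derive_partial j w (h : R) :
  is_derive h 1 (fun s : R => g (w + s *: unit_cV j))
    (partial j (w + h *: unit_cV j)).
Proof.
have dg : derivable g (w + h *: unit_cV j) (unit_cV j).
  by case: g_C1 => _ /(_ j ord0) [].
have E : (fun s : R => s^-1 *: (((fun s : R => g (w + s *: unit_cV j)) \o shift h)
   (s *: 1) - g (w + h *: unit_cV j))) =
   (fun s : R => s^-1 *: ((g \o shift (w + h *: unit_cV j)) (s *: unit_cV j) -
     g (w + h *: unit_cV j))).
  apply/funext => s; congr (_ *: (g _ - _)) => /=.
  by rewrite /shift/= [s *: 1]mulr1 scalerDl addrCA.
by split; rewrite /derivable /derive E.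
Qed.

Lemma partial_mvt j w (h : R) : exists2 t, 0 <= t <= 1 &
  g (w + h *: unit_cV j) - g w = partial j (w + (t * h) *: unit_cV j) * h.
Proof.
have c s : {for s, continuous (fun s : R => g (w + s *: unit_cV j))}.
  apply: differentiable_continuous; apply/derivable1_diffP.
  by have [] := is_derive_partial j w s.
have cw (A : set R) : {within A, continuous (fun s : R => g (w + s *: unit_cV j))}.
  by apply: continuous_subspaceT => s; exact: c.
have mvt p q : p <= q -> exists2 s, p <= s <= q &
    g (w + q *: unit_cV j) - g (w + p *: unit_cV j) =
    partial j (w + s *: unit_cV j) * (q - p).
  move=> pq; have [s spq E] := @MVT_segment _ (fun s : R => g (w + s *: unit_cV j))
    (fun s => partial j (w + s *: unit_cV j)) p q pq
    (fun s _ => is_derive_partial j w s) (cw _).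
  by exists s; [move: spq; rewrite in_itv|].
have [h0|h0|->] := ltgtP h 0; last first.
- by exists 0; rewrite ?lexx ?ler01// mulr0 scale0r addr0 subrr.
- have [s /andP[s0 sh]] := mvt 0 h (ltW h0).
  rewrite scale0r addr0 subr0 => ->; exists (s / h).
    by rewrite divr_ge0// ?(ltW h0)//= ler_pdivrMr// mul1r.
  by rewrite divfK// gt_eqF.
- have [s /andP[s0 sh]] := mvt h 0 (ltW h0).
  rewrite scale0r addr0 => E.
  exists (s / h); last by rewrite divfK ?lt_eqF// -[LHS]opprB E; ring.
  rewrite -mulrNN -invrN divr_ge0 ?oppr_ge0// ?(ltW h0)//=.
  by rewrite ler_pdivrMr ?oppr_gt0// mul1r lerN2.
Qed.

(** The path from [a] to [b] moves one coordinate at a time, so that the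
    intermediate points stay in any box containing [a] and [b], where the signs
    of the partial derivatives are known. *)
Lemma coordinate_mvt a b : exists2 xi : 'I_m -> cV,
  forall j l lo hi, lo <= a l ord0 <= hi -> lo <= b l ord0 <= hi ->
    lo <= xi j l ord0 <= hi &
  g b - g a = \sum_j partial j (xi j) * (b j ord0 - a j ord0).
Proof.
pose c (k : nat) : cV := \col_l (if (l < k)%N then b l ord0 else a l ord0).
have cS (j : 'I_m) : c j.+1 = c j + (b j ord0 - a j ord0) *: unit_cV j.
  apply/colP => l; rewrite !mxE !eqxx andbT ltnS leq_eqVlt val_eqE.
  have [->|lj] := eqVneq l j; first by rewrite ltnn/= mulr1 addrC subrK.
  by rewrite /= mulr0 addr0.
have /choice[t ht] : forall j : 'I_m, exists t : R, 0 <= t <= 1 /\ g (c j.+1) - g (c j) =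
    partial j (c j + (t * (b j ord0 - a j ord0)) *: unit_cV j) *
    (b j ord0 - a j ord0).
  by move=> j; rewrite cS; have [t] := partial_mvt j (c j) (b j ord0 - a j ord0);
    exists t.
exists (fun j : 'I_m => c j + (t j * (b j ord0 - a j ord0)) *: unit_cV j).
  move=> j l lo hi la lb; rewrite !mxE eqxx andbT.
  have [lj|lj] := eqVneq l j; last by rewrite mulr0 addr0; case: ifP.
  rewrite {l}lj in la lb *; rewrite ltnn mulr1; have [/andP[t0 t1] _] := ht j.
  move: la lb => /andP[a0 a1] /andP[b0 b1].
  by apply/andP; split; nra.
transitivity (g (c m) - g (c 0%N)).
  by congr (g _ - g _); apply/colP => l; rewrite mxE ?ltn_ord ?ltn0.
rewrite -(@telescope_sumr _ 0 m (fun k => g (c k)))// big_mkord.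
by apply: eq_bigr => j _; have [_] := ht j.
Qed.

Lemma lipschitz_box (lo hi : 'I_m -> R) : exists2 L : R, 0 <= L &
  forall a b (e : R), (forall i, lo i <= a i ord0 <= hi i) ->
    (forall i, lo i <= b i ord0 <= hi i) ->
    (forall i, `|b i ord0 - a i ord0| <= e) -> `|g b - g a| <= L * e.
Proof.
pose B := [set w : cV | forall i, lo i <= w i ord0 <= hi i].
have cB : compact B := @cV_box_compact lo hi.
have /choice[C hC] : forall j, exists C : R, forall w, B w -> `|partial j w| <= C.
  move=> j.
  have : compact (partial j @` B).
    by apply: continuous_compact cB; apply: continuous_subspaceT; exact: continuous_partial.
  move=> /compact_bounded[M [_ hM]].
  by exists (M + 1) => w Bw; apply: (hM (M + 1)); [rewrite ltrDl|exists w].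
exists (\sum_j `|C j|); first by apply: sumr_ge0.
move=> a b e Ba Bb ab; have [xi hxi ->] := coordinate_mvt a b.
rewrite mulr_suml (le_trans (ler_norm_sum _ _ _))//.
apply: ler_sum => j _; rewrite normrM ler_pM//.
apply: (@le_trans _ _ (C j)); last exact: ler_norm.
by apply: hC => i; exact: hxi.
Qed.

(** The first-order expansion along a ray, by which small multiples of an
    eigenvector of the Jacobian at 0 become sub- or supersolutions. *)
Lemma partial_at0 (phi : cV) (eta : R) : (forall i, 0 <= phi i ord0) -> 0 < eta ->
  \forall e \near 0^'+,
    `|g (e *: phi) - g 0 - e * \sum_j partial j 0 * phi j ord0| <= eta * e.
Proof.
move=> phi0 eta0.
pose eta' := eta / (1 + \sum_j phi j ord0).
have sphi : 0 <= \sum_j phi j ord0 by apply: sumr_ge0.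
have eta'0 : 0 < eta' by rewrite /eta' divr_gt0//; lra.
have : \forall w \near (0 : cV), forall j, `|partial j 0 - partial j w| < eta'.
  apply: (@filter_forall cV _ (fun j w => `|partial j 0 - partial j w| < eta')
    (nbhs (0 : cV)) _) => j.
  by have /cvgrPdist_lt := (@continuous_partial j 0); apply.
move=> /nbhs_ballP[r /= r0 hr].
near=> e.
have e0 : 0 < e by near: e; exact: nbhs_right_gt.
have [xi hxi E] := coordinate_mvt 0 (e *: phi).
rewrite E mulr_sumr -sumrB (le_trans (ler_norm_sum _ _ _))//.
have er : e * (1 + \sum_j phi j ord0) < r.
  rewrite -ltr_pdivlMr; last by lra.
  by near: e; apply: nbhs_right_lt; rewrite divr_gt0//; lra.
apply: (@le_trans _ _ (\sum_j eta' * (e * phi j ord0))); last first.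
  rewrite -mulr_sumr -mulr_sumr /eta' mulrCA [eta * e]mulrC ler_wpM2l ?(ltW e0)//.
  by rewrite -mulrA ler_piMr ?(ltW eta0)// mulrC ler_pdivrMr; lra.
apply: ler_sum => j _; rewrite !mxE subr0.
rewrite (_ : _ - _ = (partial j (xi j) - partial j 0) * (e * phi j ord0)); last by ring.
rewrite normrM [`|e * _|]ger0_norm ?mulr_ge0 ?(ltW e0)//.
rewrite ler_wpM2r ?mulr_ge0 ?(ltW e0)// distrC ltW//; apply: hr.
rewrite ball_cVE//= => i; rewrite mxE sub0r normrN.
have /andP[h1 h2] : 0 <= xi j i ord0 <= e * phi i ord0.
  by apply: hxi; rewrite !mxE ?lexx mulr_ge0 ?(ltW e0)// lexx.
rewrite ger0_norm//; apply: le_lt_trans er; apply: (le_trans h2).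
rewrite ler_wpM2l ?(ltW e0)// (bigD1 i)//= addrA addrAC lerDr.
by rewrite addr_ge0//; apply: sumr_ge0.
Unshelve. all: by end_near. Qed.

Lemma partial_gt0_incr j w (s : R) : `|s| = 1 -> 0 < partial j w ->
  \forall h \near 0^'+, 0 < s * (g (w + (s * h) *: unit_cV j) - g w).
Proof.
move=> s1 p0.
have : \forall x \near w, 0 < partial j x.
  by apply: (cvgr_gt _ (@continuous_partial j w)).
move=> /nbhs_ballP[r /= r0 hr].
near=> h.
have h0 : 0 < h by near: h; exact: nbhs_right_gt.
have hr' : h < r by near: h; exact: nbhs_right_lt.
have [t /andP[t0 t1] ->] := partial_mvt j w (s * h).
rewrite mulrCA mulr_gt0//.
  apply: hr; rewrite ball_cVE//= => i; rewrite !mxE eqxx andbT opprD addNKr normrN.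
  rewrite !normrM s1 mul1r.
  apply: le_lt_trans hr'; rewrite [`|t|]ger0_norm// [`|h|]gtr0_norm//.
  case: eqP => _; rewrite ?normr1 ?normr0 ?mulr1 ?mulr0 ?(ltW h0)//.
  by rewrite ler_piMl// ltW.
by rewrite mulrA -expr2 -real_normK ?num_real// s1 expr1n mul1r.
Unshelve. all: by end_near. Qed.

End partial.

(** A one-sided inequality that is strict in a single coordinate can be made
    strict in all of them by an arbitrarily small displacement, when the
    coupling between the coordinates is monotone and irreducible: each step
    moves one coordinate in which strictness already holds, and thereby makes a
    new coordinate strict. The sign [s] selects the direction both of the
    inequality and of the displacement. *)
Section spread.
Variables (G : 'I_m -> cV -> R) (U : set cV) (s : R).
Hypothesis U_open : open U.
Hypothesis G_cont : forall i, continuous (G i).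
Hypothesis s1 : `|s| = 1.
Hypothesis G_mono : forall w j, U w -> \forall h \near 0^'+, forall i, i != j ->
  0 <= s * (G i (w + (s * h) *: unit_cV j) - G i w).
Hypothesis G_irr : forall w (S : {set 'I_m}), U w ->
  S != finset.set0 -> S != [set: 'I_m]%SET -> exists i j, [/\ i \in S, j \notin S &
  \forall h \near 0^'+, 0 < s * (G i (w + (s * h) *: unit_cV j) - G i w)].

Lemma cvg_displace w j : (w + (s * h) *: unit_cV j) @[h --> 0^'+] --> w.
Proof.
have c : {for 0, continuous (fun h : R => w + (s * h) *: unit_cV j)}.
  apply: continuous_cV_at => i.
  have c1 : {for 0, continuous (fun h : R => w i ord0)} by exact: cst_continuous.
  have c2 : {for 0, continuous (fun h : R => s * h)} by exact: mulrl_continuous.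
  have c3 : {for 0, continuous (fun h : R => unit_cV j i ord0)} by exact: cst_continuous.
  rewrite (_ : (fun h : R => (w + (s * h) *: unit_cV j) i ord0) =
    (fun h : R => w i ord0 + s * h * unit_cV j i ord0)); last first.
    by apply/funext => h; rewrite !mxE.
  exact: (continuousD c1 (continuousM c2 c3)).
have := cvg_at_right_filter c.
by rewrite mulr0 scale0r addr0.
Qed.

Lemma spread w (e : R) : U w -> (forall i, 0 <= s * G i w) ->
  (exists i, 0 < s * G i w) -> 0 < e -> exists w' : cV, [/\ U w',
    forall i, 0 <= s * (w' i ord0 - w i ord0),
    forall i, `|w' i ord0 - w i ord0| < e &
    forall i, 0 < s * G i w'].
Proof.
pose S w := [set i | s * G i w <= 0]%SET.
have [k] := ubnP #|S w|; elim: k w e => // k IH w e Sk Uw G0 [i0 Gi0] e0.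
have ss (x : R) : s * (s * x) = x.
  by rewrite mulrA -expr2 -real_normK ?num_real// s1 expr1n mul1r.
have [S0|S0] := eqVneq (S w) finset.set0.
  exists w; split => // i; rewrite ?subrr ?mulr0 ?normr0//.
  have : i \notin S w by rewrite S0 inE.
  by rewrite inE -ltNge.
have ST : S w != [set: 'I_m]%SET.
  apply/eqP => ST; have : i0 \in S w by rewrite ST inE.
  by rewrite inE leNgt Gi0.
have [i [j [iS jS nG]]] := G_irr Uw S0 ST.
have near_pos l : \forall h \near 0^'+, l \notin S w ->
    0 < s * G l (w + (s * h) *: unit_cV j).
  case: (boolP (l \in S w)) => [lS|]; first by near=> h.
  rewrite inE -ltNge => Gl.
  have c : s * G l (w + (s * h) *: unit_cV j) @[h --> 0^'+] --> s * G l w.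
    apply: cvgMr; apply: continuous_cvg; first exact: G_cont.
    exact: cvg_displace.
  near=> h; move=> _; near: h.
  exact: (cvgr_gt _ c).
have [h] : exists h, [/\ 0 < h < e / 2, U (w + (s * h) *: unit_cV j),
   forall i, i != j -> 0 <= s * (G i (w + (s * h) *: unit_cV j) - G i w),
   0 < s * (G i (w + (s * h) *: unit_cV j) - G i w) &
   forall l, l \notin S w -> 0 < s * G l (w + (s * h) *: unit_cV j)].
  near (0 : R)^'+ => h; exists h; split.
  - apply/andP; split; first by near: h; exact: nbhs_right_gt.
    by near: h; apply: nbhs_right_lt; rewrite divr_gt0.
  - near: h; apply: cvg_displace; exact: open_nbhs_nbhs.
  - by near: h; exact: G_mono.
  - by near: h.
  - near: h; exact: (@filter_forall _ _ (fun l h => l \notin S w ->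
      0 < s * G l (w + (s * h) *: unit_cV j)) (0 : R)^'+ _ near_pos).
set w1 := w + _ => -[/andP[h0 he] Uw1 mono1 Gi1 pos1].
have w1E l : w1 l ord0 - w l ord0 = s * (h * (l == j)%:R).
  by rewrite !mxE eqxx andbT addrAC subrr add0r mulrA.
have G1 l : 0 <= s * G l w1.
  have [lS|/pos1/ltW//] := boolP (l \in S w).
  have lj : l != j by apply: contraNneq jS => <-.
  by have := mono1 l lj; rewrite mulrBr subr_ge0; apply: le_trans.
have Gi1' : 0 < s * G i w1.
  by move: Gi1; rewrite mulrBr subr_gt0; apply: le_lt_trans.
have S1 : (#|S w1| < k)%N.
  rewrite -ltnS; apply: leq_trans Sk; rewrite ltnS; apply: proper_card.
  apply/properP; split.
    apply/fintype.subsetP => l; rewrite inE => Gl; apply: contraTT Gl => /pos1.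
    by rewrite -ltNge.
  by exists i => //; rewrite inE -ltNge.
have e2 : 0 < e / 2 by rewrite divr_gt0.
have [w' [Uw' w'1 w'2 w'3]] := IH w1 (e / 2) S1 Uw1 G1 (ex_intro _ i Gi1') e2.
have h01 l : 0 <= h * (l == j)%:R <= h.
  by case: eqP => _; rewrite ?mulr1 ?mulr0 ?lexx ?(ltW h0).
exists w'; split => // l.
  rewrite (_ : _ - _ = (w' l ord0 - w1 l ord0) + (w1 l ord0 - w l ord0)); last by ring.
  rewrite mulrDr addr_ge0// w1E ss.
  by have /andP[] := h01 l.
rewrite (_ : _ - _ = (w' l ord0 - w1 l ord0) + (w1 l ord0 - w l ord0)); last by ring.
rewrite (le_lt_trans (ler_normD _ _))//.
rewrite w1E normrM s1 mul1r.
have /andP[h1 h2] := h01 l; rewrite [`|h * _|]ger0_norm//.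
have := w'2 l; lra.
Unshelve. all: by end_near. Qed.

End spread.
End coordinates.

(** * Cooperative irreducible matrices *)

Section perron.
Context {R : realType} {m : nat}.
Variable (A : 'M[R]_m).
Hypothesis m_gt0 : (0 < m)%N.
Hypothesis A_coop : cooperative A.
Hypothesis A_irr : irreducible A.
Local Notation cV := 'cV[R]_m.
Implicit Types (x y w : cV).

Lemma mulmx_coord x i : (A *m x) i ord0 = \sum_j A i j * x j ord0.
Proof. by rewrite mxE. Qed.

Lemma continuous_mulmx_coord i : continuous (fun x => (A *m x) i ord0).
Proof.
move=> x; rewrite (_ : (fun x => _) = (fun x => \sum_j A i j * x j ord0)); last first.
  by apply/funext => y; rewrite mxE.
apply: continuous_sum_at => j.
have c : {for x, continuous (fun=> A i j : R)} by exact: cst_continuous.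
exact: (continuousM c (@coord_continuous _ _ _ j ord0 x)).
Qed.

(** Increasing a coordinate in which the inequality is strict makes it strict in
    the coordinates that this one feeds, and irreducibility reaches all of
    them. *)
Lemma linear_spread (lambda : R) x : (forall i, lambda * x i ord0 <= (A *m x) i ord0) ->
  (exists i, lambda * x i ord0 < (A *m x) i ord0) ->
  exists y, (forall i, x i ord0 <= y i ord0) /\
    forall i, lambda * y i ord0 < (A *m y) i ord0.
Proof.
move=> x1 x2.
pose G i y := (A *m y) i ord0 - lambda * y i ord0.
have GE w j h i : i != j -> G i (w + h *: unit_cV j) - G i w = h * A i j.
  move=> ij; rewrite /G !mulmx_coord !mxE eqxx andbT (negbTE ij) mulr0 addr0.
  rewrite opprB addrA subrK -sumrB (bigD1 j)//= big1 ?addr0.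
    by rewrite !mxE !eqxx/= mulr1; ring.
  by move=> l lj; rewrite !mxE (negbTE lj)/= mulr0 addr0 subrr.
have [||||||||y [_ y1 _ y2]] := @spread _ _ G setT 1 _ _ _ _ _ x 1 Logic.I.
- exact: openT.
- move=> i w.
  have c : {for w, continuous (fun=> lambda)} by exact: cst_continuous.
  exact: (continuousB (@continuous_mulmx_coord i w)
    (continuousM c (@coord_continuous _ _ _ i ord0 w))).
- exact: normr1.
- move=> w j _; near=> h; move=> i ij; rewrite !mul1r GE// mulr_ge0 ?A_coop//.
- move=> w S _ S0 ST; have [i [j [iS jS Aij]]] := A_irr S0 ST.
  have ij : i != j by apply: contraNneq jS => <-.
  exists i, j; split => //; near=> h; rewrite !mul1r GE// mulr_gt0//.
  by rewrite lt_neqAle eq_sym Aij A_coop.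
- by move=> i; rewrite mul1r subr_ge0.
- by have [i xi] := x2; exists i; rewrite mul1r subr_gt0.
- exact: ltr01.
exists y; split => i.
  by have := y1 i; rewrite mul1r subr_ge0.
by have := y2 i; rewrite mul1r subr_gt0.
Unshelve. all: by end_near. Qed.

Let K : R := \sum_i \sum_j `|A i j|.

(** The Collatz-Wielandt pairs, normalized so that they form a compact set. *)
Let pairs : set (cV * R) := [set p : cV * R | [/\ forall i, 0 <= p.1 i ord0 <= 1,
  - K <= p.2 <= K, \sum_i p.1 i ord0 = 1 &
  forall i, p.2 * p.1 i ord0 <= (A *m p.1) i ord0]].

Let compact_pairs : compact pairs.
Proof.
pose B := [set x : cV | forall i, 0 <= x i ord0 <= 1] `*` `[- K, K]%classic.
have cB : compact B.
  by apply: compact_setX; [exact: cV_box_compact|exact: segment_compact].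
pose C1 := (fun p : cV * R => \sum_i p.1 i ord0) @^-1` [set x | x = 1].
pose C2 i := (fun p : cV * R => (A *m p.1) i ord0 - p.2 * p.1 i ord0) @^-1`
  [set x | 0 <= x].
have ccoord i : continuous (fun p : cV * R => p.1 i ord0).
  move=> p; apply: (@continuous_comp _ _ _ fst (fun x : cV => x i ord0)).
    exact: cvg_fst.
  exact: coord_continuous.
have -> : pairs = B `&` (C1 `&` \bigcap_(i in [set: 'I_m]) C2 i).
  apply/seteqP; split => p /=.
    move=> [p1 p2 p3 p4]; split; first by split => //=; rewrite in_itv.
    by split => // i _; rewrite /C2/= subr_ge0.
  move=> [[/= p1 p2] [p3 p4]]; split => //.
  by move=> i; have := p4 i Logic.I; rewrite /C2/= subr_ge0.
apply: compact_closedI => //; apply: closedI.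
  apply: closed_comp; last exact: closed_eq.
  move=> p _; apply: (@continuous_sum_at _ _ _ (fun i (p : cV * R) => p.1 i ord0)).
  by move=> i; exact: ccoord.
apply: closed_bigI => i _; apply: closed_comp; last exact: closed_ge.
move=> p _.
have c1 : {for p, continuous (fun p : cV * R => (A *m p.1) i ord0)}.
  apply: (@continuous_comp _ _ _ fst (fun x : cV => (A *m x) i ord0)).
    exact: cvg_fst.
  exact: continuous_mulmx_coord.
have c2 : {for p, continuous (fun p : cV * R => p.2)} by exact: cvg_snd.
exact: (continuousB c1 (continuousM c2 (@ccoord i p))).
Qed.

(** The largest [lambda] in a Collatz-Wielandt pair is attained at some [x]. If
    [A x = lambda x] failed there, [linear_spread] would give a pair with a
    larger [lambda]; and the zero coordinates of [x] would form a set on which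
    irreducibility fails. *)
Lemma perron : exists lambda : R, exists phi : cV,
  (forall i, 0 < phi i ord0) /\ A *m phi = lambda *: phi.
Proof.
have normalize (lambda : R) y : - K <= lambda -> (forall i, 0 <= y i ord0) ->
    0 < \sum_i y i ord0 ->
    (forall i, lambda * y i ord0 <= (A *m y) i ord0) ->
    pairs ((\sum_i y i ord0)^-1 *: y, lambda).
  move=> Kl y0 sy0 yl.
  pose z := (\sum_i y i ord0)^-1 *: y.
  have zi i : z i ord0 = (\sum_i y i ord0)^-1 * y i ord0 by rewrite mxE.
  have z0 i : 0 <= z i ord0 by rewrite zi mulr_ge0// invr_ge0 ltW.
  have sz : \sum_i z i ord0 = 1.
    by under eq_bigr do rewrite zi; rewrite -mulr_sumr mulVf ?gt_eqF.
  have z1 i : z i ord0 <= 1.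
    by rewrite -sz (bigD1 i)//= lerDl sumr_ge0.
  have zl i : lambda * z i ord0 <= (A *m z) i ord0.
    rewrite /z -scalemxAr !mxE mulrCA ler_wpM2l ?invr_ge0 ?(ltW sy0)//.
    by have := yl i; rewrite mxE.
  split => //=; first by move=> i; rewrite z0 z1.
  rewrite Kl/= -[lambda]mulr1 -sz mulr_sumr; apply: ler_sum => i _.
  apply: le_trans (zl i) _; rewrite mulmx_coord; apply: ler_sum => j _.
  by rewrite (le_trans (ler_norm _))// normrM (ger0_norm (z0 j)) ler_piMr.
have [p pP pmax] : exists2 p, p \in pairs & forall q, q \in pairs -> q.2 <= p.2.
  apply: compact_EVT_max => //; last first.
    by apply: continuous_subspaceT => p; exact: cvg_snd.
  pose y : cV := const_mx 1.
  exists ((\sum_i y i ord0)^-1 *: y, - K); apply: normalize => //.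
  - by move=> i; rewrite mxE.
  - under eq_bigr do rewrite mxE.
    by rewrite sumr_const card_ord pmulrn_lgt0.
  - move=> i; rewrite mulmx_coord mxE mulr1 lerNl -sumrN.
    apply: (@le_trans _ _ (\sum_j `|A i j|)).
      by apply: ler_sum => j _; rewrite mxE mulr1 -normrN ler_norm.
    by rewrite /K [leRHS](bigD1 i)//= lerDl; apply: sumr_ge0 => l _; exact: sumr_ge0.
move: pP; rewrite inE => -[]; set x := p.1; set lambda := p.2 => x01 /andP[Kl _] sx xl.
have x0 i : 0 <= x i ord0 by have /andP[] := x01 i.
exists lambda, x.
have Ax : A *m x = lambda *: x.
  apply/colP => i; apply/eqP; rewrite [X in _ == X]mxE eq_le.
  apply/andP; split; last exact: xl.
  rewrite leNgt.
  apply/negP => xi.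
  have [y [xy yl]] := linear_spread xl (ex_intro _ i xi).
  have y0 j : 0 <= y j ord0 by rewrite (le_trans (x0 j)).
  have sy : 0 < \sum_i y i ord0.
    by rewrite (@lt_le_trans _ _ 1)// -sx; apply: ler_sum.
  have nd j : \forall delta \near 0^'+, (lambda + delta) * y j ord0 <= (A *m y) j ord0.
    near=> delta; have d0 : 0 < delta by [].
    rewrite mulrDl -lerBrDl.
    have y1 : 0 < 1 + y j ord0 by rewrite ltr_pwDl.
    apply: (@le_trans _ _ (delta * (1 + y j ord0))).
      by rewrite ler_wpM2l ?(ltW d0)// lerDr.
    rewrite -ler_pdivlMr//; near: delta; apply: nbhs_right_le.
    by apply: divr_gt0; [rewrite subr_gt0|rewrite ltr_pwDl].
  have [delta [d0 yd]] : exists delta, 0 < delta /\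
      forall j, (lambda + delta) * y j ord0 <= (A *m y) j ord0.
    near (0 : R)^'+ => delta; exists delta; split => //.
    near: delta; exact: (@filter_forall _ _ (fun j delta =>
      (lambda + delta) * y j ord0 <= (A *m y) j ord0) (0 : R)^'+ _ nd).
  have Kld : - K <= lambda + delta by rewrite (le_trans Kl)// lerDl ltW.
  have := pmax _ (mem_set (normalize _ _ Kld y0 sy yd)).
  by rewrite /= -/lambda gerDl leNgt d0.
split => // i; rewrite lt_neqAle x0 andbT eq_sym; apply/negP => /eqP xi.
pose S := [set i | x i ord0 == 0]%SET.
have S0 : S != finset.set0 by apply/set0Pn; exists i; rewrite inE xi.
have ST : S != [set: 'I_m]%SET.
  apply/eqP => ST; have := sx; rewrite big1.
    by move=> /esym/eqP; rewrite oner_eq0.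
  move=> l _; have : l \in S by rewrite ST inE.
  by rewrite inE => /eqP.
have [a [b [aS bS Aab]]] := A_irr S0 ST.
have xa : x a ord0 = 0 by apply/eqP; move: aS; rewrite inE.
have xb : 0 < x b ord0 by rewrite lt_neqAle x0 andbT eq_sym; move: bS; rewrite inE.
have ab : a != b by apply: contraNneq bS => <-.
have : 0 < (A *m x) a ord0.
  rewrite mulmx_coord (bigD1 b)//= ltr_pwDl//.
    by rewrite mulr_gt0// lt_neqAle eq_sym Aab A_coop.
  apply: sumr_ge0 => l _; have [->|la] := eqVneq l a; first by rewrite xa mulr0.
  by rewrite mulr_ge0// A_coop// eq_sym.
by rewrite Ax mxE xa mulr0 ltxx.
Unshelve. all: by end_near. Qed.

End perron.

Section spectral_bound.
Context {R : realType} {m : nat}.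
Variables (A : 'M[R]_m) (lambda : R) (phi : 'cV[R]_m).
Hypothesis m_gt0 : (0 < m)%N.
Hypothesis A_coop : cooperative A.
Hypothesis phi_gt0 : forall i, 0 < phi i ord0.
Hypothesis A_phi : A *m phi = lambda *: phi.
Local Notation C x := (real_complex R x).
Let AC := map_mx (real_complex R) A.

(** After adding a multiple c of the identity the matrix is nonnegative.
    Pairing the moduli of a left eigenvector for [z] with the positive right
    eigenvector [phi] then gives [|z + c| <= lambda + c]. *)
Let Re_eigenvalue_le z : eigenvalue AC z -> complex.Re z <= lambda.
Proof.
move=> /eigenvalueP[u uA u0].
pose c := \sum_i `|A i i|.
have Ac i j : 0 <= A i j + c * (i == j)%:R.
  have [->|ij] := eqVneq i j; last by rewrite mulr0 addr0 A_coop.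
  rewrite mulr1 /c (bigD1 j)//= addrA addr_ge0//; last exact: sumr_ge0.
  by rewrite addrC -lerBlDr sub0r -normrN ler_norm.
have h j : `|z + C c| * `|u ord0 j| <=
    \sum_i `|u ord0 i| * C (A i j + c * (i == j)%:R).
  rewrite -normrM.
  have -> : (z + C c) * u ord0 j = \sum_i u ord0 i * C (A i j + c * (i == j)%:R).
    have := congr1 (fun M : 'rV_m => M ord0 j) uA; rewrite !mxE => uAj.
    rewrite mulrDl -uAj.
    under [RHS]eq_bigr do rewrite rmorphD mulrDr.
    rewrite big_split/=; congr (_ + _).
      by apply: eq_bigr => i _; rewrite mxE.
    rewrite (bigD1 j)//= big1 ?addr0 ?eqxx ?mulr1 1?mulrC// => i ij.
    by rewrite (negbTE ij) mulr0 rmorph0 mulr0.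
  apply: le_trans (ler_norm_sum _ _ _) _; apply: ler_sum => i _.
  by rewrite normrM [`|C _|]ger0_norm// lecR.
pose s := \sum_j `|u ord0 j| * C (phi j ord0).
have phiC j : 0 < C (phi j ord0) by rewrite ltcR.
have s0 : 0 < s.
  have [j uj] : exists j, u ord0 j != 0.
    apply/existsP; apply: contraNT u0 => /existsPn u0; apply/eqP/rowP => j.
    by rewrite mxE; apply/eqP; have := u0 j; rewrite negbK.
  rewrite /s (bigD1 j)//= ltr_pwDl ?mulr_gt0 ?normr_gt0//.
  by apply: sumr_ge0 => l _; rewrite mulr_ge0// ltW.
have : `|z + C c| * s <= C (lambda + c) * s.
  rewrite /s mulr_sumr; apply: (@le_trans _ _ (\sum_j
    (\sum_i `|u ord0 i| * C (A i j + c * (i == j)%:R)) * C (phi j ord0))).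
    by apply: ler_sum => j _; rewrite mulrA ler_pM2r.
  under eq_bigr do rewrite mulr_suml.
  rewrite exchange_big/= mulr_sumr; apply: ler_sum => i _.
  under eq_bigr do rewrite -mulrA -rmorphM.
  rewrite -mulr_sumr mulrCA ler_wpM2l// -rmorph_sum -rmorphM lecR.
  have := congr1 (fun M : 'cV_m => M i ord0) A_phi; rewrite !mxE => Ai.
  under eq_bigr do rewrite mulrDl.
  rewrite big_split/= Ai mulrDl lerD2l (bigD1 i)//= eqxx mulr1 big1 ?addr0//.
  by move=> l li; rewrite eq_sym (negbTE li) mulr0 mul0r.
rewrite ler_pM2r// => hz.
have := le_trans (normc_ge_Re (z + C c)) hz; rewrite lecR.
move=> /(le_trans (ler_norm _)); rewrite raddfD/=.
by rewrite lerD2r.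
Qed.

Let lambda_eigenvalue : eigenvalue AC (C lambda).
Proof.
rewrite /eigenvalue /eigenspace kermx_eq0 row_free_unit; apply/negP => uA.
have : (AC - (C lambda)%:M) *m map_mx (real_complex R) phi = 0.
  rewrite mulmxBl /AC -map_mxM A_phi map_mxZ mul_scalar_mx.
  by rewrite subrr.
move=> /(congr1 (mulmx (invmx (AC - (C lambda)%:M)))).
rewrite mulKmx// mulmx0 => /matrixP/(_ (Ordinal m_gt0) ord0).
rewrite !mxE => /eqP; rewrite fmorph_eq0.
by rewrite gt_eqF.
Qed.

Lemma spectral_boundE : spectral_bound A = lambda.
Proof.
rewrite /spectral_bound; set E := (X in sup X).
have El : E lambda by exists (C lambda).
have Eub : ubound E lambda by move=> _ [z zE <-]; exact: Re_eigenvalue_le.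
apply/eqP; rewrite eq_le; apply/andP; split.
  by apply: sup_le_ub => //; exists lambda.
by apply: ub_le_sup => //; exists lambda.
Qed.

End spectral_bound.

(** * The kinetics *)

Lemma interior_nonneg_coneP {R : realType} {m : nat} (w : 'cV[R]_m) :
  interior nonneg_cone w <-> forall i, 0 < w i ord0.
Proof.
split.
  move=> /nbhs_ballP[e /= e0 eC] i.
  have h : ball w e (w - const_mx (e / 2)).
    by rewrite ball_cVE//= => j; rewrite !mxE opprB addrCA subrr addr0 gtr0_norm; lra.
  have := eC _ h i; rewrite !mxE; lra.
move=> w0; apply: (@filter_forall _ _ (fun i (x : 'cV[R]_m) => 0 <= x i ord0)
  (nbhs w) _) => i.
have h : \forall x \near (w : 'cV[R]_m), 0 < (x : 'cV[R]_m) i ord0.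
  by apply: (cvgr_gt _ (@coord_continuous _ _ _ i ord0 w)).
by apply: filterS h => x /ltW.
Qed.

Lemma order_intervalP {R : realType} {m : nat} (v w : 'cV[R]_m) :
  order_interval v w <-> forall i, 0 <= w i ord0 <= v i ord0.
Proof.
split => [[h1 h2] i|h].
  have := h1 i; have := h2 i; rewrite !mxE; lra.
by split => i; have /andP[] := h i; rewrite !mxE; lra.
Qed.

Section reaction.
Context {R : realType} {m : nat}.
Variables (v : 'cV[R]_m) (f : 'cV[R]_m -> 'cV[R]_m).
Local Notation cV := 'cV[R]_m.
Local Notation M := (order_interval v).
Implicit Types (a b w p : cV) (alpha : R).
Hypothesis v_gt0 : forall i, 0 < v i ord0.
Hypothesis f_C1 : class_C1 f.
Hypothesis f_coop : forall w, M w ->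
  cooperative (Jacobian f w) /\ irreducible (Jacobian f w).
Hypothesis f0 : f 0 = 0.
Hypothesis f_sub : forall w alpha, (M `&` interior nonneg_cone) w ->
  0 < alpha < 1 -> vlt (alpha *: f w) (f (alpha *: w)).

Local Notation fi := (fun i w => f w i ord0).

Let f_C1i i : class_C 1 (fi i). Proof. exact: f_C1. Qed.

Let JE w i j : Jacobian f w i j = partial (fi i) j w.
Proof. by rewrite mxE. Qed.

Lemma continuous_reaction i : continuous (fi i).
Proof. exact: class_C1_continuous. Qed.

Lemma reaction0 i : f 0 i ord0 = 0.
Proof. by rewrite f0 mxE. Qed.

(** Along the coordinatewise path from [a] to [b] only the off-diagonal
    derivatives of the i-th component contribute. *)
Lemma reaction_mono a b i : M a -> M b -> (forall j, a j ord0 <= b j ord0) ->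
  a i ord0 = b i ord0 -> f a i ord0 <= f b i ord0.
Proof.
move=> /order_intervalP Ma /order_intervalP Mb ab abi.
have [xi hxi E] := coordinate_mvt (f_C1i i) a b.
rewrite -subr_ge0 E; apply: sumr_ge0 => j _.
have [->|ij] := eqVneq j i; first by rewrite abi subrr mulr0.
rewrite mulr_ge0 ?subr_ge0// -JE.
have [|coop _] := f_coop (w := xi j); last by apply: coop; rewrite eq_sym.
by apply/order_intervalP => l; exact: hxi.
Qed.

Lemma orderI_scale alpha w : 0 <= alpha <= 1 -> M w -> M (alpha *: w).
Proof.
move=> /andP[a0 a1] /order_intervalP Mw; apply/order_intervalP => i; rewrite mxE.
have /andP[w0 w1] := Mw i; rewrite mulr_ge0//=.
by rewrite (le_trans _ w1)// ler_piMl.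
Qed.

(** Inequalities between continuous functions extend from the vectors of M with
    positive coordinates to M. *)
Lemma orderI_closure (g : cV -> R) : continuous g ->
  (forall w, M w -> (forall i, 0 < w i ord0) -> 0 <= g w) ->
  forall w, M w -> 0 <= g w.
Proof.
move=> cg gpos w /order_intervalP Mw; rewrite leNgt; apply/negP => gw.
have h : {for 0, continuous (fun s : R => w + s *: (v - w))}.
  apply: continuous_cV_at => i.
  rewrite (_ : (fun s => _) = (fun s : R => w i ord0 + s * (v - w) i ord0)); last first.
    by apply/funext => s; rewrite !mxE.
  have c1 : {for 0, continuous (fun _ : R => w i ord0)} by exact: cst_continuous.
  have c2 : {for 0, continuous (fun _ : R => (v - w) i ord0)} by exact: cst_continuous.
  have c3 : {for 0, continuous (fun s : R => s)} by exact: cvg_id.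
  exact: (continuousD c1 (continuousM c3 c2)).
have hg : {for 0, continuous (fun s : R => g (w + s *: (v - w)))}.
  by apply: (continuous_comp h); exact: cg.
have : \forall s \near 0^'+, g (w + s *: (v - w)) < 0.
  apply: (@cvgr_lt _ _ _ _ _ (g w)) => //.
  by have := cvg_at_right_filter hg; rewrite scale0r addr0.
move=> near_neg.
near (0 : R)^'+ => s.
have : g (w + s *: (v - w)) < 0 by near: s.
have s0 : 0 < s by [].
have s1 : s < 1 by near: s; exact: nbhs_right_lt.
rewrite ltNge gpos//.
  apply/order_intervalP => i; rewrite !mxE; have := Mw i; have := v_gt0 i.
  move=> vi /andP[w0 wv]; apply/andP; split; nra.
by move=> i; rewrite !mxE; have := Mw i; have := v_gt0 i => vi /andP[w0 wv]; nra.
Unshelve. all: by end_near. Qed.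

(** Subhomogeneity extends to the faces of M by continuity. *)
Lemma reaction_sub alpha w i : 0 < alpha <= 1 -> M w ->
  alpha * f w i ord0 <= f (alpha *: w) i ord0.
Proof.
move=> /andP[a0]; rewrite le_eqVlt => /predU1P[->|a1] Mw.
  by rewrite mul1r scale1r.
rewrite -subr_ge0.
have c1 : continuous (fun w => f (alpha *: w) i ord0 - alpha * f w i ord0).
  move=> x.
  have h1 : {for x, continuous (fun x : cV => alpha *: x)}.
    by apply: (@continuousZr _ _ _ id); exact: cvg_id.
  have h2 : {for x, continuous (fun x : cV => f (alpha *: x) i ord0)}.
    exact: (continuous_comp h1 (@continuous_reaction i _)).
  have h3 : {for x, continuous (fun _ : cV => alpha)} by exact: cst_continuous.
  exact: (continuousB h2 (continuousM h3 (@continuous_reaction i x))).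
apply: (orderI_closure c1) Mw => x Mx x0.
have [] := @f_sub x alpha; first by split => //; exact/interior_nonneg_coneP.
  by rewrite a0 a1.
by move=> /(_ i); rewrite !mxE.
Qed.

Lemma reaction_sub_lt alpha w : 0 < alpha < 1 -> M w -> (forall i, 0 < w i ord0) ->
  exists i, alpha * f w i ord0 < f (alpha *: w) i ord0.
Proof.
move=> a01 Mw w0.
have [] := @f_sub w alpha; [by split => //; exact/interior_nonneg_coneP|by []|].
move=> h1 h2; apply: contrapT => /forallNP h; apply: h2.
apply/colP => i; rewrite mxE; apply/eqP; rewrite eq_le; apply/andP; split.
  by have := h1 i; rewrite !mxE subr_ge0.
by rewrite leNgt; apply/negP; exact: h.
Qed.

(** This is subhomogeneity at [alpha *: w] with the factor [alpha^-1]. *)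
Lemma reaction_super alpha w i : 1 <= alpha -> M (alpha *: w) ->
  f (alpha *: w) i ord0 <= alpha * f w i ord0.
Proof.
move=> a1 Maw; have a0 : 0 < alpha by rewrite (lt_le_trans ltr01).
have := @reaction_sub alpha^-1 (alpha *: w) i.
rewrite scalerA mulVf ?gt_eqF// scale1r invr_gt0 a0 invf_le1// a1.
move=> /(_ isT Maw).
by rewrite mulrC ler_pdivrMr// mulrC.
Qed.

(** By subhomogeneity [f (e *: w) / e] increases, as [e] decreases to 0, to the
    derivative at 0 in the direction [w]. *)
Lemma reaction_le_linear w i : M w -> f w i ord0 <= (Jacobian f 0 *m w) i ord0.
Proof.
move=> Mw; have w0 j : 0 <= w j ord0 by have /order_intervalP/(_ j)/andP[] := Mw.
have -> : (Jacobian f 0 *m w) i ord0 = \sum_j partial (fi i) j 0 * w j ord0.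
  by rewrite mxE; apply: eq_bigr => j _; rewrite JE.
apply/ler_addgt0Pr => eta eta0.
have h := partial_at0 (f_C1i i) w0 eta0.
near (0 : R)^'+ => e.
have e0 : 0 < e by [].
have e1 : e <= 1 by near: e; exact: nbhs_right_le.
have : `|f (e *: w) i ord0 - f 0 i ord0 - e * \sum_j partial (fi i) j 0 * w j ord0|
  <= eta * e by near: e.
rewrite reaction0 subr0 => /(le_trans (ler_norm _)); rewrite lerBlDl => h2.
have := reaction_sub i (_ : 0 < e <= 1) Mw; rewrite e0 e1 => /(_ isT) h3.
rewrite -(ler_pM2l e0) (le_trans h3)// (le_trans h2)//.
by rewrite mulrDr [eta * e]mulrC.
Unshelve. all: by end_near. Qed.

(** Subhomogeneity with the factor 1/2 is strict in some coordinate, and the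
    linearization bounds the reaction at [w / 2]. *)
Lemma reaction_lt_linear w : M w -> (forall i, 0 < w i ord0) ->
  exists i, f w i ord0 < (Jacobian f 0 *m w) i ord0.
Proof.
move=> Mw w0; have h12 : 0 < (2^-1 : R) < 1 by apply/andP; split; lra.
have [i hi] := reaction_sub_lt h12 Mw w0; exists i.
have Mw2 : M (2^-1 *: w) by apply: orderI_scale => //; apply/andP; split; lra.
have := reaction_le_linear i Mw2; rewrite -scalemxAr mxE; lra.
Qed.

(** On the faces of the cone the reaction points inwards. *)
Lemma reaction_ge0 w i : M w -> w i ord0 = 0 -> 0 <= f w i ord0.
Proof.
move=> Mw wi; rewrite -(reaction0 i); apply: reaction_mono => //.
- by apply/order_intervalP => j; rewrite mxE lexx ltW.
- by move=> j; rewrite mxE; have /order_intervalP/(_ j)/andP[] := Mw.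
- by rewrite mxE.
Qed.

(** Irreducibility gives a vanishing coordinate [i] that some positive
    coordinate [j] strictly promotes. Decreasing the j-th coordinate of [w]
    keeps the i-th component of [f] nonnegative, so that it was positive. *)
Lemma reaction_face w : M w -> (exists i, w i ord0 != 0) -> (exists i, w i ord0 = 0) ->
  exists i, w i ord0 = 0 /\ 0 < f w i ord0.
Proof.
move=> Mw [i1 wi1] [i2 wi2].
have Mw' := (order_intervalP v w).1 Mw.
pose S := [set i | w i ord0 == 0]%SET.
have S0 : S != finset.set0 by apply/set0Pn; exists i2; rewrite inE wi2.
have ST : S != [set: 'I_m]%SET.
  apply/eqP => ST; have : i1 \in S by rewrite ST inE.
  by rewrite inE (negbTE wi1).
have [coop irr] := f_coop Mw.
have [i [j [iS jS Aij]]] := irr S S0 ST.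
have wi : w i ord0 = 0 by apply/eqP; move: iS; rewrite inE.
have wj : 0 < w j ord0.
  by have /andP[w0 _] := Mw' j; rewrite lt_neqAle w0 andbT eq_sym; move: jS; rewrite inE.
have ij : i != j by apply: contraNneq jS => <-.
exists i; split => //.
have Pij : 0 < partial (fi i) j w by rewrite -JE lt_neqAle eq_sym Aij coop.
have N1 : `|(-1 : R)| = 1 by rewrite normrN1.
have := partial_gt0_incr (f_C1i i) N1 Pij.
move=> h; near (0 : R)^'+ => e.
have e0 : 0 < e by [].
have ew : e <= w j ord0 by near: e; exact: nbhs_right_le.
have : 0 < -1 * (f (w + (-1 * e) *: unit_cV j) i ord0 - f w i ord0) by near: e.
rewrite !mulN1r opprB subr_gt0; apply: le_lt_trans.
apply: reaction_ge0; last by rewrite !mxE eqxx andbT (negbTE ij) mulr0 addr0.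
apply/order_intervalP => l; rewrite !mxE eqxx andbT; have /andP[l0 l1] := Mw' l.
have [->|_] := eqVneq l j; last by rewrite mulr0 addr0 l0.
rewrite mulr1; have /andP[j0 j1] := Mw' j; apply/andP; split; lra.
Unshelve. all: by end_near. Qed.

Section equilibria.
Variable kappa : R.

(** The i-th component of the vector field of the kinetics under dilution at the
    constant rate [kappa]. *)
Definition net i w : R := f w i ord0 - kappa * w i ord0.

Let U : set cV := [set w | forall i, 0 < w i ord0 < v i ord0].

Lemma orderI_interior w : U w -> M w.
Proof.
by move=> Uw; apply/order_intervalP => i; have /andP[h1 h2] := Uw i; rewrite !ltW.
Qed.

Lemma continuous_net i : continuous (net i).
Proof.
move=> w; have c1 : {for w, continuous (fun _ : cV => kappa)} by exact: cst_continuous.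
exact: (continuousB (@continuous_reaction i w)
  (continuousM c1 (@coord_continuous _ _ _ i ord0 w))).
Qed.

Lemma net_mono a b i : M a -> M b -> (forall j, a j ord0 <= b j ord0) ->
  a i ord0 = b i ord0 -> net i a <= net i b.
Proof. by move=> Ma Mb ab abi; rewrite /net abi lerD2r reaction_mono. Qed.

Lemma net_sub alpha w i : 0 < alpha <= 1 -> M w ->
  alpha * net i w <= net i (alpha *: w).
Proof.
by move=> a01 Mw; rewrite /net mxE mulrBr mulrCA lerD2r reaction_sub.
Qed.

Lemma net_super alpha w i : 1 <= alpha -> M (alpha *: w) ->
  net i (alpha *: w) <= alpha * net i w.
Proof.
by move=> a1 Mw; rewrite /net mxE mulrBr mulrCA lerD2r reaction_super.
Qed.

Lemma net_spread (s : R) w (e : R) : `|s| = 1 -> U w ->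
  (forall i, 0 <= s * net i w) -> (exists i, 0 < s * net i w) -> 0 < e ->
  exists w' : cV, [/\ U w', forall i, `|w' i ord0 - w i ord0| < e &
    forall i, 0 < s * net i w'].
Proof.
move=> s1 Uw G0 Gi e0.
have oU : open U.
  rewrite openE => x Ux; apply: (@filter_forall _ _
    (fun i (y : cV) => 0 < y i ord0 < v i ord0) (nbhs x) _) => i.
  have /andP[x0 xv] := Ux i.
  have n1 : \forall y \near (x : cV), 0 < (y : cV) i ord0.
    by apply: (cvgr_gt _ (@coord_continuous _ _ _ i ord0 x)).
  have n2 : \forall y \near (x : cV), (y : cV) i ord0 < v i ord0.
    by apply: (cvgr_lt _ (@coord_continuous _ _ _ i ord0 x)).
  by near=> y; apply/andP; split; near: y.
have near_U x j : U x -> \forall h \near 0^'+, U (x + (s * h) *: unit_cV j).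
  move=> Ux; exact: (cvg_displace s j (open_nbhs_nbhs (conj oU Ux))).
have netE x j h i : i != j -> net i (x + (s * h) *: unit_cV j) - net i x =
    f (x + (s * h) *: unit_cV j) i ord0 - f x i ord0.
  by move=> ij; rewrite /net !mxE eqxx andbT (negbTE ij) mulr0 addr0; ring.
have [||||||||w' [Uw' _ w'1 w'2]] := @spread _ _ net U s _ _ _ _ _ w e Uw.
- exact: oU.
- exact: continuous_net.
- exact: s1.
- move=> x j Ux; near=> h; move=> i ij; have h0 : 0 < h by [].
  have Ux' : U (x + (s * h) *: unit_cV j) by near: h; exact: near_U.
  have xi : x i ord0 = (x + (s * h) *: unit_cV j) i ord0.
    by rewrite !mxE (negbTE ij) mulr0 addr0.
  rewrite netE//.
  have [s0|s0] := leP 0 s.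
    rewrite mulr_ge0// subr_ge0; apply: reaction_mono => //; try exact: orderI_interior.
    by move=> l; rewrite !mxE lerDl !mulr_ge0// ltW.
  rewrite mulr_le0// ?(ltW s0)// subr_le0.
  apply: reaction_mono => //; try exact: orderI_interior.
  by move=> l; rewrite !mxE gerDl mulr_le0_ge0// mulr_le0_ge0// ltW.
- move=> x S Ux S0 ST.
  have [coop irr] := f_coop (orderI_interior Ux).
  have [i [j [iS jS Aij]]] := irr S S0 ST; exists i, j; split => //.
  have ij : i != j by apply: contraNneq jS => <-.
  have Pij : 0 < partial (fi i) j x by rewrite -JE lt_neqAle eq_sym Aij coop.
  have := partial_gt0_incr (f_C1i i) s1 Pij.
  by apply: filterS => h; rewrite netE.
- exact: G0.
- exact: Gi.
- exact: e0.
by exists w'.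
Unshelve. all: by end_near. Qed.

Variables (lambda : R) (phi : cV).
Hypothesis phi_gt0 : forall i, 0 < phi i ord0.
Hypothesis phi_eigen : forall i,
  (Jacobian f 0 *m phi) i ord0 = (lambda + kappa) * phi i ord0.

Lemma small_multiple (e : R) : 0 < e -> \forall c \near 0^'+,
  forall i, c * phi i ord0 < e /\ c * phi i ord0 < v i ord0.
Proof.
move=> e0; apply: (@filter_forall _ _ (fun i c =>
  c * phi i ord0 < e /\ c * phi i ord0 < v i ord0) (0 : R)^'+ _) => i.
near=> c; rewrite -!ltr_pdivlMr//.
by split; near: c; apply: nbhs_right_lt; rewrite divr_gt0.
Unshelve. all: by end_near. Qed.

(** The reaction lies below its linearization, strictly in some coordinate, so
    that a small multiple of the Perron vector has a nonpositive and nonzero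
    vector field, which [net_spread] makes negative in all coordinates. *)
Lemma subcritical_barrier (e : R) : lambda <= 0 -> 0 < e -> exists p,
  [/\ M p, forall i, 0 < p i ord0 < e & forall i, net i p < 0].
Proof.
move=> l0 e0; have e20 : 0 < e / 2 by rewrite divr_gt0.
near (0 : R)^'+ => c; have c0 : 0 < c by [].
have hc : forall i, c * phi i ord0 < e / 2 /\ c * phi i ord0 < v i ord0.
  by near: c; exact: small_multiple.
have Uw : U (c *: phi).
  by move=> i; rewrite mxE mulr_gt0//=; have [] := hc i.
have le i : (Jacobian f 0 *m (c *: phi)) i ord0 - kappa * (c *: phi) i ord0 <= 0.
  rewrite -scalemxAr mxE phi_eigen mxE.
  rewrite (_ : _ - _ = lambda * (c * phi i ord0)); last by ring.
  by rewrite mulr_le0_ge0// mulr_ge0 ?ltW.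
have Mw := orderI_interior Uw.
have [|||p [Up pe pn]] := @net_spread (-1) (c *: phi) (e / 2) (normrN1 _) Uw.
- move=> i; rewrite mulN1r oppr_ge0 (le_trans _ (le i))// lerD2r.
  exact: reaction_le_linear.
- have [i hi] := reaction_lt_linear Mw (fun i => proj1 (andP (Uw i))).
  exists i; rewrite mulN1r oppr_gt0 (lt_le_trans _ (le i))// ltrD2r//.
- exact: e20.
exists p; split; first exact: orderI_interior.
- move=> i; have /andP[-> _]/= := Up i.
  have := pe i; rewrite mxE ltr_norml => /andP[_]; have [] := hc i; lra.
- by move=> i; have := pn i; rewrite mulN1r oppr_gt0.
Unshelve. all: by end_near. Qed.

Hypothesis net_top : forall i w, M w -> w i ord0 = v i ord0 -> net i w < 0.

Definition equilibrium w := [/\ M w, exists i, w i ord0 != 0 &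
  forall i, net i w = 0].

Let sub_equilibria : set cV := [set w | M w /\ forall i, 0 <= net i w].

(** The supremum of the subequilibria, taken in each coordinate. It turns out to
    be a subequilibrium by monotonicity, and then an equilibrium. *)
Let top_sub : cV := \col_i sup [set w i ord0 | w in sub_equilibria].

Let sub_equilibria0 : sub_equilibria 0.
Proof.
split; first by apply/order_intervalP => i; rewrite mxE lexx ltW.
by move=> i; rewrite /net reaction0 mxE mulr0 subrr.
Qed.

Let le_top_sub w : sub_equilibria w -> forall i, w i ord0 <= top_sub i ord0.
Proof.
move=> Sw i; rewrite mxE; apply: ub_le_sup; last by exists w.
by exists (v i ord0) => _ [x [/order_intervalP/(_ i)/andP[_ xv] _] <-].
Qed.

Let top_sub_M : M top_sub.
Proof.
apply/order_intervalP => i; apply/andP; split.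
  by have := le_top_sub sub_equilibria0 i; rewrite [X in X <= _]mxE.
rewrite mxE; apply: ge_sup; first by exists 0, 0; rewrite ?mxE.
by move=> _ [x [/order_intervalP/(_ i)/andP[_ xv] _] <-].
Qed.

Let replace w i (x : R) : cV := w + (x - w i ord0) *: unit_cV i.

Let replaceE w i x j : replace w i x j ord0 = if j == i then x else w j ord0.
Proof.
rewrite !mxE eqxx andbT; have [->|_] := eqVneq j i.
  by rewrite mulr1 addrC subrK.
by rewrite mulr0 addr0.
Qed.

(** Were the i-th component negative at the supremum, it would be negative at a
    nearby vector that agrees in the i-th coordinate with some subequilibrium and
    dominates it, against monotonicity. *)
Let top_sub_net_ge0 i : 0 <= net i top_sub.
Proof.
rewrite leNgt; apply/negP => ni.
have : \forall w \near top_sub, net i w < 0.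
  by apply: (cvgr_lt _ (@continuous_net i top_sub)).
move=> /nbhs_ballP[r /= r0 hr].
have [_ [w Sw <-] wr] : exists2 x, [set w i ord0 | w in sub_equilibria] x &
    sup [set w i ord0 | w in sub_equilibria] - r < x.
  apply: sup_adherent => //; split; first by exists 0, 0; rewrite ?mxE.
  by exists (v i ord0) => _ [x [/order_intervalP/(_ i)/andP[_ xv] _] <-].
have wi := le_top_sub Sw i.
have [Mw nw] := Sw.
have /hr : ball top_sub r (replace top_sub i (w i ord0)).
  rewrite ball_cVE//= => j; rewrite replaceE; case: eqP => [->|_].
    by rewrite ger0_norm ?subr_ge0// mxE; lra.
  by rewrite subrr normr0.
rewrite ltNge (le_trans (nw i))//; apply: net_mono => //.
- apply/order_intervalP => j; rewrite replaceE; case: eqP => [->|_].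
    by have /order_intervalP := Mw.
  by have /order_intervalP := top_sub_M.
- by move=> j; rewrite replaceE; case: eqP => [->//|_]; exact: le_top_sub.
- by rewrite replaceE eqxx.
Qed.

Let top_sub_lt i : top_sub i ord0 < v i ord0.
Proof.
have /order_intervalP/(_ i)/andP[_] := top_sub_M.
rewrite le_eqVlt => /predU1P[E|//]; have := net_top top_sub_M E.
by rewrite ltNge top_sub_net_ge0.
Qed.

(** Raising the i-th coordinate keeps a subequilibrium one as long as its own
    net growth stays nonnegative, so this growth vanishes at the top. *)
Let top_sub_net i : net i top_sub = 0.
Proof.
apply/eqP; rewrite eq_le top_sub_net_ge0 andbT leNgt; apply/negP => ni.
have : \forall w \near top_sub, 0 < net i w.
  by apply: (cvgr_gt _ (@continuous_net i top_sub)).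
move=> /(cvg_displace 1 i) h.
near (0 : R)^'+ => e.
have e0 : 0 < e by [].
have ev : e <= v i ord0 - top_sub i ord0.
  by near: e; apply: nbhs_right_le; rewrite subr_gt0; exact: top_sub_lt.
have : 0 < net i (top_sub + (1 * e) *: unit_cV i) by near: e.
rewrite mul1r; set w := top_sub + _ => nw.
have wE j : w j ord0 = if j == i then top_sub i ord0 + e else top_sub j ord0.
  rewrite [w j ord0]mxE [X in _ + X]mxE unit_cVE.
  have [->|_] := eqVneq j i; first by rewrite mulr1.
  by rewrite mulr0 addr0.
have Mt j : 0 <= top_sub j ord0 <= v j ord0 by have /order_intervalP := top_sub_M.
have Mw : M w.
  apply/order_intervalP => j; rewrite wE; case: eqP => [->|_ //].
  by have /andP[t0 t1] := Mt i; apply/andP; split; lra.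
have : sub_equilibria w.
  split => // j; have [->|ji] := eqVneq j i; first exact: ltW.
  rewrite (le_trans (top_sub_net_ge0 j))//; apply: net_mono => //.
    by move=> l; rewrite wE; case: eqP => [->|_//]; rewrite lerDl ltW.
  by rewrite wE (negbTE ji).
move=> /le_top_sub/(_ i); rewrite wE eqxx.
by rewrite gerDl leNgt e0.
Unshelve. all: by end_near. Qed.

Hypothesis m_gt0 : (0 < m)%N.
Hypothesis lambda_gt0 : 0 < lambda.

(** For a positive eigenvalue small multiples of the Perron vector are
    subequilibria. *)
Let top_sub_gt0 i : 0 < top_sub i ord0.
Proof.
near (0 : R)^'+ => c; have c0 : 0 < c by [].
have hc : forall i, c * phi i ord0 < 1 /\ c * phi i ord0 < v i ord0.
  by near: c; exact: small_multiple.
have Mw : M (c *: phi).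
  by apply/order_intervalP => j; rewrite mxE mulr_ge0 ?ltW//=; have [] := hc j.
have h : forall j, `|f (c *: phi) j ord0 - f 0 j ord0 -
    c * \sum_l partial (fi j) l 0 * phi l ord0| <= (lambda * phi j ord0) * c.
  near: c; apply: (@filter_forall _ _ (fun j c =>
    `|f (c *: phi) j ord0 - f 0 j ord0 -
     c * \sum_l partial (fi j) l 0 * phi l ord0| <= (lambda * phi j ord0) * c)
    (0 : R)^'+ _) => j.
  apply: partial_at0 => //; first by move=> l; rewrite ltW.
  by rewrite mulr_gt0.
have : sub_equilibria (c *: phi).
  split => // j; have := h j; rewrite reaction0 subr0 ler_norml => /andP[h1 _].
  have E : \sum_l partial (fi j) l 0 * phi l ord0 = (lambda + kappa) * phi j ord0.
    by rewrite -phi_eigen mxE; apply: eq_bigr => l _; rewrite JE.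
  rewrite E in h1; rewrite /net mxE.
  by move: h1; rewrite lerBrDr; move=> h1; rewrite subr_ge0 (le_trans _ h1)//; lra.
move=> /le_top_sub/(_ i); apply: lt_le_trans; by rewrite mxE mulr_gt0.
Unshelve. all: by end_near. Qed.

Let top_sub_U : U top_sub.
Proof. by move=> i; rewrite top_sub_gt0 top_sub_lt. Qed.

Let i0 : 'I_m := Ordinal m_gt0.

Let close_multiple (e : R) : 0 < e -> \forall d \near 0^'+,
  forall i, d * top_sub i ord0 < e /\ (1 + d) * top_sub i ord0 < v i ord0.
Proof.
move=> e0; apply: (@filter_forall _ _ (fun i d =>
  d * top_sub i ord0 < e /\ (1 + d) * top_sub i ord0 < v i ord0) (0 : R)^'+ _) => i.
have t0 := top_sub_gt0 i; have tv := top_sub_lt i.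
near=> d; rewrite mulrDl mul1r -ltrBrDl -!ltr_pdivlMr//.
by split; near: d; apply: nbhs_right_lt; rewrite divr_gt0// subr_gt0.
Unshelve. all: by end_near. Qed.

(** By subhomogeneity the equilibrium times a factor slightly below 1 is a
    subequilibrium, strictly so in some coordinate; [net_spread] makes it strict
    in all of them. With a factor above 1 one obtains [barrier_above]. *)
Lemma barrier_below (e : R) : 0 < e -> exists p, [/\ M p, forall i, 0 < p i ord0,
  forall i, `|p i ord0 - top_sub i ord0| < e & forall i, 0 < net i p].
Proof.
move=> e0; have e20 : 0 < e / 2 by rewrite divr_gt0.
near (0 : R)^'+ => d; have d0 : 0 < d by [].
have d1 : d < 1 by near: d; exact: nbhs_right_lt.
have hd : forall i, d * top_sub i ord0 < e / 2 /\ (1 + d) * top_sub i ord0 < v i ord0.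
  by near: d; exact: close_multiple.
have d01 : 0 < 1 - d < 1 by apply/andP; split; lra.
have Uw : U ((1 - d) *: top_sub).
  move=> i; rewrite mxE; have := top_sub_gt0 i; have := top_sub_lt i.
  move: d01 => /andP[d2 d3] t1 t2; rewrite mulr_gt0//=.
  by rewrite (lt_trans _ t1)// gtr_pMl.
have [|||p [Up pe pn]] := @net_spread 1 _ (e / 2) (normr1 _) Uw.
- move=> i; rewrite mul1r; apply: le_trans (net_sub i _ top_sub_M).
    by rewrite top_sub_net mulr0.
  by move: d01 => /andP[-> /ltW ->].
- have [i hi] := reaction_sub_lt d01 top_sub_M top_sub_gt0.
  exists i; rewrite mul1r /net mxE mulrCA.
  have := top_sub_net i; rewrite /net => /subr0_eq E.
  by rewrite -E subr_gt0.
- exact: e20.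
exists p; split; first exact: orderI_interior.
- by move=> i; have /andP[] := Up i.
- move=> i; rewrite (_ : _ - _ = (p i ord0 - ((1 - d) *: top_sub) i ord0) +
    - (d * top_sub i ord0)); last by rewrite [X in _ - X + _]mxE; ring.
  rewrite (le_lt_trans (ler_normD _ _))// normrN [`|d * _|]gtr0_norm.
    by have := pe i; have [] := hd i; lra.
  by rewrite mulr_gt0.
- by move=> i; have := pn i; rewrite mul1r.
Unshelve. all: by end_near. Qed.

Lemma barrier_above (e : R) : 0 < e -> exists p, [/\ M p, forall i, 0 < p i ord0,
  forall i, `|p i ord0 - top_sub i ord0| < e & forall i, net i p < 0].
Proof.
move=> e0; have e20 : 0 < e / 2 by rewrite divr_gt0.
near (0 : R)^'+ => d; have d0 : 0 < d by [].
have hd : forall i, d * top_sub i ord0 < e / 2 /\ (1 + d) * top_sub i ord0 < v i ord0.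
  by near: d; exact: close_multiple.
have d1 : 0 < 1 + d by lra.
have Uw : U ((1 + d) *: top_sub).
  by move=> i; rewrite mxE mulr_gt0//=; have [] := hd i.
have Mw := orderI_interior Uw.
have [|||p [Up pe pn]] := @net_spread (-1) _ (e / 2) (normrN1 _) Uw.
- move=> i; rewrite mulN1r oppr_ge0; apply: le_trans (net_super i _ Mw) _; first lra.
  by rewrite top_sub_net mulr0.
- have d01 : 0 < (1 + d)^-1 < 1 by rewrite invr_gt0 d1 invf_lt1//; lra.
  have [i hi] := reaction_sub_lt d01 Mw (fun i => proj1 (andP (Uw i))).
  exists i; rewrite mulN1r /net mxE oppr_gt0 subr_lt0.
  move: hi; rewrite scalerA mulVf ?gt_eqF// scale1r mulrC ltr_pdivrMr//.
  have := top_sub_net i; rewrite /net => /subr0_eq ->.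
  by rewrite mulrA; congr (_ < _); ring.
- exact: e20.
exists p; split; first exact: orderI_interior.
- by move=> i; have /andP[] := Up i.
- move=> i; rewrite (_ : _ - _ = (p i ord0 - ((1 + d) *: top_sub) i ord0) +
    (d * top_sub i ord0)); last by rewrite [X in _ - X + _]mxE; ring.
  rewrite (le_lt_trans (ler_normD _ _))// [`|d * _|]gtr0_norm.
    by have := pe i; have [] := hd i; lra.
  by rewrite mulr_gt0.
- by move=> i; have := pn i; rewrite mulN1r oppr_gt0.
Unshelve. all: by end_near. Qed.

(** Let [q] be the smallest ratio [w j / p j], attained at [i]. Then [q *: p]
    touches [w] from below at the i-th coordinate, and if [q < 1] its vector
    field there is positive by subhomogeneity, whereas that of [w] vanishes. *)
Lemma barrier_le_equilibrium w p : equilibrium w -> M p ->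
  (forall i, 0 < p i ord0) -> (forall i, 0 < net i p) ->
  forall i, p i ord0 <= w i ord0.
Proof.
move=> [Mw w0 nw] Mp p0 np.
have w_ge0 i : 0 <= w i ord0 by have /order_intervalP/(_ i)/andP[] := Mw.
have w_gt0 i : 0 < w i ord0.
  rewrite lt_neqAle w_ge0 andbT eq_sym; apply/negP => /eqP wi.
  have [j [wj fj]] := reaction_face Mw w0 (ex_intro _ i wi).
  by have := nw j; rewrite /net wj mulr0 subr0 => E; rewrite E ltxx in fj.
pose q i := w i ord0 / p i ord0.
case: (@arg_minP _ _ _ i0 xpredT q isT) => i _ qmin.
have [qi|qi] := leP 1 (q i).
  move=> j; have := le_trans qi (qmin j isT).
  by rewrite /q ler_pdivlMr// mul1r.
have qi0 : 0 < q i by rewrite divr_gt0.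
have qi01 : 0 < q i <= 1 by rewrite qi0 ltW.
have Mqp : M (q i *: p) by apply: orderI_scale => //; rewrite ltW//= ltW.
have : net i (q i *: p) <= net i w.
  apply: net_mono => //.
    by move=> j; rewrite mxE -ler_pdivlMr//; exact: qmin.
  by rewrite mxE /q divfK// gt_eqF.
rewrite nw leNgt (lt_le_trans _ (net_sub i qi01 Mp))//.
by rewrite mulr_gt0.
Qed.

Lemma unique_equilibrium : exists w_e, [/\ unique equilibrium w_e,
  forall e : R, 0 < e -> exists p, [/\ M p, forall i, 0 < p i ord0,
    forall i, `|p i ord0 - w_e i ord0| < e & forall i, 0 < net i p] &
  forall e : R, 0 < e -> exists p, [/\ M p, forall i, 0 < p i ord0,
    forall i, `|p i ord0 - w_e i ord0| < e & forall i, net i p < 0]].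
Proof.
exists top_sub; split; [split| exact: barrier_below|exact: barrier_above].
  split; [exact: top_sub_M| |exact: top_sub_net].
  by exists i0; rewrite gt_eqF// top_sub_gt0.
move=> w Ew; apply/colP => i; apply/eqP; rewrite eq_le; apply/andP; split.
  apply/ler_addgt0Pr => e e0; have [p [Mp p0 pe pn]] := barrier_below e0.
  have := barrier_le_equilibrium Ew Mp p0 pn i.
  by have := pe i; rewrite ltr_norml => /andP[]; lra.
by apply: le_top_sub; have [Mw _ nw] := Ew; split => // j; rewrite nw.
Qed.

End equilibria.
End reaction.

(** * Lebesgue measure on R^n *)

Section measurability.
Context {R : realType} {n : nat}.
Local Notation RT := (measurableTypeR R).
Local Notation rV := 'rV[RT]_n.

Lemma measurable_rV_coord (i : 'I_n) :
  measurable_fun [set: rV] (fun x : rV => x ord0 i : RT).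
Proof.
move=> _ Y mY; rewrite setTI; apply: sub_sigma_algebra => /=.
rewrite -bigcup_seq/=; exists i => /=; first by rewrite mem_index_enum.
by exists Y => //; rewrite setTI.
Qed.

Lemma ball_rVE (c : 'rV[R]_n) (r : R) : 0 < r ->
  ball c r = [set x | forall i, `|c ord0 i - x ord0 i| < r].
Proof.
move=> r0; apply/seteqP; split => x.
  by move=> [_ h] i; exact: h.
by move=> h; split => // i j; rewrite ord1; exact: h.
Qed.

Lemma measurable_ball_rV (c : 'rV[R]_n) (r : R) : 0 < r ->
  measurable (ball c r : set rV).
Proof.
move=> r0.
rewrite [X in measurable X](_ : _ = \bigcap_(i in [set: 'I_n])
    ((fun x : rV => x ord0 i : RT) @^-1` ball (c ord0 i) r)); last first.
  by rewrite ball_rVE//; apply/seteqP; split => x /= h i; [move=> _|]; exact: h.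
apply: fin_bigcap_measurable => // i _.
rewrite -[X in measurable X]setTI; apply: measurable_rV_coord => //.
by rewrite ball_itv; exact: measurable_itv.
Qed.

(** An open set is the union of the balls with rational centre and radius that it
    contains. *)
Lemma open_measurable_rV (U : set 'rV[R]_n) : open U ->
  measurable (U : set rV).
Proof.
move=> oU.
pose F (p : 'rV[rat]_n * rat) : set 'rV[R]_n :=
  if pselect (0 < (ratr p.2 : R) /\
      ball (map_mx ratr p.1 : 'rV[R]_n) (ratr p.2) `<=` U)
  then ball (map_mx ratr p.1 : 'rV[R]_n) (ratr p.2) else set0.
rewrite [X in measurable X](_ : _ = \bigcup_p F p); last first.
  apply/seteqP; split => x; last first.
    by move=> [p _]; rewrite /F; case: pselect => // -[_ h] /h.
  move=> Ux.
  have [e /= e0 eU] := (proj1 (nbhs_ballP x U)) (open_nbhs_nbhs (conj oU Ux)).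
  have e20 : 0 < e / 2 by rewrite divr_gt0.
  have [q] := rat_in_itvoo e20.
  rewrite in_itv/= => /andP[q0 qe].
  have cP i : exists s : rat, `|ratr s - x ord0 i| < (ratr q : R).
    have [s] : exists s, ratr s \in `](x ord0 i - ratr q), (x ord0 i + ratr q)[.
      by apply: rat_in_itvoo; rewrite ltrBlDr -addrA ltrDl addr_gt0.
    by rewrite in_itv/= => /andP[h1 h2]; exists s; rewrite ltr_distl h1 h2.
  have /choice[c hc] := cP.
  exists (\row_i c i, q) => //; rewrite /F /=.
  have xb : ball (map_mx ratr (\row_i c i) : 'rV[R]_n) (ratr q) x.
    by rewrite ball_rVE// => i; rewrite !mxE; exact: hc.
  case: pselect => //= -[]; split => // y yb.
  apply: eU; apply: (ball_split (z := (map_mx ratr (\row_i c i) : 'rV[R]_n))).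
    by apply: (le_ball (ltW qe)); exact: ball_sym.
  exact: (le_ball (ltW qe)).
apply: countable_bigcupT_measurable => [|p].
  exact: countableP.
rewrite /F; case: (pselect _) => [[h _]|_] /=; last exact: measurable0.
exact: measurable_ball_rV.
Qed.

Lemma continuous_measurable_rV (D : set 'rV[R]_n) (g : 'rV[R]_n -> R) :
  open D -> {in D, continuous g} -> measurable_fun (D : set rV) (g : rV -> RT).
Proof.
move=> oD cg; apply: (measurability _ (RGenOpens.measurableE R)).
move=> _ [_ [a [b ->] <-]]; apply: open_measurable_rV.
move: cg; rewrite -(continuous_open_subspace g oD) => /continuousP.
move=> /(_ _ (@interval_open _ (BRight a) (BLeft b) isT isT)).
move/open_subspaceP => [V oV]; rewrite setIC => VE.
by rewrite [X in open X]setIC -VE; exact: openI.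
Qed.

End measurability.

Section tonelli.
Context {R : realType}.
Local Notation RT := (measurableTypeR R).
Local Open Scope ereal_scope.

Lemma lebesgue_tuple_sigma_finite n :
  sigma_finite setT (@lebesgue_tuple R n).
Proof.
elim: n => [|n IH].
  exists (fun=> setT) => [|k]; first by rewrite bigcup_const.
  by split => //=; rewrite diracE mem_set// ltry.
have /sigma_finiteP[/= F [TF ndF Foo]] := IH.
have /sigma_finiteP[/= G [TG ndG Goo]] := sigma_finiteT (@lebesgue_measure R).
pose u (t : n.+1.-tuple RT) : (n.-tuple RT * RT)%type :=
  ([tuple of behead t], thead t).
have mu_ : measurable_fun setT u.
  apply/measurable_fun_pairP; split => /=; last exact: measurable_tnth.
  apply/measurable_fun_tnthP => i.
  rewrite (_ : _ \o _ = fun t : n.+1.-tuple RT => tnth t (lift ord0 i)).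
    exact: measurable_tnth.
  by apply/funext => t /=; rewrite [in RHS](tuple_eta t) tnthS.
exists (fun k => u @^-1` (F k `*` G k)).
  apply/esym/seteqP; split => // t _.
  have : [set: n.-tuple RT] (u t).1 by [].
  rewrite TF => -[k _ Fk].
  have : [set: RT] (u t).2 by [].
  rewrite TG => -[l _ Gl].
  exists (maxn k l) => //; split.
    by move: (u t).1 Fk; exact/subsetPset/ndF/leq_maxl.
  by move: (u t).2 Gl; exact/subsetPset/ndG/leq_maxr.
move=> k; have [mF Fk] := Foo k; have [mG Gk] := Goo k.
split.
  by rewrite -[X in measurable X]setTI; apply: mu_ => //; exact: measurableX.
rewrite /= /pushforward (_ : _ @^-1` _ = F k `*` G k); last first.
  apply/seteqP; split => -[t a] /=; rewrite /u /tuple_snoc /= theadE;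
  rewrite (_ : [tuple of _] = t)//; exact/val_inj.
rewrite product_measure1E// lte_mul_pinfty// ge0_fin_numE//.
Qed.

(** [lebesgue_tuple n] as a bare set function, on which the structure of
    sigma-finite measure that Tonelli's theorem asks for can be declared. *)
Definition lebesgue_tuple_fun n : set (n.-tuple RT) -> \bar R :=
  lebesgue_tuple n.

HB.instance Definition _ n := Measure.copy (@lebesgue_tuple_fun n) (lebesgue_tuple n).
HB.instance Definition _ n := @Measure_isSigmaFinite.Build _ _ _
  (@lebesgue_tuple_fun n) (lebesgue_tuple_sigma_finite n).

Lemma ge0_integral_lebesgue_tupleS n (g : n.+1.-tuple RT -> \bar R) :
  measurable_fun setT g -> (forall t, 0 <= g t) ->
  measurable_fun setT
    (fun t : n.-tuple RT => \int[lebesgue_measure]_a g [tuple of a :: t]) /\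
  \int[lebesgue_tuple n.+1]_t g t =
  \int[lebesgue_tuple n]_t \int[lebesgue_measure]_a g [tuple of a :: t].
Proof.
move=> mg g0.
pose m1 : {sigma_finite_measure set (n.-tuple RT) -> \bar R} :=
  [the {sigma_finite_measure set (n.-tuple RT) -> \bar R} of @lebesgue_tuple_fun n].
pose G (p : n.-tuple RT * RT) := g (tuple_snoc p).
have mG : measurable_fun setT G.
  by apply: measurableT_comp; [exact: mg|exact: measurable_tuple_snoc].
have G0 p : 0 <= G p by exact: g0.
split.
  exact: (@measurable_fun_fubini_tonelli_F _ _ _ _ _ lebesgue_measure G mG G0).
rewrite ge0_integral_pushforward//=; last exact: measurable_tuple_snoc.
rewrite preimage_setT.
exact: (@fubini_tonelli1 _ _ _ _ _ m1 lebesgue_measure G mG G0).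
Qed.

Lemma measurable_fun_subM (y r : R) :
  measurable_fun setT (fun a : RT => (r * (y - a))%R : RT).
Proof.
by apply: measurable_funM => //; apply: measurable_funB.
Qed.

Lemma ge0_integral_lebesgue_subM (y r : R) (g : RT -> \bar R) : (0 < r)%R ->
  measurable_fun setT g -> (forall t, 0 <= g t) ->
  r%:E * \int[lebesgue_measure]_a g (r * (y - a))%R =
  \int[lebesgue_measure]_a g a.
Proof.
move=> r0 mg g0.
have mphi := measurable_fun_subM y r.
pose r' := NngNum (ltW r0).
pose mu' : {measure set RT -> \bar R} :=
  image_measure (@lebesgue_measure R) mphi.
rewrite [LHS](_ : _ = \int[mscale r' mu']_a g a).
  apply: eq_measure_integral => A mA _.
  apply/esym/lebesgue_measure_unique => //= _ [[a b] /= _ <-].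
  rewrite /mscale/= /pushforward.
  rewrite (_ : _ @^-1` _ = `[(y - b / r)%R, (y - a / r)%R[%classic); last first.
    apply/funext => t; apply/propext; rewrite /= !in_itv/=.
    rewrite mulrC -ltr_pdivrMr// -ler_pdivlMr//.
    by rewrite lerBlDr -lerBlDl ltrBrDr -ltrBrDl andbC.
  rewrite !lebesgue_measure_itv/= !lte_fin ltrD2l ltrN2 ltr_pM2r ?invr_gt0//.
  case: ifPn => ab; last by rewrite mule0.
  rewrite -!EFinD -EFinM; congr EFin.
  by field; rewrite gt_eqF.
by rewrite ge0_integral_mscale//= ge0_integral_pushforward//= preimage_setT.
Qed.

Lemma ge0_integral_lebesgue_tuple_subM n (y : 'I_n -> R) (r : R)
    (g : n.-tuple RT -> \bar R) : (0 < r)%R ->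
  measurable_fun setT g -> (forall t, 0 <= g t) ->
  (r ^+ n)%:E *
    \int[lebesgue_tuple n]_t g [tuple (r * (y i - tnth t i))%R | i < n] =
  \int[lebesgue_tuple n]_t g t.
Proof.
move=> r0; elim: n y g => [|n IH] y g mg g0.
  rewrite expr0 mul1e; apply: eq_integral => t _; congr g.
  by rewrite tuple0 [RHS]tuple0.
pose T m (z : 'I_m -> R) (t : m.-tuple RT) : m.-tuple RT :=
  [tuple (r * (z i - tnth t i))%R | i < m].
have mT m (z : 'I_m -> R) : measurable_fun setT (T m z).
  apply/measurable_fun_tnthP => i.
  rewrite (_ : _ \o _ = (fun a : RT => (r * (z i - a))%R : RT) \o (@tnth m RT ^~ i)).
    exact: measurableT_comp (measurable_fun_subM _ _) (measurable_tnth _).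
  by apply/funext => t /=; rewrite tnth_mktuple.
have TS (t : n.-tuple RT) (a : RT) : T n.+1 y [tuple of a :: t] =
    [tuple of (r * (y ord0 - a))%R :: T n (y \o lift ord0) t].
  apply: eq_from_tnth => i; rewrite tnth_mktuple.
  have [->|i0] := eqVneq i ord0; first by rewrite !tnth0.
  have [j ->] : exists j, i = lift ord0 j.
    by case: (unliftP ord0 i) i0 => [j ->|->]; [exists j|rewrite eqxx].
  by rewrite !tnthS tnth_mktuple.
have mgT : measurable_fun setT (g \o T n.+1 y).
  by apply: measurableT_comp; [exact: mg|exact: mT].
have [_ ->] := @ge0_integral_lebesgue_tupleS n (g \o T n.+1 y) mgT (fun=> g0 _).
have [mG ->] := @ge0_integral_lebesgue_tupleS n g mg g0.
have G0 (t : n.-tuple RT) : 0 <= \int[lebesgue_measure]_a g [tuple of a :: t].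
  by apply: integral_ge0 => a _; exact: g0.
rewrite -[RHS](IH (y \o lift ord0) _ mG G0).
rewrite exprSr EFinM -muleA; congr (_ * _).
have mG' := (@ge0_integral_lebesgue_tupleS n (g \o T n.+1 y) mgT (fun=> g0 _)).1.
have G0' (t : n.-tuple RT) : 0 <= \int[lebesgue_measure]_a (g \o T n.+1 y) [tuple of a :: t].
  by apply: integral_ge0 => a _; exact: g0.
transitivity (\int[lebesgue_tuple n]_t
   (r%:E * \int[lebesgue_measure]_a (g \o T n.+1 y) [tuple of a :: t])).
  by apply/esym; apply: ge0_integralZl => //; rewrite lee_fin ltW.
apply: eq_integral => t _.
rewrite -[RHS](@ge0_integral_lebesgue_subM (y ord0) r)//.
  by congr (_ * _); apply: eq_integral => a _; exact: (congr1 g (TS t a)).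
apply: measurableT_comp => //.
apply: measurable_cons => //.
Qed.

Lemma ge0_integral_lebesgue_rV n (g : 'rV[RT]_n -> \bar R) :
  measurable_fun setT g -> (forall t, 0 <= g t) ->
  \int[lebesgue_rV n]_x g x = \int[lebesgue_tuple n]_t g (rV_of_tuple t).
Proof.
move=> mg g0; rewrite ge0_integral_pushforward ?preimage_setT//=.
exact: measurable_rV_of_tuple.
Qed.

Lemma measurable_rVP d (T : measurableType d) n (h : T -> 'rV[RT]_n) :
  (forall i, measurable_fun setT (fun t => h t ord0 i : RT)) ->
  measurable_fun setT h.
Proof.
move=> mh; rewrite (_ : h = @rV_of_tuple _ RT n \o
    (fun t => [tuple (h t ord0 i : RT) | i < n])).
  apply: measurableT_comp; first exact: measurable_rV_of_tuple.
  apply/measurable_fun_tnthP => i.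
  rewrite (_ : _ \o _ = (fun t => h t ord0 i : RT)); first exact: mh.
  by apply/funext => t /=; rewrite tnth_mktuple.
by apply/funext => t; apply/rowP => i; rewrite /= mxE tnth_mktuple.
Qed.

(** The change of variables x = r (y - z). *)
Lemma ge0_integral_rV_subM n (y : 'rV[R]_n) (r : R) (g : 'rV[RT]_n -> \bar R) :
  (0 < r)%R -> measurable_fun setT g -> (forall t, 0 <= g t) ->
  (r ^+ n)%:E * \int[lebesgue_rV n]_z g (r *: (y - z))%R =
  \int[lebesgue_rV n]_x g x.
Proof.
move=> r0 mg g0; rewrite !ge0_integral_lebesgue_rV//.
  rewrite -[RHS](@ge0_integral_lebesgue_tuple_subM n (fun i => y ord0 i) r)//.
    congr (_ * _); apply: eq_integral => t _; congr g.
    by apply/rowP => i; rewrite !mxE tnth_mktuple.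
  by apply: measurableT_comp => //; exact: measurable_rV_of_tuple.
apply: measurableT_comp; first exact: mg.
apply: measurable_rVP => i.
under eq_fun do rewrite !mxE.
apply: measurableT_comp (measurable_fun_subM _ _) (measurable_rV_coord i).
Qed.

Lemma lebesgue_tuple_cube n (a : 'I_n -> R) (h : R) : (0 <= h)%R ->
  lebesgue_tuple n [set t : n.-tuple RT |
    forall i, (a i <= tnth t i <= a i + h)%R] = (h ^+ n)%:E.
Proof.
move=> h0; elim: n a => [|n IH] a.
  by rewrite /= diracE mem_set// => -[].
rewrite /= /pushforward [X in product_measure1 _ _ X](_ : _ =
  [set t : n.-tuple RT | forall i, (a (lift ord0 i) <= tnth t i <=
     a (lift ord0 i) + h)%R] `*` (`[a ord0, (a ord0 + h)%R]%classic : set RT)).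
  rewrite product_measure1E//=; last first.
    rewrite (_ : [set t | _] = \bigcap_(i in [set: 'I_n])
       ((@tnth n RT ^~ i) @^-1` `[a (lift ord0 i), (a (lift ord0 i) + h)%R])).
      apply: fin_bigcap_measurable => // i _.
      by rewrite -[X in measurable X]setTI; exact: measurable_tnth.
    apply/seteqP; split => t /= H i; first by rewrite /= in_itv/=; move=> _; exact: H.
    by have := H i Logic.I; rewrite /= in_itv.
  rewrite (IH (fun i => a (lift ord0 i))) lebesgue_measure_itv/= lte_fin.
  rewrite -EFinD addrAC subrr add0r exprSr ltrDl.
  by case: ltgtP h0 => // <- _; rewrite !mulr0 mule0.
apply/seteqP; split => -[t x] /=.
  move=> H; split.
    by move=> i; have := H (lift ord0 i); rewrite tnthS.
  by rewrite in_itv/=; have := H ord0; rewrite tnth0.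
move=> [H1]; rewrite in_itv/= => H2 i.
case: (unliftP ord0 i) => [j|] ->; first by rewrite tnthS.
by rewrite tnth0.
Qed.

Lemma lebesgue_rV_cube n (a : 'I_n -> R) (h : R) : (0 <= h)%R ->
  lebesgue_rV n [set x : 'rV[RT]_n |
    forall i, (a i <= x ord0 i <= a i + h)%R] = (h ^+ n)%:E.
Proof.
move=> h0; rewrite -(lebesgue_tuple_cube a h0).
transitivity (lebesgue_tuple n (@rV_of_tuple _ RT n @^-1`
  [set x | forall i, (a i <= x ord0 i <= a i + h)%R])); first by [].
congr (Measure.sort _ _).
by apply/seteqP; split => t /= H i; have := H i; rewrite mxE.
Qed.

Lemma measurable_cube n (a : 'I_n -> R) (h : R) :
  measurable [set x : 'rV[RT]_n | forall i, (a i <= x ord0 i <= a i + h)%R].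
Proof.
rewrite (_ : [set t | _] = \bigcap_(i in [set: 'I_n])
  ((fun x : 'rV[RT]_n => x ord0 i : RT) @^-1` `[a i, (a i + h)%R])).
  apply: fin_bigcap_measurable => // i _.
  by rewrite -[X in measurable X]setTI; exact: measurable_rV_coord.
apply/seteqP; split => t /= H i; first by rewrite /= in_itv/=; move=> _; exact: H.
by have := H i Logic.I; rewrite /= in_itv.
Qed.

End tonelli.

(** * Dispersal *)

Section kernel.
Context {R : realType} {n : nat}.
Local Notation RT := (measurableTypeR R).
Local Notation mu := (@lebesgue_rV R n).
Variables (Om : set 'rV[R]_n) (J : 'rV[R]_n -> R).
Hypothesis Om_open : open Om.
Hypothesis J_kernel : dispersal_kernel J.

Implicit Types (r c : R) (x y z : 'rV[R]_n) (w g : 'rV[R]_n -> R).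

Let J_cont : continuous J. Proof. by case: J_kernel. Qed.
Let J_ge0 x : 0 <= J x. Proof. by case: J_kernel. Qed.

(** The operator [dispersal] on a single component. *)
Definition disperse (r : R) (w : 'rV[R]_n -> R) (y : 'rV[R]_n) : R :=
  Rint_rV Om (fun z => rescaled J r (y - z) * w z).

Definition bounded_measurable (w : 'rV[R]_n -> R) : Prop :=
  measurable_fun (Om : set 'rV[RT]_n) (w : 'rV[RT]_n -> RT) /\
  exists M : R, forall z, Om z -> `|w z| <= M.

Lemma rescaled_ge0 r x : 0 <= r -> 0 <= rescaled J r x.
Proof. by move=> r0; rewrite /rescaled mulr_ge0// exprn_ge0. Qed.

Lemma measurable_Om : measurable (Om : set 'rV[RT]_n).
Proof. exact: open_measurable_rV. Qed.

Lemma continuous_rescaled (r : R) (y : 'rV[R]_n) :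
  continuous (fun z : 'rV[R]_n => rescaled J r (y - z)).
Proof.
move=> z.
have h0 : {for z, continuous (fun z : 'rV[R]_n => r *: (y - z))}.
  apply: (@continuousZr _ _ _ (fun z : 'rV[R]_n => y - z)).
  apply: (@continuousB _ _ _ (fun=> y) id); first exact: cst_continuous.
  exact: cvg_id.
have h1 : {for z, continuous (J \o (fun z : 'rV[R]_n => r *: (y - z)))}.
  by apply: continuous_comp; [exact: h0|exact: J_cont].
have h2 : {for z, continuous (fun=> r ^+ n : R)} by exact: cst_continuous.
exact: (continuousM h2 h1).
Qed.

Lemma measurable_J : measurable_fun setT (J : 'rV[RT]_n -> RT).
Proof.
apply: continuous_measurable_rV; first exact: openT.
by move=> x _; exact: J_cont.
Qed.

Lemma measurable_rescaled r y :
  measurable_fun setT ((fun z => rescaled J r (y - z)) : 'rV[RT]_n -> RT).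
Proof.
apply: continuous_measurable_rV; first exact: openT.
by move=> x _; exact: continuous_rescaled.
Qed.

Lemma measurable_rV_subM (y : 'rV[R]_n) (r : R) :
  measurable_fun setT ((fun z => r *: (y - z)) : 'rV[RT]_n -> 'rV[RT]_n).
Proof.
apply: measurable_rVP => i; under eq_fun do rewrite !mxE.
exact: measurableT_comp (measurable_fun_subM _ _) (measurable_rV_coord i).
Qed.

Lemma ge0_integral_rescaled r y (g : 'rV[R]_n -> R) : 0 < r ->
  measurable_fun setT (g : 'rV[RT]_n -> RT) -> (forall x, 0 <= g x) ->
  (\int[mu]_z (rescaled J r (y - z) * g z)%:E =
   \int[mu]_x (J x * g (y - r^-1 *: x))%:E)%E.
Proof.
move=> r0 mg g0.
pose h (x : 'rV[RT]_n) : RT := J x * g (y - r^-1 *: x).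
have mh : measurable_fun setT h.
  apply: measurable_funM; first exact: measurable_J.
  apply: measurableT_comp; first exact: mg.
  apply: measurable_rVP => i; under eq_fun do rewrite !mxE.
  apply: measurable_funB => //; apply: measurable_funM => //.
  exact: measurable_rV_coord.
have h0 x : 0 <= h x by rewrite /h mulr_ge0.
rewrite -[RHS](@ge0_integral_rV_subM _ _ y r (EFin \o h))//; last exact/measurable_EFinP.
rewrite -ge0_integralZl//; last 2 first.
- by move=> x _; rewrite lee_fin.
- by rewrite lee_fin exprn_ge0// ltW.
- apply: eq_integral => z _; rewrite -EFinM; congr EFin.
  rewrite /rescaled /h mulrA; congr (_ * g _).
  by rewrite scalerA mulVf ?gt_eqF// scale1r opprB addrC subrK.
- apply/measurable_EFinP.
  by apply: measurableT_comp; [exact: mh|exact: measurable_rV_subM].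
Qed.

Lemma integral_rescaled r y : 0 < r ->
  (\int[mu]_z (rescaled J r (y - z))%:E = 1)%E.
Proof.
move=> r0; have [_ _ _ <-] := J_kernel.
have := @ge0_integral_rescaled r y (fun=> 1) r0 (measurable_cst _) (fun=> ler01).
under eq_integral do rewrite mulr1.
by under [in RHS]eq_integral do rewrite mulr1.
Qed.

Lemma integrable_rescaled r y : 0 < r ->
  mu.-integrable setT (fun z => (rescaled J r (y - z))%:E).
Proof.
move=> r0; apply/integrableP; split.
  by apply/measurable_EFinP; exact: measurable_rescaled.
under eq_integral do rewrite /= ger0_norm ?rescaled_ge0 ?ltW//.
by rewrite integral_rescaled// ltry.
Qed.

Lemma integrable_disperse r y w : 0 < r -> bounded_measurable w ->
  mu.-integrable Om (fun z => (rescaled J r (y - z) * w z)%:E).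
Proof.
move=> r0 [mw [M wM]].
have mO := measurable_Om.
apply: (@le_integrable _ _ _ mu Om mO _ (fun z => (rescaled J r (y - z) * M)%:E)) => //.
- apply/measurable_EFinP; apply: measurable_funM => //.
  apply: measurable_funS (measurable_rescaled r y) => //.
- move=> z Oz /=; rewrite lee_fin !normrM ler_wpM2l//.
  by rewrite (le_trans (wM _ Oz))// ler_norm.
- under eq_fun do rewrite EFinM; apply: integrableZr => //.
  apply: integrableS (integrable_rescaled y r0) => //.
Qed.

Lemma le_disperse r y w1 w2 : 0 < r ->
  bounded_measurable w1 -> bounded_measurable w2 ->
  (forall z, Om z -> w1 z <= w2 z) -> disperse r w1 y <= disperse r w2 y.
Proof.
move=> r0 b1 b2 h; apply: le_Rintegral; first exact: measurable_Om.
- exact: integrable_disperse.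
- exact: integrable_disperse.
- by move=> z Oz; apply: ler_wpM2l (h _ Oz); rewrite rescaled_ge0// ltW.
Qed.

Lemma bounded_measurable_cst c : bounded_measurable (fun=> c).
Proof. by split; [exact: measurable_cst|exists `|c|]. Qed.

Lemma disperseZ r y w c : 0 < r -> bounded_measurable w ->
  disperse r (fun z => c * w z) y = c * disperse r w y.
Proof.
move=> r0 bw; rewrite /disperse /Rint_rV -RintegralZl//.
- by apply: eq_Rintegral => z _; rewrite mulrCA.
- exact: measurable_Om.
- exact: integrable_disperse.
Qed.

Lemma disperse_cst_le r y c : 0 < r -> 0 <= c -> disperse r (fun=> c) y <= c.
Proof.
move=> r0 c0.
rewrite (_ : (fun=> c) = (fun z => c * (fun=> 1) z)); last first.
  by apply/funext => z; rewrite mulr1.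
rewrite disperseZ//; last exact: bounded_measurable_cst.
rewrite ler_piMr//.
have int1 : (\int[mu]_(z in Om) (rescaled J r (y - z) * 1)%:E <= 1%:E)%E.
  rewrite -(integral_rescaled y r0).
  under eq_integral do rewrite mulr1.
  apply: ge0_subset_integral => //; first exact: measurable_Om.
    by apply/measurable_EFinP; exact: measurable_rescaled.
  by move=> z _; rewrite lee_fin rescaled_ge0// ltW.
rewrite /disperse /Rint_rV /Rintegral -lee_fin fineK//.
rewrite ge0_fin_numE; first exact: le_lt_trans int1 (ltry _).
by apply: integral_ge0 => z _; rewrite lee_fin mulr1 rescaled_ge0// ltW.
Qed.

Lemma disperse_le r y w c : 0 < r -> 0 <= c -> bounded_measurable w ->
  (forall z, Om z -> w z <= c) -> disperse r w y <= c.
Proof.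
move=> r0 c0 bw h; apply: le_trans (disperse_cst_le y r0 c0).
by apply: le_disperse => //; exact: bounded_measurable_cst.
Qed.

Lemma disperse_ge r y w c : 0 < r -> 0 <= c -> bounded_measurable w ->
  (forall z, Om z -> - c <= w z) -> - c <= disperse r w y.
Proof.
move=> r0 c0 bw h.
apply: (@le_trans _ _ (disperse r (fun z => - 1 * (fun=> c) z) y)).
  rewrite disperseZ//; last exact: bounded_measurable_cst.
  by rewrite mulN1r lerN2 disperse_cst_le.
apply: le_disperse => //.
  have := bounded_measurable_cst (- c).
  by rewrite (_ : (fun=> - c) = (fun=> -1 * c))//; apply/funext => z; rewrite mulN1r.
by move=> z Oz; rewrite mulN1r; exact: h.
Qed.

Lemma disperse_ge0 r y w : 0 < r ->
  (forall z, Om z -> 0 <= w z) -> 0 <= disperse r w y.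
Proof.
move=> r0 h; apply: Rintegral_ge0 => z Oz.
by rewrite mulr_ge0 ?h// rescaled_ge0// ltW.
Qed.

(** If [w] were positive at [z], the integrand would be bounded below by a
    positive constant on a cube around [z]. *)
Lemma disperse_eq0 r y z w : 0 < r -> bounded_measurable w ->
  (forall z, Om z -> 0 <= w z) -> Om z -> {for z, continuous w} ->
  0 < J (r *: (y - z)) -> disperse r w y = 0 -> w z = 0.
Proof.
move=> r0 bw w0 Oz cw Jz D0; apply/eqP; rewrite eq_le w0// andbT leNgt.
apply/negP => wz.
pose F z := rescaled J r (y - z) * w z.
have Fz : 0 < F z by rewrite /F mulr_gt0// /rescaled mulr_gt0// exprn_gt0.
have F0 z' : Om z' -> 0 <= F z'.
  by move=> Oz'; rewrite /F mulr_ge0 ?w0// rescaled_ge0// ltW.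
have cF : {for z, continuous F}.
  by apply: continuousM => //; exact: continuous_rescaled.
have nF : \forall z' \near z, F z / 2 < F z'.
  by apply: (cvgr_gt _ cF); rewrite ltr_pdivrMr// ltr_pMr// ltr1n.
have nO : \forall z' \near z, Om z' by exact: open_nbhs_nbhs.
have [e /= e0 eF] := (proj1 (nbhs_ballP z _)) (filterI nF nO).
pose Q : set 'rV[RT]_n := [set x | forall i,
  (z ord0 i - e / 4) <= x ord0 i <= (z ord0 i - e / 4) + e / 2].
have QF x : Q x -> F z / 2 < F x /\ Om x.
  move=> Qx; apply: eF; rewrite ball_rVE//= => i.
  have /andP[h1 h2] := Qx i.
  rewrite distrC ltr_distl; apply/andP; split; lra.
have e20 : 0 <= e / 2 by lra.
have iF := integrable_disperse y r0 bw.
have mF := measurable_int _ iF.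
have : (0 < \int[mu]_(x in Om) (F x)%:E)%E.
  apply: (@lt_le_trans _ _ (\int[mu]_(x in Q) (F z / 2)%:E)%E).
    rewrite integral_cst; last exact: measurable_cube.
    by rewrite lebesgue_rV_cube// -EFinM lte_fin mulr_gt0 ?exprn_gt0//; lra.
  apply: (@le_trans _ _ (\int[mu]_(x in Q) (F x)%:E)%E).
    apply: ge0_le_integral => //.
    - exact: measurable_cube.
    - by move=> x _; rewrite lee_fin; lra.
    - apply: measurable_funS mF => //; first exact: measurable_Om.
      by move=> x /QF[].
    - by move=> x /QF[h _]; rewrite lee_fin ltW.
  apply: ge0_subset_integral => //.
  - exact: measurable_cube.
  - exact: measurable_Om.
  - by move=> x /QF[].
move=> h; have : 0 < disperse r w y; last by rewrite D0 ltxx.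
apply: fine_gt0; apply/andP; split; first exact: h.
rewrite -ge0_fin_numE; last exact: ltW.
exact: (integrable_fin_num measurable_Om iF).
Qed.

Section cap.
Variables (c0 : 'rV[R]_n) (a : R).
Hypothesis a_gt0 : 0 < a.

Definition paraboloid (y : 'rV[R]_n) : R :=
  1 - (\sum_i (y ord0 i - c0 ord0 i) ^+ 2) / a ^+ 2.

(** The cut-off at 0 can only raise the average over a centred kernel, and it
    does so substantially near the edge of the support. *)
Definition cap (y : 'rV[R]_n) : R := Num.max 0 (paraboloid y).

Lemma cap_ge0 y : 0 <= cap y.
Proof. by rewrite /cap le_max lexx. Qed.

Lemma cap_le1 y : cap y <= 1.
Proof.
rewrite /cap ge_max ler01/= /paraboloid gerBl divr_ge0 ?sqr_ge0//.
by apply: sumr_ge0 => i _; exact: sqr_ge0.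
Qed.

Lemma paraboloid_le_cap y : paraboloid y <= cap y.
Proof. by rewrite /cap le_max lexx orbT. Qed.

Lemma continuous_paraboloid : continuous paraboloid.
Proof.
move=> x.
have h i : {for x, continuous (fun y => (y ord0 i - c0 ord0 i) ^+ 2)}.
  have h1 : {for x, continuous (fun y => y ord0 i : R)} by exact: coord_continuous.
  have h2 : {for x, continuous (fun=> c0 ord0 i : R)} by exact: cst_continuous.
  exact: (continuous_comp (continuousB h1 h2) (@exprn_continuous _ 2 _)).
have h1 : {for x, continuous (fun=> (a ^+ 2)^-1 : R)} by exact: cst_continuous.
have h2 : {for x, continuous (fun=> 1 : R)} by exact: cst_continuous.
exact: (continuousB h2 (continuousM (continuous_sum_at h) h1)).
Qed.

Lemma continuous_cap : continuous cap.
Proof.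
move=> x; have h : {for x, continuous (fun=> 0 : R)} by exact: cst_continuous.
exact: (continuous_max h (@continuous_paraboloid x)).
Qed.

Hypothesis cap_Om : forall y, 0 < cap y -> Om y.

Lemma bounded_measurable_cap : bounded_measurable cap.
Proof.
split.
  by apply: continuous_measurable_rV => // x _; exact: continuous_cap.
by exists 1 => z _; rewrite ger0_norm ?cap_ge0 ?cap_le1.
Qed.

Lemma disperse_capE r y : 0 < r ->
  disperse r cap y = Rint_rV setT (fun x => J x * cap (y - r^-1 *: x)).
Proof.
move=> r0; rewrite /disperse /Rint_rV Rintegral_mkcond; congr fine.
rewrite -ge0_integral_rescaled//; last 2 first.
- by apply: continuous_measurable_rV => [|x _]; [exact: openT|exact: continuous_cap].
- exact: cap_ge0.
apply: eq_integral => z _; rewrite patchE; case: ifPn => //.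
rewrite notin_setE => nOz; rewrite (_ : cap z = 0) ?mulr0//.
by apply/eqP; rewrite eq_le cap_ge0 andbT leNgt; apply/negP => /cap_Om.
Qed.

Hypothesis J_centered : forall i, Rint_rV setT (fun x => J x * x ord0 i) = 0.
Variable R0 : R.
Hypothesis J_supp : forall x i, J x != 0 -> `|x ord0 i| <= R0.

Lemma integrable_J : mu.-integrable setT (fun x => (J x)%:E).
Proof.
apply/integrableP; split; first by apply/measurable_EFinP; exact: measurable_J.
under eq_integral do rewrite /= ger0_norm//.
by have [_ _ _ ->] := J_kernel; rewrite ltry.
Qed.

Lemma integrable_J_mul (g : 'rV[R]_n -> R) (M : R) : continuous g ->
  (forall x, J x != 0 -> `|g x| <= M) ->
  mu.-integrable setT (fun x => (J x * g x)%:E).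
Proof.
move=> cg gM.
apply: (@le_integrable _ _ _ mu setT measurableT _ (fun x => (J x * M)%:E)) => //.
- apply/measurable_EFinP; apply: measurable_funM; first exact: measurable_J.
  by apply: continuous_measurable_rV => [|x _]; [exact: openT|exact: cg].
- move=> x _ /=; rewrite lee_fin !normrM.
  have [->|Jx] := eqVneq (J x) 0; first by rewrite normr0 !mul0r.
  by rewrite ler_wpM2l// (le_trans (gM _ Jx))// ler_norm.
- by under eq_fun do rewrite EFinM; apply: integrableZr => //; exact: integrable_J.
Qed.

Let M2 := Rint_rV setT (fun x => J x * \sum_i x ord0 i ^+ 2).

Let continuous_coord i : continuous (fun x : 'rV[R]_n => x ord0 i : R).
Proof. exact: coord_continuous. Qed.

Lemma integrable_J_coord i : mu.-integrable setT (fun x => (J x * x ord0 i)%:E).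
Proof. by apply: (@integrable_J_mul _ R0) => // x Jx; exact: J_supp. Qed.

Lemma integrable_J_sq :
  mu.-integrable setT (fun x => (J x * \sum_i x ord0 i ^+ 2)%:E).
Proof.
apply: (@integrable_J_mul _ (\sum_(i < n) R0 ^+ 2)) => [x|x Jx].
  apply: continuous_sum_at => i.
  exact: (continuous_comp (@continuous_coord i x) (@exprn_continuous _ 2 _)).
rewrite ger0_norm; last by apply: sumr_ge0 => i _; exact: sqr_ge0.
apply: ler_sum => i _; rewrite -real_normK ?num_real// lerXn2r ?nnegrE//.
  by rewrite (le_trans _ (J_supp i Jx)).
exact: J_supp.
Qed.

Lemma Rint_J : Rint_rV setT J = 1.
Proof. by rewrite /Rint_rV /Rintegral; have [_ _ _ ->] := J_kernel. Qed.

Lemma integrable_J_linear (k : 'I_n -> R) :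
  mu.-integrable setT (fun x => (J x * \sum_i k i * x ord0 i)%:E).
Proof.
apply: (@integrable_J_mul _ (\sum_i `|k i| * R0)) => [x|x Jx].
  apply: continuous_sum_at => i.
  have h : {for x, continuous (fun=> k i : R)} by exact: cst_continuous.
  exact: (continuousM h (@continuous_coord i x)).
apply: le_trans (ler_norm_sum _ _ _) _; apply: ler_sum => i _.
by rewrite normrM ler_wpM2l// J_supp.
Qed.

Lemma Rint_J_linear (k : 'I_n -> R) :
  Rint_rV setT (fun x => J x * \sum_i k i * x ord0 i) = 0.
Proof.
rewrite /Rint_rV /Rintegral.
have -> : (fun x : 'rV[RT]_n => (J x * \sum_i k i * x ord0 i)%:E) =
    (fun x => \sum_i ((k i)%:E * (J x * x ord0 i)%:E))%E.
  apply/funext => x; rewrite mulr_sumr -sumEFin; apply: eq_bigr => i _.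
  by rewrite -EFinM mulrCA.
rewrite integral_sum//; last first.
  by move=> i; apply: integrableZl => //; exact: integrable_J_coord.
rewrite big1// => i _; rewrite integralZl//; last exact: integrable_J_coord.
rewrite -[X in (_ * X)%E]fineK; last first.
  exact: (integrable_fin_num measurableT (integrable_J_coord i)).
by have := J_centered i; rewrite /Rint_rV /Rintegral => ->; rewrite mule0.
Qed.

Lemma paraboloid_sub r x y : 0 < r -> paraboloid (y - r^-1 *: x) =
  paraboloid y + \sum_i (2 * (y ord0 i - c0 ord0 i) / (a ^+ 2 * r)) * x ord0 i
  - (a ^+ 2 * r ^+ 2)^-1 * \sum_i x ord0 i ^+ 2.
Proof.
move=> r0; rewrite /paraboloid -!addrA; congr (_ + _).
rewrite !mulr_suml mulr_sumr -!sumrN -!big_split/=.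
apply: eq_bigr => i _; rewrite !mxE; field.
by rewrite !gt_eqF.
Qed.

Lemma integrable_J_cap r y :
  mu.-integrable setT (fun x => (J x * cap (y - r^-1 *: x))%:E).
Proof.
apply: (@integrable_J_mul _ 1) => [x|x _].
  have h0 : {for x, continuous (fun x : 'rV[R]_n => r^-1 *: x)}.
    by apply: (@continuousZr _ _ _ id); exact: cvg_id.
  have h1 : {for x, continuous (fun=> y)} by exact: cst_continuous.
  exact: (continuous_comp (continuousB h1 h0) (@continuous_cap _)).
by rewrite ger0_norm ?cap_ge0 ?cap_le1.
Qed.

(** In the expansion of the paraboloid around [y] the linear term integrates to
    zero, since the kernel is centred. *)
Lemma disperse_cap_ge_paraboloid r y : 0 < r ->
  paraboloid y - M2 / (a ^+ 2 * r ^+ 2) <= disperse r cap y.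
Proof.
move=> r0; rewrite disperse_capE//.
pose k i := 2 * (y ord0 i - c0 ord0 i) / (a ^+ 2 * r).
pose b := (a ^+ 2 * r ^+ 2)^-1.
have E x : J x * paraboloid (y - r^-1 *: x) =
    (paraboloid y * J x + J x * \sum_i k i * x ord0 i)
    - b * (J x * \sum_i x ord0 i ^+ 2).
  by rewrite paraboloid_sub// mulrBr mulrDr [J x * paraboloid y]mulrC -/k -/b mulrCA.
have i1 : mu.-integrable setT (fun x => (paraboloid y * J x)%:E).
  by under eq_fun do rewrite EFinM; apply: integrableZl => //; exact: integrable_J.
have i2 := integrable_J_linear k.
have i3 : mu.-integrable setT (fun x => (b * (J x * \sum_i x ord0 i ^+ 2))%:E).
  by under eq_fun do rewrite EFinM; apply: integrableZl => //; exact: integrable_J_sq.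
have i12 : mu.-integrable setT
    (fun x => (paraboloid y * J x + J x * \sum_i k i * x ord0 i)%:E).
  by under eq_fun do rewrite EFinD; exact: integrableD.
have i123 : mu.-integrable setT (fun x => (J x * paraboloid (y - r^-1 *: x))%:E).
  by under eq_fun do rewrite E EFinB; exact: integrableB.
apply: (@le_trans _ _ (Rint_rV setT (fun x => J x * paraboloid (y - r^-1 *: x)))).
  rewrite [X in _ <= X](_ : _ = paraboloid y - M2 / (a ^+ 2 * r ^+ 2))//.
  rewrite /Rint_rV; under eq_Rintegral do rewrite E.
  rewrite RintegralB// RintegralD// !RintegralZl//; last 2 first.
  - exact: integrable_J_sq.
  - exact: integrable_J.
  have := Rint_J_linear k; rewrite /Rint_rV => ->.
  have := Rint_J; rewrite /Rint_rV => ->.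
  by rewrite mulr1 addr0 [b * _]mulrC.
apply: le_Rintegral => //; first exact: integrable_J_cap.
by move=> x _; rewrite ler_wpM2l// paraboloid_le_cap.
Qed.

(** Where the paraboloid is at most 3 / 4, the distance to the centre is at least
    [a / 2]. On a cube [Q] of displacements that all point towards the centre, on
    which the kernel is bounded below, the paraboloid gains an amount of order
    [1 / r]. *)
Lemma disperse_cap_edge : exists2 kappa, 0 < kappa &
  exists r1, forall r y, r1 <= r -> 0 < r -> 0 <= paraboloid y <= 3 / 4 ->
    kappa / r <= disperse r cap y.
Proof.
have J0 : 0 < J 0 by case: J_kernel.
have nJ : \forall x \near (0 : 'rV[R]_n), J 0 / 2 < J x.
  by apply: (cvgr_gt _ (@J_cont 0)); lra.
have [e /= e0 eJ] := (proj1 (nbhs_ballP _ _)) nJ.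
pose h := e / 4; have h0 : 0 < h by rewrite /h; lra.
pose kappa := J 0 / 2 * (h / (4 * a)) * h ^+ n.
exists kappa; first by rewrite /kappa !(mulr_gt0, invr_gt0, exprn_gt0).
exists (16 * n%:R * h / a) => r y r1 r0 /andP[p0 p34].
pose v i := y ord0 i - c0 ord0 i.
have sv : a ^+ 2 / 4 <= \sum_i v i ^+ 2.
  move: p34; rewrite /paraboloid lerBlDr -lerBlDl => p34.
  have {p34} : 1 / 4 <= (\sum_i (y ord0 i - c0 ord0 i) ^+ 2) / a ^+ 2 by lra.
  by rewrite ler_pdivlMr ?exprn_gt0// mulrC mul1r.
have va i : `|v i| <= a.
  rewrite -(@ler_pXn2r _ 2) ?nnegrE ?(ltW a_gt0)// real_normK ?num_real//.
  move: p0; rewrite /paraboloid subr_ge0 ler_pdivrMr ?exprn_gt0// mul1r.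
  apply: le_trans; rewrite (bigD1 i)//= lerDl.
  by apply: sumr_ge0 => j _; exact: sqr_ge0.
(* The cube of side h in the orthant of the vector v; its corner l is chosen so
   that every coordinate has the sign of that of v and modulus at least h. *)
pose l i := if 0 <= v i then h else - (2 * h).
pose Q : set 'rV[RT]_n := [set x | forall i, l i <= x ord0 i <= l i + h].
have Qx x : Q x -> J 0 / 2 <= J x /\ h / (4 * a) / r <= cap (y - r^-1 *: x).
  move=> Qx.
  have xh i : `|x ord0 i| <= 2 * h.
    have := Qx i; rewrite /l; case: ifP => _ /andP[h1 h2]; rewrite ler_norml;
    apply/andP; split; lra.
  split.
    apply/ltW/eJ; rewrite ball_rVE//= => i; rewrite mxE sub0r normrN.
    by rewrite (le_lt_trans (xh i))// /h; lra.
  apply: le_trans (paraboloid_le_cap _); rewrite paraboloid_sub//.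
  have vx i : h * v i ^+ 2 / a <= v i * x ord0 i.
    rewrite ler_pdivrMr// -subr_ge0.
    rewrite (_ : _ - _ = v i * (x ord0 i * a - h * v i)); last by ring.
    have := Qx i; have := va i; rewrite ler_norml /l => /andP[va1 va2].
    case: ifP => [v0|/negbT]; last rewrite -ltNge => v0; move=> /andP[x1 x2].
      rewrite mulr_ge0// subr_ge0 (@le_trans _ _ (h * a)) ?ler_pM2l ?ler_pM2r//.
    rewrite nmulr_rge0// subr_le0 (@le_trans _ _ (- h * a))//.
      by rewrite ler_pM2r//; lra.
    by rewrite mulNr -mulrN ler_pM2l//.
  have s1 : h * a / 4 <= \sum_i v i * x ord0 i.
    apply: (@le_trans _ _ (\sum_i h * v i ^+ 2 / a)); last exact: ler_sum.
    rewrite -mulr_suml -mulr_sumr ler_pdivlMr//.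
    rewrite (_ : h * a / 4 * a = h * (a ^+ 2 / 4)); last by field.
    by rewrite ler_pM2l.
  have s2 : \sum_i x ord0 i ^+ 2 <= n%:R * (4 * h ^+ 2).
    rewrite (_ : n%:R * _ = \sum_(i < n) (2 * h) ^+ 2); last first.
      by rewrite sumr_const card_ord -mulr_natl; ring.
    apply: ler_sum => i _; rewrite -(@real_normK _ (x ord0 i)) ?num_real//.
    by rewrite ler_pXn2r ?nnegrE ?mulr_ge0// ltW.
  rewrite (_ : \sum_i _ = 2 / (a ^+ 2 * r) * \sum_i v i * x ord0 i); last first.
    rewrite mulr_sumr; apply: eq_bigr => i _; rewrite -/(v i); field.
    by rewrite !gt_eqF.
  have t1 : h / (2 * a) / r <= 2 / (a ^+ 2 * r) * \sum_i v i * x ord0 i.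
    apply: (@le_trans _ _ (2 / (a ^+ 2 * r) * (h * a / 4))).
      by rewrite le_eqVlt; apply/orP; left; apply/eqP; field; rewrite !gt_eqF.
    by rewrite ler_pM2l// divr_gt0// mulr_gt0// exprn_gt0.
  have t2 : (a ^+ 2 * r ^+ 2)^-1 * \sum_i x ord0 i ^+ 2 <= h / (4 * a) / r.
    apply: (@le_trans _ _ ((a ^+ 2 * r ^+ 2)^-1 * (n%:R * (4 * h ^+ 2)))).
      by rewrite ler_pM2l// invr_gt0 mulr_gt0// exprn_gt0.
    rewrite mulrC ler_pdivrMr; last by rewrite mulr_gt0// exprn_gt0.
    rewrite (_ : h / (4 * a) / r * _ = r * (a * h / 4)); last first.
      by field; rewrite !gt_eqF.
    rewrite -ler_pdivrMr; last by rewrite !mulr_gt0.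
    apply: le_trans r1.
    by rewrite le_eqVlt; apply/orP; left; apply/eqP; field; rewrite !gt_eqF.
  have t3 : h / (2 * a) / r = h / (4 * a) / r + h / (4 * a) / r.
    by field; rewrite !gt_eqF.
  lra.
rewrite disperse_capE// /Rint_rV /Rintegral.
have iJ := integrable_J_cap r y.
have fJ := integrable_fin_num measurableT iJ.
rewrite -lee_fin fineK//.
have hn : (lebesgue_rV n Q = (h ^+ n)%:E)%E by apply: lebesgue_rV_cube; exact: ltW.
have -> : ((kappa / r)%:E = \int[mu]_(x in Q) (J 0 / 2 * (h / (4 * a) / r))%:E)%E.
  rewrite integral_cst; last exact: measurable_cube.
  rewrite hn -EFinM; congr EFin; rewrite /kappa; field.
  by rewrite !gt_eqF.
apply: (@le_trans _ _ (\int[mu]_(x in Q) (J x * cap (y - r^-1 *: x))%:E)%E).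
  apply: ge0_le_integral => //.
  - exact: measurable_cube.
  - by move=> x _; rewrite lee_fin ltW// !(mulr_gt0, invr_gt0).
  - by apply: measurable_funS (measurable_int _ iJ) => //.
  - move=> x /Qx[q1 q2]; rewrite lee_fin; apply: ler_pM => //;
    by rewrite ltW// !(mulr_gt0, invr_gt0).
apply: ge0_subset_integral => //.
- exact: measurable_cube.
- exact: (measurable_int _ iJ).
- by move=> x _; rewrite lee_fin mulr_ge0 ?cap_ge0.
Qed.

(** Eventually dispersal loses at most a fraction [delta] of the cap: away from
    the edge the loss is the second moment of the kernel over [r ^ 2], whereas
    near the edge the cap gains of order [1 / r] from its own positive part. *)
Lemma disperse_cap delta : 0 < delta -> exists r1, forall r y, r1 <= r -> 0 < r ->
  (1 - delta) * cap y <= disperse r cap y.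
Proof.
move=> d0; have [kappa k0 [r1 edge]] := disperse_cap_edge.
have M20 : 0 <= M2.
  apply: Rintegral_ge0 => x _; rewrite mulr_ge0// sumr_ge0// => i _.
  exact: sqr_ge0.
pose b := M2 / (delta * a ^+ 2).
have b0 : 0 <= b by rewrite /b divr_ge0// mulr_ge0 ?sqr_ge0// ltW.
exists (Num.max r1 (Num.max 1 (Num.max (b / kappa) (4 / 3 * b)))) => r y.
rewrite !ge_max => /and4P[rr1 r1' rb1 rb2] r0.
have rr : r <= r ^+ 2 by rewrite expr2 ler_peMl// ltW.
have [p0|p0] := leP (paraboloid y) 0.
  rewrite /cap max_l// mulr0; apply: disperse_ge0 => // z _; exact: cap_ge0.
have capE : cap y = paraboloid y by rewrite /cap max_r// ltW.
have [pb|pb] := leP (b / r ^+ 2) (paraboloid y).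
  apply: le_trans (disperse_cap_ge_paraboloid y r0).
  rewrite capE mulrBl mul1r lerD2l lerN2.
  have -> : M2 / (a ^+ 2 * r ^+ 2) = delta * (b / r ^+ 2).
    by rewrite /b; field; rewrite !gt_eqF.
  by rewrite ler_pM2l.
have br : b / r ^+ 2 <= b / r.
  by rewrite ler_wpM2l// lef_pV2// posrE exprn_gt0.
apply: (@le_trans _ _ (kappa / r)); last first.
  apply: edge => //; rewrite ltW//=.
  apply: le_trans (ltW pb) _; apply: le_trans br _.
  rewrite ler_pdivrMr//; lra.
rewrite capE; apply: (@le_trans _ _ (paraboloid y)).
  by rewrite ler_piMl ?ltW//; lra.
apply: le_trans (ltW pb) _; rewrite ler_pdivrMr ?exprn_gt0//.
rewrite expr2 mulrA divfK ?gt_eqF//.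
by move: rb1; rewrite ler_pdivrMr// mulrC.
Qed.

End cap.
End kernel.

(** * First touching times *)

Section touching.
Context {R : realType} {T : pseudoMetricType R} {I : finType}.
Variables (K : set T) (a b : R) (h : I -> R -> T -> R).
Hypothesis K_compact : compact K.
Let Q : set (R * T) := `[a, b]%classic `*` K.
Hypothesis h_cont : forall i, {within Q, continuous (fun p => h i p.1 p.2)}.
Hypothesis h_start : forall i y, K y -> 0 < h i a y.
Hypothesis h_touch : forall i t y, a < t <= b -> K y -> h i t y = 0 ->
  (forall j z, K z -> 0 <= h j t z) ->
  exists2 d, 0 < d & is_derive t 1 (fun s => h i s y) d.

Let compact_Q : compact Q.
Proof. by apply: compact_setX => //; exact: segment_compact. Qed.

Let bad i : set (R * T) := Q `&` [set p | h i p.1 p.2 <= 0].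

Let compact_bad i : compact (bad i).
Proof.
have /continuous_closedP/(_ _ (@closed_le R 0)) := @h_cont i.
by move/closed_subspaceP => [V cV VE]; rewrite /bad setIC -VE setIC; exact: compact_closedI.
Qed.

Let left_limit i t y : a < t <= b -> K y ->
  (forall s, a <= s < t -> 0 < h i s y) -> 0 <= h i t y.
Proof.
move=> /andP[at_ tb] Ky pos; rewrite leNgt; apply/negP => neg.
have Qt : Q (t, y) by split => //=; rewrite in_itv/= (ltW at_).
have /subspace_continuousP/(_ _ Qt) c := @h_cont i.
have : \forall p \near within Q (nbhs (t, y)), h i p.1 p.2 < 0.
  by apply: (cvgr_lt _ c).
rewrite near_withinE => /nbhs_ballP[e /= e0 he].
pose s := Num.max a (t - e / 2).
have st : s < t by rewrite /s gt_max at_/= gtrBl divr_gt0.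
have sa : a <= s by rewrite /s le_max lexx.
have := he (s, y); rewrite /= => /(_ _ _).
have bs : ball (t, y) e (s, y).
  split => /=; last exact: ballxx.
  rewrite /ball/= ger0_norm ?subr_ge0 ?(ltW st)//.
  have : t - e / 2 <= s by rewrite /s le_max lexx orbT.
  by move=> h1; lra.
have Qs : Q (s, y) by split => //=; rewrite in_itv/= sa (le_trans (ltW st)).
move=> /(_ bs Qs); rewrite ltNge => /negP; apply.
by rewrite ltW// pos// sa.
Qed.

(** At the first time at which some [h i] reaches zero, [h i] has come down from
    positive values, so that its derivative cannot be positive. *)
Lemma first_touching i t y : a <= t <= b -> K y -> 0 < h i t y.
Proof.
move=> atb Ky; rewrite ltNge; apply/negP => hneg.
pose B := \big[setU/set0]_(j : I) bad j.
have BP p : B p <-> exists j, bad j p.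
  rewrite /B -bigcup_seq; split => [[j _ bj]|[j bj]]; first by exists j.
  by exists j => //=; rewrite mem_index_enum.
have cB : compact B by apply: bigsetU_compact => j _; exact: compact_bad.
have [||p pB pmin] := @compact_EVT_min _ R fst B _ cB.
- by exists (t, y); apply/BP; exists i; split => //; split => //=; rewrite in_itv.
- by apply: continuous_subspaceT => p; exact: cvg_fst.
move: pB; rewrite inE => /BP[j [[/= p1 p2] pj]].
move: p pmin p1 p2 pj => -[t0 y0] /= pmin t0ab Ky0 hj.
rewrite in_itv/= in t0ab; have /andP[at0 t0b] := t0ab.
have {}at0 : a < t0.
  rewrite lt_neqAle at0 andbT; apply/negP => /eqP at0'.
  by move: hj; rewrite -at0' leNgt h_start.
have pos l s z : a <= s < t0 -> K z -> 0 < h l s z.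
  move=> /andP[sa st0] Kz; rewrite ltNge; apply/negP => hl.
  have : (s, z) \in B.
    rewrite inE; apply/BP; exists l; split => //; split => //=.
    by rewrite in_itv/= sa (le_trans (ltW st0)).
  by move/pmin => /=; rewrite leNgt st0.
have t0ab' : a < t0 <= b by rewrite at0.
have ge0 l z : K z -> 0 <= h l t0 z.
  by move=> Kz; apply: left_limit => // s sat; exact: pos.
have h0 : h j t0 y0 = 0 by apply/eqP; rewrite eq_le hj ge0.
have [d d0 /is_derive1_caratheodory[q [qE qc qd]]] := h_touch t0ab' Ky0 h0 ge0.
have : \forall s \near t0, 0 < q s by apply: (cvgr_gt _ qc); rewrite qd.
move=> /nbhs_ballP[e /= e0 he].
pose s := Num.max a (t0 - e / 2).
have st : s < t0 by rewrite /s gt_max at0/= gtrBl divr_gt0.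
have sa : a <= s by rewrite /s le_max lexx.
have bs : ball t0 e s.
  rewrite /ball/= ger0_norm ?subr_ge0 ?(ltW st)//.
  have : t0 - e / 2 <= s by rewrite /s le_max lexx orbT.
  by move=> h1; lra.
have hs : 0 < h j s y0 by rewrite pos// sa.
have := qE s; rewrite h0 subr0 => E; move: hs; rewrite E.
by rewrite ltNge => /negP; apply; rewrite mulr_ge0_le0 ?(ltW (he _ bs))// subr_le0 ltW.
Qed.

End touching.

(** * Solutions *)
(** The rate at which the growth of the domain dilutes the densities. *)
Definition dilution {R : realType} (n : nat) (rho : R -> R) (t : R) : R :=
  n%:R * ray_derive rho t / rho t.

Section solution.
Context {R : realType} {m n : nat}.
Variables (Om : set 'rV[R]_n) (d : 'rV[R]_m) (rho : R -> R).
Variables (J : 'rV[R]_n -> R) (f : 'cV[R]_m -> 'cV[R]_m).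
Hypothesis Om_open : open Om.
Hypothesis Om_bounded : bounded_set Om.
Hypothesis d_gt0 : forall i, 0 < d ord0 i.
Hypothesis rho_gt0 : forall t, 0 <= t -> 0 < rho t.
Hypothesis J_kernel : dispersal_kernel J.
Variables (phi : 'rV[R]_n -> 'cV[R]_m) (u : R -> 'rV[R]_n -> 'cV[R]_m).
Hypothesis u_sol : is_solution Om d rho J f phi u.
Let K := closure Om.
Implicit Types (t s : R) (y z : 'rV[R]_n) (i : 'I_m).

Lemma compact_closure_domain : compact K.
Proof.
apply: bounded_closed_compact; last exact: closed_closure.
have [M [Mr hM]] := Om_bounded.
exists M; split => // x Mx y Ky.
have : closed [set y : 'rV[R]_n | `|y| <= x].
  rewrite (_ : [set y | _] = (fun y : 'rV[R]_n => `|y|) @^-1` [set z | z <= x])//.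
  by apply: closed_comp => [z _|]; [exact: norm_continuous|exact: closed_le].
move=> /closure_id ->; apply: closure_subset Ky => z Oz /=.
exact: hM.
Qed.

Lemma solution_continuous i :
  {within [set ty : R * 'rV[R]_n | 0 <= ty.1 /\ K ty.2],
     continuous (fun ty => u ty.1 ty.2 i ord0)}.
Proof.
have [cu _ _] := u_sol; move=> p.
exact: (continuous_comp (cu p) (@coord_continuous _ _ _ i ord0 _)).
Qed.

Lemma solution_continuous_on i a b : 0 <= a ->
  {within `[a, b]%classic `*` K, continuous (fun ty : R * 'rV[R]_n => u ty.1 ty.2 i ord0)}.
Proof.
move=> a0; apply: continuous_subspaceW (@solution_continuous i) => -[t y] /= [].
by rewrite in_itv/= => /andP[at_ _] Ky; split => //; exact: le_trans at_.
Qed.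

Lemma solution_slice t i : 0 <= t -> {within K, continuous (fun y => u t y i ord0)}.
Proof.
move=> t0; apply/subspace_continuousP => y Ky.
have := (subspace_continuousP _ _).1 (@solution_continuous i) (t, y).
move=> /(_ (conj t0 Ky)) /= c.
have c2 : (fun z : 'rV[R]_n => (t, z)) @ within K (nbhs y) -->
    within [set ty : R * 'rV[R]_n | 0 <= ty.1 /\ K ty.2] (nbhs (t, y)).
  move=> A /=; rewrite /within/= => -[[P1 P2] /= [n1 n2] PA].
  apply: filterS n2 => z P2z Kz; apply: (PA (t, z)) => //=.
  by split => //; exact: nbhs_singleton.
by move=> A nA; exact: (c2 _ (c A nA)).
Qed.

Lemma solution_continuous_at t i y : 0 <= t -> Om y ->
  {for y, continuous (fun y => u t y i ord0)}.
Proof.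
move=> t0 Oy; have := continuous_subspaceW (@subset_closure _ Om) (@solution_slice t i t0).
by rewrite (continuous_open_subspace _ Om_open); apply; rewrite inE.
Qed.

Lemma solution_bounded_measurable t i : 0 <= t ->
  bounded_measurable Om (fun z => u t z i ord0).
Proof.
move=> t0; split.
  apply: continuous_measurable_rV => // y; rewrite inE => Oy.
  exact: solution_continuous_at.
have := continuous_compact (@solution_slice t i t0) compact_closure_domain.
move=> /compact_bounded[M [_ hM]]; exists (M + 1) => z Oz.
by apply: (hM (M + 1)); [rewrite ltrDl|exists z => //; exact: subset_closure].
Qed.

Lemma solution_start i y : K y -> u 0 y i ord0 = phi y i ord0.
Proof. by have [_ u0 _] := u_sol => /u0 ->. Qed.

Lemma solution_derive t y i : 0 < t -> K y ->
  is_derive t (1 : R) (fun s => u s y i ord0)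
    (d ord0 i * (disperse Om J (rho t) (fun z => u t z i ord0) y - u t y i ord0)
     - dilution n rho t * u t y i ord0 + f (u t y) i ord0).
Proof.
move=> t0 Ky; have [_ _ /(_ t y t0 Ky) [du Du]] := u_sol.
split; first exact: ((derivable_mxP _ _ _).1 du i ord0).
have := derive_mx du; rewrite Du => /matrixP/(_ i ord0); rewrite [X in _ = X]mxE => <-.
by rewrite /rhs !mul_diag_mx !mxE mulrBr.
Qed.

End solution.

Section ray.
Context {R : realType}.
Implicit Types (r : R -> R) (t s : R).

Lemma ray_continuous r :
  (forall t, 0 <= t -> cvg (ray_slope r t @ ray_dnbhs t)) ->
  {within [set t | 0 <= t], continuous r}.
Proof.
move=> dr; apply/subspace_continuousP => t t0.
have /cvg_ex[L hL] := dr t t0.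
have c : (fun s => r t + ray_slope r t s * (s - t)) @ ray_dnbhs t --> r t.
  rewrite -[X in _ --> X]addr0 -(mulr0 L) -[X in L * X](subrr t).
  apply: cvgD; first exact: cvg_cst.
  apply: cvgM; first exact: hL.
  apply: cvgB; last exact: cvg_cst.
  move=> A nA; rewrite /ray_dnbhs /within/=; apply: filterS (nbhs_dnbhs nA).
  by move=> s As _.
apply/cvgrPdist_lt => e e0.
have h : \forall s \near t, s != t -> 0 <= s ->
    `|r t - (r t + ray_slope r t s * (s - t))| < e.
  by have /cvgrPdist_lt/(_ e e0) := c.
rewrite near_withinE; apply: filterS h => s hs s0.
have [->|st] := eqVneq s t; first by rewrite subrr normr0.
have := hs st s0; rewrite /ray_slope divfK ?subr_eq0//.
by rewrite (_ : r t + (r s - r t) = r s)//; ring.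
Qed.

Lemma dilution_bounded (n : nat) r (b : R) : (forall t, 0 <= t -> 0 < r t) ->
  ray_smooth r -> exists2 C : R, 0 <= C &
    forall t, 0 <= t <= b -> `|dilution n r t| <= C.
Proof.
move=> r0 sr.
have [b0|b0] := ltP b 0.
  by exists 0 => // t /andP[t0 tb]; have := lt_le_trans b0 t0; rewrite ltNge tb.
have sub : `[0, b]%classic `<=` [set t : R | 0 <= t].
  by move=> t /=; rewrite in_itv/= => /andP[].
have c0 : {within `[0, b], continuous r}.
  by apply: continuous_subspaceW sub _; apply: ray_continuous => t; exact: (sr 0%N).
have c1 : {within `[0, b], continuous (ray_derive r)}.
  by apply: continuous_subspaceW sub _; apply: ray_continuous => t; exact: (sr 1%N).
have [s sab smin] := EVT_min b0 c0.
have s0 : 0 <= s by move: sab; rewrite in_itv/= => /andP[].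
have := continuous_compact c1 (@segment_compact _ 0 b).
move=> /compact_bounded[M [_ hM]].
have M0 : 0 <= `|M| + 1 by rewrite addr_ge0.
exists (n%:R * (`|M| + 1) / r s).
  by rewrite divr_ge0 ?mulr_ge0// ltW// r0.
move=> t /andP[t0 tb]; have tab : t \in `[0, b] by rewrite in_itv/= t0.
rewrite /dilution !normrM [`|n%:R|]ger0_norm// ler_pM ?mulr_ge0//.
  by rewrite ler_wpM2l//; apply: (hM (`|M| + 1)); [rewrite (le_lt_trans (ler_norm _))// ltrDl|exists t].
rewrite normfV gtr0_norm ?r0// lef_pV2 ?posrE ?r0//.
exact: smin.
Qed.

Lemma dilution_cvg (n : nat) r (k : R) : ray_derive r t / r t @[t --> +oo] --> k ->
  dilution n r t @[t --> +oo] --> n%:R * k.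
Proof.
move=> h; rewrite (_ : dilution n r = fun t => n%:R * (ray_derive r t / r t)).
  by apply: cvgMr.
by apply/funext => t; rewrite /dilution mulrA.
Qed.

End ray.

Section norm.
Context {R : realType} {m : nat}.
Implicit Types w : 'cV[R]_m.

Lemma cV_norm_le w (e : R) : 0 <= e -> (forall i, `|w i ord0| <= e) -> `|w| <= e.
Proof.
move=> e0 h; rewrite {1}/Num.Def.normr/= mx_normrE.
by apply: bigmax_le => // -[i j] _; rewrite ord1; exact: h.
Qed.

Lemma cV_coord_le_norm w i : `|w i ord0| <= `|w|.
Proof.
rewrite [leRHS]/Num.Def.normr/= mx_normrE.
exact: (le_bigmax _ (fun ij : 'I_m * 'I_1 => `|w ij.1 ij.2|) (i, ord0)).
Qed.

Lemma le_sup_norm {n : nat} (Om : set 'rV[R]_n) (w : 'rV[R]_n -> 'cV[R]_m) (B : R) y :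
  (forall y, closure Om y -> `|w y| <= B) -> closure Om y -> `|w y| <= sup_norm Om w.
Proof.
move=> wB Ky; apply: ub_le_sup; last by exists y.
by exists B => _ [z Kz <-]; exact: wB.
Qed.

Lemma sup_norm_le {n : nat} (Om : set 'rV[R]_n) (w : 'rV[R]_n -> 'cV[R]_m) (e : R) :
  Om !=set0 -> (forall y, closure Om y -> `|w y| <= e) -> sup_norm Om w <= e.
Proof.
move=> [y Oy] we; apply: ge_sup => [|_ [z Kz <-]]; last exact: we.
by exists `|w y|, y => //; exact: subset_closure.
Qed.

End norm.

Lemma clamp_dist {R : realType} (a c e : R) : 0 <= c -> 0 <= e ->
  - e <= a -> a <= c + e -> `|a - Num.max 0 (Num.min c a)| <= e.
Proof.
move=> c0 e0 ea ac; rewrite ler_norml.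
case: (leP c a) => ca; first by rewrite max_r//; apply/andP; split; lra.
by case: (leP 0) => a0; apply/andP; split; lra.
Qed.

Section exp_profile.
Context {R : realType}.

(** The amplitudes of the barriers: [A] is the limit and [g] the rate. *)
Definition exp_profile (A B g T t : R) : R := A + B * expR (g * (t - T)).

Lemma exp_profile_start (A B g T : R) : exp_profile A B g T T = A + B.
Proof. by rewrite /exp_profile subrr mulr0 expR0 mulr1. Qed.

Lemma is_derive_exp_profile (A B g T t : R) :
  is_derive t (1 : R) (exp_profile A B g T) (B * (g * expR (g * (t - T)))).
Proof.
have h0 : is_derive t (1 : R) ((id : R -> R) - cst T) (1 - 0).
  by apply: is_deriveB.
have h1 : is_derive t (1 : R) (fun s : R => g * (s - T)) g.
  by have := is_deriveZ g h0; rewrite subr0 [_ *: 1]mulr1.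
have h2 : is_derive t (1 : R) (fun s : R => expR (g * (s - T)))
    (expR (g * (t - T)) * g).
  exact: (@is_derive1_comp _ expR (fun s : R => g * (s - T)) t _ _ _ h1).
have h3 := is_deriveD (is_derive_cst A t (1 : R)) (is_deriveZ B h2).
rewrite add0r in h3; rewrite [g * expR _]mulrC; exact: h3.
Qed.

Lemma continuous_exp_profile (A B g T : R) : continuous (exp_profile A B g T).
Proof.
move=> t; apply: differentiable_continuous; apply/derivable1_diffP.
by have [] := is_derive_exp_profile A B g T t.
Qed.

Lemma exp_profile_eventually (A B g T e : R) : 0 < g -> 0 < e ->
  \forall t \near +oo, `|exp_profile A B (- g) T t - A| < e.
Proof.
move=> g0 e0; near=> t.
have tT : T + `|B| / (e * g) < t by near: t; apply: nbhs_pinfty_gt; exact: num_real.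
rewrite /exp_profile addrAC subrr add0r normrM (gtr0_norm (expR_gt0 _)).
rewrite mulNr expRN ltr_pdivrMr ?expR_gt0//.
apply: (@lt_le_trans _ _ (e * (1 + g * (t - T)))); last first.
  by rewrite ler_pM2l// expR_ge1Dx.
have : `|B| / (e * g) < t - T by lra.
by rewrite ltr_pdivrMr ?mulr_gt0// => h; lra.
Unshelve. all: by end_near. Qed.

End exp_profile.

(** * Barriers and long-time behaviour *)
Section dynamics.
Context {R : realType} {m n : nat}.
Variables (Om : set 'rV[R]_n) (d : 'rV[R]_m) (rho : R -> R).
Variables (J : 'rV[R]_n -> R) (f : 'cV[R]_m -> 'cV[R]_m) (v : 'cV[R]_m).
Variable sigma : R.
Hypothesis Om_open : open Om.
Hypothesis Om_bounded : bounded_set Om.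
Hypothesis d_gt0 : forall i, 0 < d ord0 i.
Hypothesis rho_gt0 : forall t : R, 0 <= t -> 0 < rho t.
Hypothesis rho_smooth : ray_smooth rho.
Hypothesis J_kernel : dispersal_kernel J.
Hypothesis v_gt0 : forall i, 0 < v i ord0.
Hypothesis f_C1 : class_C1 f.
Local Notation M := (order_interval v).
Hypothesis f_coop : forall w, M w ->
  cooperative (Jacobian f w) /\ irreducible (Jacobian f w).
Hypothesis f0 : f 0 = 0.
Hypothesis f_sub : forall w (alpha : R), (M `&` interior nonneg_cone) w ->
  0 < alpha < 1 -> vlt (alpha *: f w) (f (alpha *: w)).
Hypothesis sigma_gt0 : 0 < sigma.
Hypothesis f_top : forall i (t : R) w, 0 <= t -> M w -> w i ord0 = v i ord0 ->
  f w i ord0 - dilution n rho t * v i ord0 <= - sigma.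
Let K := closure Om.
Implicit Types (t s T : R) (y z : 'rV[R]_n) (i j : 'I_m) (w p : 'cV[R]_m).

(** The box exceeds M by 1, in order to contain the values of a solution that is
    not yet known to stay in M. *)
Lemma reaction_lipschitz : exists2 L : R, 0 <= L & forall i w w' (e : R),
  (forall j, -1 <= w j ord0 <= v j ord0 + 1) ->
  (forall j, -1 <= w' j ord0 <= v j ord0 + 1) ->
  (forall j, `|w' j ord0 - w j ord0| <= e) ->
  `|f w' i ord0 - f w i ord0| <= L * e.
Proof.
have /choice[L hL] : forall i, exists L : R, 0 <= L /\ forall w w' (e : R),
  (forall j, -1 <= w j ord0 <= v j ord0 + 1) ->
  (forall j, -1 <= w' j ord0 <= v j ord0 + 1) ->
  (forall j, `|w' j ord0 - w j ord0| <= e) ->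
  `|f w' i ord0 - f w i ord0| <= L * e.
  move=> i; have [L L0 hL] := @lipschitz_box _ _ _ (f_C1 i) (fun=> -1)
    (fun j => v j ord0 + 1).
  by exists L; split.
exists (\sum_i L i); first by apply: sumr_ge0 => i _; have [] := hL i.
move=> i w w' e bw bw' ww'; have [L0 /(_ w w' e bw bw' ww') h] := hL i.
apply: le_trans h _; apply: ler_wpM2r.
  by apply: le_trans (ww' i); exact: normr_ge0.
rewrite (bigD1 i)//= lerDl; apply: sumr_ge0 => j _; by have [] := hL j.
Qed.

Variable kappa : R.
Hypothesis dilution_kappa : dilution n rho t @[t --> +oo] --> kappa.

Lemma eventually_dilution (e : R) : 0 < e -> exists2 T : R, 0 <= T &
  forall t, T <= t -> `|kappa - dilution n rho t| < e.
Proof.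
move=> e0; have /cvgrPdist_lt/(_ e e0) [A [_ hA]] := dilution_kappa.
exists (Num.max 0 (A + 1)); first by rewrite le_max lexx.
by move=> t; rewrite ge_max => /andP[_ At]; apply: hA; lra.
Qed.

(** The vector field is negative with a margin, which absorbs the difference
    between the dilution and its limit. *)
Lemma supersolution_eventually p : (forall i, 0 < p i ord0) ->
  (forall i, net f kappa i p < 0) -> exists gamma T : R, [/\ 0 < gamma, 0 <= T &
    forall t i, T <= t ->
      f p i ord0 - dilution n rho t * p i ord0 + gamma * p i ord0 < 0].
Proof.
move=> p0 hp.
have hg : \forall g \near (0 : R)^'+, forall i,
    g < - net f kappa i p / (2 * p i ord0).
  apply: (@filter_forall _ _ (fun i (g : R) =>
    g < - net f kappa i p / (2 * p i ord0)) ((0 : R)^'+)) => i.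
  by apply: nbhs_right_lt; rewrite divr_gt0 ?oppr_gt0 ?mulr_gt0.
near (0 : R)^'+ => g; have g0 : 0 < g by [].
have hg' : forall i, g < - net f kappa i p / (2 * p i ord0) by near: g.
have [T T0 hT] := eventually_dilution g0.
exists g, T; split => // t i Tt.
have := hT t Tt; rewrite ltr_norml => /andP[h1 h2].
have := hg' i; rewrite ltr_pdivlMr ?mulr_gt0// /net => h3.
have : (kappa - dilution n rho t) * p i ord0 < g * p i ord0 by rewrite ltr_pM2r.
lra.
Unshelve. all: by end_near. Qed.

(** Here [gamma] is at the same time the margin and the fraction that dispersal
    is allowed to lose in [lower_barrier]. *)
Lemma subsolution_eventually p : (forall i, 0 < p i ord0) ->
  (forall i, 0 < net f kappa i p) -> exists gamma T : R, [/\ 0 < gamma, 0 <= T &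
    forall t i, T <= t -> gamma * p i ord0 <=
      f p i ord0 - dilution n rho t * p i ord0 - d ord0 i * gamma * p i ord0].
Proof.
move=> p0 hp.
have d2 i : 0 < 2 + d ord0 i by rewrite addr_gt0.
have hg : \forall g \near (0 : R)^'+, forall i,
    g < net f kappa i p / ((2 + d ord0 i) * p i ord0).
  apply: (@filter_forall _ _ (fun i (g : R) =>
    g < net f kappa i p / ((2 + d ord0 i) * p i ord0)) ((0 : R)^'+)) => i.
  by apply: nbhs_right_lt; rewrite divr_gt0 ?mulr_gt0.
near (0 : R)^'+ => g; have g0 : 0 < g by [].
have hg' : forall i, g < net f kappa i p / ((2 + d ord0 i) * p i ord0) by near: g.
have [T T0 hT] := eventually_dilution g0.
exists g, T; split => // t i Tt.
have := hT t Tt; rewrite ltr_norml => /andP[h1 h2].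
have := hg' i; rewrite ltr_pdivlMr ?mulr_gt0// /net => h3.
have : - g * p i ord0 < (kappa - dilution n rho t) * p i ord0 by rewrite ltr_pM2r.
lra.
Unshelve. all: by end_near. Qed.

Section one_solution.
Variables (phi : 'rV[R]_n -> 'cV[R]_m) (u : R -> 'rV[R]_n -> 'cV[R]_m).
Hypothesis phi_M : forall y, K y -> M (phi y).
Hypothesis u_sol : is_solution Om d rho J f phi u.

Let compact_K : compact K. Proof. exact: compact_closure_domain. Qed.

Let K_Om y : Om y -> K y. Proof. exact: subset_closure. Qed.

Lemma barrier_continuous (g : R * 'rV[R]_n -> R) (s : R) i a b : 0 <= a ->
  continuous g -> {within `[a, b]%classic `*` K,
    continuous (fun p : R * 'rV[R]_n => g p + s * u p.1 p.2 i ord0)}.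
Proof.
move=> a0 cg; have cu := @solution_continuous_on _ _ _ _ _ _ _ _ _ _ u_sol i a b a0.
have cg' : {within `[a, b]%classic `*` K, continuous g} by exact: continuous_subspaceT.
have cs : {within `[a, b]%classic `*` K, continuous (fun _ : R * 'rV[R]_n => s)}.
  by apply: continuous_subspaceT; exact: cst_continuous.
by move=> p; exact: (continuousD (cg' p) (continuousM (cs p) (cu p))).
Qed.

Let rate t y i : R :=
  d ord0 i * (disperse Om J (rho t) (fun z => u t z i ord0) y - u t y i ord0)
  - dilution n rho t * u t y i ord0 + f (u t y) i ord0.

Let barrier_derive (c s A B g T : R) t y i : 0 < t -> K y ->
  is_derive t (1 : R) (fun r : R => c * exp_profile A B g T r + s * u r y i ord0)
    (c * (B * (g * expR (g * (t - T)))) + s * rate t y i).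
Proof.
move=> t0 Ky; have h1 := is_derive_exp_profile A B g T t.
have h2 := solution_derive u_sol i t0 Ky.
exact: (is_deriveD (is_deriveZ c h1) (is_deriveZ s h2)).
Qed.

Let bm t i : 0 <= t -> bounded_measurable Om (fun z => u t z i ord0).
Proof. by move=> t0; exact: (solution_bounded_measurable Om_open Om_bounded u_sol i t0). Qed.

Let continuous_fst_profile (A B g T : R) :
  continuous (fun p : R * 'rV[R]_n => exp_profile A B g T p.1).
Proof.
move=> p; apply: (@continuous_comp _ _ _ fst (exp_profile A B g T)).
  exact: cvg_fst.
exact: continuous_exp_profile.
Qed.

(** The cooperativity of the reaction is only known on M, so that a solution
    leaving M slightly is compared with its coordinatewise projection to M. The
    error is proportional to the margin, whose exponential growth absorbs it. *)
Lemma solution_invariant_upto b : 0 <= b -> exists2 L : R, 0 <= L &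
  forall e : R, 0 < e -> e * expR (L * b) <= 1 -> forall i t y, 0 <= t <= b -> K y ->
    0 < e * expR (L * t) + u t y i ord0 /\
    0 < v i ord0 + e * expR (L * t) - u t y i ord0.
Proof.
move=> b0; have [L L0 hL] := reaction_lipschitz.
have [C C0 hC] := dilution_bounded n b rho_gt0 rho_smooth.
exists (L + C + 1) => [|e e0 eb]; first by rewrite !addr_ge0.
set g := L + C + 1 in eb *.
have g0 : 0 <= g by rewrite !addr_ge0.
pose A (i : 'I_m * bool) : R := if i.2 then 0 else v i.1 ord0.
pose sg (b : bool) : R := if b then 1 else -1.
pose h (i : 'I_m * bool) (t : R) (y : 'rV[R]_n) : R :=
  1 * exp_profile (A i) e g 0 t + sg i.2 * u t y i.1 ord0.
have hT i t y : h (i, true) t y = e * expR (g * t) + u t y i ord0.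
  by rewrite /h /exp_profile/= subr0 add0r !mul1r.
have hF i t y : h (i, false) t y = v i ord0 + e * expR (g * t) - u t y i ord0.
  by rewrite /h /A /exp_profile/= subr0 mul1r mulN1r.
suff hpos : forall (i : 'I_m * bool) t y, 0 <= t <= b -> K y -> 0 < h i t y.
  move=> i t y tb Ky; split.
    by rewrite -hT; exact: hpos.
  by rewrite -hF; exact: hpos.
apply: first_touching => //.
- move=> i; apply: barrier_continuous => //.
  move=> p; have c1 : {for p, continuous (fun _ : R * 'rV[R]_n => 1 : R)}.
    exact: cst_continuous.
  exact: (continuousM c1 (@continuous_fst_profile _ _ _ _ p)).
- move=> [i []] y Ky; rewrite /h exp_profile_start mul1r/=.
    rewrite add0r mul1r (solution_start u_sol i Ky).
    by have /order_intervalP/(_ i)/andP[h1 _] := phi_M Ky; lra.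
  rewrite mulN1r (solution_start u_sol i Ky) /A/=.
  by have /order_intervalP/(_ i)/andP[_ h1] := phi_M Ky; lra.
move=> [i o] t y /andP[t0 tb] Ky hi hj.
exists (1 * (e * (g * expR (g * (t - 0)))) + sg o * rate t y i); last first.
  exact: barrier_derive.
have rt : 0 < rho t by apply: rho_gt0; exact: ltW.
pose E : R := e * expR (g * t).
have E0 : 0 < E by rewrite mulr_gt0// expR_gt0.
have E1 : E <= 1.
  by apply: le_trans eb; rewrite ler_pM2l// ler_expR ler_wpM2l.
have lo j z : K z -> - E <= u t z j ord0.
  by move=> Kz; have := hj (j, true) z Kz; rewrite hT -/E; lra.
have hi' j z : K z -> u t z j ord0 <= v j ord0 + E.
  by move=> Kz; have := hj (j, false) z Kz; rewrite hF -/E; lra.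
pose Pu : 'cV[R]_m := \col_j Num.max 0 (Num.min (v j ord0) (u t y j ord0)).
have PuE j : Pu j ord0 = Num.max 0 (Num.min (v j ord0) (u t y j ord0)) by rewrite mxE.
have Pu_b j : 0 <= Pu j ord0 <= v j ord0.
  by rewrite PuE le_max lexx/= ge_max ge_min lexx (ltW (v_gt0 j)).
have MPu : M Pu by apply/order_intervalP.
have Pu_u j : `|u t y j ord0 - Pu j ord0| <= E.
  rewrite PuE; apply: clamp_dist; [exact: ltW|exact: ltW| |exact: hi'].
  exact: lo.
have fPu : `|f (u t y) i ord0 - f Pu i ord0| <= L * E.
  apply: hL => // j.
    by have /andP[] := Pu_b j => p0 pv; apply/andP; split; lra.
  have := lo j y Ky; have := hi' j y Ky => h1 h2; apply/andP; split; lra.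
have tdil : `|dilution n rho t| <= C by apply: hC; rewrite ltW.
have dE : `|dilution n rho t * E| <= C * E by rewrite normrM (gtr0_norm E0) ler_pM2r.
move: fPu dE; rewrite !ler_norml => /andP[f1 f2] /andP[dE1 dE2].
have di := d_gt0 i.
rewrite subr0 mul1r mulrCA -/E; case: o hi => hi.
  have ui : u t y i ord0 = - E.
    by move: hi; rewrite hT -/E; lra.
  have Pui : Pu i ord0 = 0.
    rewrite PuE ui max_l// ge_min oppr_le0 (ltW E0) orbT//.
  have fP0 := reaction_ge0 v_gt0 f_C1 f_coop f0 MPu Pui.
  have dis : - E <= disperse Om J (rho t) (fun z => u t z i ord0) y.
    apply: disperse_ge => //; [exact: ltW|by apply: bm; exact: ltW|].
    by move=> z /K_Om Kz; exact: lo.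
  rewrite /sg mul1r /rate ui.
  have : 0 <= d ord0 i * (disperse Om J (rho t) (fun z => u t z i ord0) y - - E).
    by rewrite mulr_ge0 ?(ltW di)//; lra.
  have gE : g * E = L * E + C * E + E by rewrite /g; ring.
  rewrite gE mulrN; lra.
have ui : u t y i ord0 = v i ord0 + E.
  by move: hi; rewrite hF -/E; lra.
have Pui : Pu i ord0 = v i ord0.
  by rewrite PuE ui min_l ?lerDl ?(ltW E0)// max_r// ltW.
have fPv := f_top (ltW t0) MPu Pui.
have vi := v_gt0 i.
have dis : disperse Om J (rho t) (fun z => u t z i ord0) y <= v i ord0 + E.
  apply: disperse_le => //; [by rewrite addr_ge0 ?ltW|by apply: bm; exact: ltW|].
  by move=> z /K_Om Kz; exact: hi'.
rewrite /sg mulN1r /rate ui.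
have : d ord0 i * (disperse Om J (rho t) (fun z => u t z i ord0) y - (v i ord0 + E)) <= 0.
  by rewrite mulr_ge0_le0 ?(ltW di)//; lra.
have gE : g * E = L * E + C * E + E by rewrite /g; ring.
rewrite gE; have s0 := sigma_gt0 => X0; clearbody E.
move: f1 f2 dE1 dE2 fPv; rewrite mulrDr; lra.
Qed.

Lemma solution_invariant t y : 0 <= t -> K y -> M (u t y).
Proof.
move=> t0 Ky; have [L L0 h] := solution_invariant_upto t0.
apply/order_intervalP => i.
have key (e : R) : 0 < e -> e <= 1 -> - e <= u t y i ord0 <= v i ord0 + e.
  move=> e0 e1; have X0 := expR_gt0 (L * t).
  have e0' : 0 < e / expR (L * t) by rewrite divr_gt0.
  have eK : e / expR (L * t) * expR (L * t) = e by rewrite divfK// gt_eqF.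
  have tt : 0 <= t <= t by rewrite t0 lexx.
  have := h _ e0'; rewrite eK => /(_ e1 i t y tt Ky); rewrite eK => -[h1 h2].
  by apply/andP; split; lra.
apply/andP; split.
  rewrite leNgt; apply/negP => u0.
  pose e := Num.min 1 (- u t y i ord0 / 2).
  have e0 : 0 < e by rewrite /e lt_min ltr01/=; lra.
  have e1 : e <= 1 by rewrite /e ge_min lexx.
  have e2 : e <= - u t y i ord0 / 2 by rewrite /e ge_min lexx orbT.
  by have /andP[] := key e e0 e1; lra.
apply/ler_addgt0Pr => e e0.
have e0' : 0 < Num.min 1 e by rewrite lt_min ltr01.
have e1' : Num.min 1 e <= 1 by rewrite ge_min lexx.
have /andP[_ h1] := key _ e0' e1'.
by apply: le_trans h1 _; rewrite lerD2l ge_min lexx orbT.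
Qed.

Let u_ge0 t y i : 0 <= t -> K y -> 0 <= u t y i ord0.
Proof.
by move=> t0 Ky; have /order_intervalP/(_ i)/andP[] := solution_invariant t0 Ky.
Qed.

Let slice t i : 0 <= t -> {within K, continuous (fun y => u t y i ord0)}.
Proof. exact: (@solution_slice _ _ _ _ _ _ _ _ _ _ u_sol). Qed.

(** At a first contact with the profile the gap between the profile and the
    solution would have a positive derivative. *)
Let barrier_touching (c : 'I_m -> R) (A B g T b : R) : 0 <= T ->
  (forall i y, K y -> u T y i ord0 < c i * (A + B)) ->
  (forall t y i, T < t <= b -> K y ->
    u t y i ord0 = c i * exp_profile A B g T t ->
    (forall j z, K z -> u t z j ord0 <= c j * exp_profile A B g T t) ->
    rate t y i < c i * (B * (g * expR (g * (t - T))))) ->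
  forall t y i, T <= t <= b -> K y -> u t y i ord0 < c i * exp_profile A B g T t.
Proof.
move=> T0 start touch t y i tb Ky.
pose h (i : 'I_m) (t : R) (y : 'rV[R]_n) : R :=
  c i * exp_profile A B g T t + (-1) * u t y i ord0.
suff : 0 < h i t y by rewrite /h; lra.
move: i t y tb Ky; apply: first_touching => //.
- move=> i; apply: barrier_continuous => //.
  move=> p; have c1 : {for p, continuous (fun _ : R * 'rV[R]_n => c i : R)}.
    exact: cst_continuous.
  exact: (continuousM c1 (@continuous_fst_profile _ _ _ _ p)).
- by move=> i y Ky; rewrite /h exp_profile_start; have := start i y Ky; lra.
move=> i t y /andP[Tt tb] Ky h0 hj.
exists (c i * (B * (g * expR (g * (t - T)))) + (-1) * rate t y i); last first.
  by apply: barrier_derive => //; exact: le_lt_trans Tt.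
have : rate t y i < c i * (B * (g * expR (g * (t - T)))).
  apply: touch => //; [by rewrite Tt| by move: h0; rewrite /h; lra|].
  by move=> j z Kz; have := hj j z Kz; rewrite /h; lra.
by lra.
Qed.

(** A supersolution of the limiting kinetics is a barrier, also when it is
    multiplied by a factor above 1 that decreases to 1: by subhomogeneity the
    reaction at a multiple is at most that multiple of the reaction. *)
Lemma upper_barrier p (gamma T a0 : R) : M p -> (forall i, 0 < p i ord0) ->
  0 <= gamma -> 0 <= T -> 0 <= a0 ->
  (forall t i, T <= t ->
    f p i ord0 - dilution n rho t * p i ord0 + gamma * p i ord0 < 0) ->
  (forall i y, K y -> u T y i ord0 < (1 + a0) * p i ord0) ->
  forall t y i, T <= t -> K y ->
    u t y i ord0 < p i ord0 * exp_profile 1 a0 (- gamma) T t.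
Proof.
move=> Mp p0 g0 T0 a00 fp start t y i Tt Ky.
apply: (@barrier_touching (fun i => p i ord0) 1 a0 (- gamma) T t) => //.
- by move=> {}i {}y {}Ky; rewrite mulrC; exact: start.
- move=> {y i Ky t Tt}t y i /andP[Tt _] Ky ui uj.
  have t0 : 0 < t by exact: le_lt_trans Tt.
  set X := expR _ in ui uj *; rewrite -/X.
  have X0 : 0 < X by exact: expR_gt0.
  pose al : R := 1 + a0 * X.
  have alE : exp_profile 1 a0 (- gamma) T t = al by [].
  rewrite alE in ui uj.
  have al1 : 1 <= al by rewrite /al lerDl mulr_ge0// ltW.
  have al0 : 0 < al by exact: lt_le_trans al1.
  have Mu := solution_invariant (ltW t0) Ky.
  pose w := al^-1 *: u t y.
  have uw : u t y = al *: w by rewrite /w scalerA divff ?gt_eqF// scale1r.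
  have Mw : M w by apply: orderI_scale => //; rewrite invr_ge0 (ltW al0) invf_le1.
  have wE j : w j ord0 = u t y j ord0 / al by rewrite mxE mulrC.
  have fu : f (u t y) i ord0 <= al * f p i ord0.
    rewrite uw; apply: le_trans (reaction_super v_gt0 f_C1 f_sub i al1 _) _; first by rewrite -uw.
    rewrite ler_pM2l//; apply: (reaction_mono f_C1 f_coop) => //.
      by move=> j; rewrite wE ler_pdivrMr// uj.
    by rewrite wE ui mulfK// gt_eqF.
  have dis : disperse Om J (rho t) (fun z => u t z i ord0) y <= p i ord0 * al.
    apply: disperse_le => //; [exact/rho_gt0/ltW|by rewrite mulr_ge0 ?ltW|by apply: bm; exact: ltW|].
    by move=> z /K_Om; exact: uj.
  have dd : d ord0 i * (disperse Om J (rho t) (fun z => u t z i ord0) y - u t y i ord0) <= 0.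
    by rewrite mulr_ge0_le0 ?(ltW (d_gt0 i))// ui; lra.
  rewrite /rate.
  have fpi := fp t i (ltW Tt).
  have : al * (f p i ord0 - dilution n rho t * p i ord0 + gamma * p i ord0) < 0.
    by rewrite pmulr_rlt0.
  have -> : p i ord0 * (a0 * (- gamma * X)) = gamma * p i ord0 - al * (gamma * p i ord0).
    by rewrite /al; ring.
  have : 0 <= gamma * p i ord0 by rewrite mulr_ge0// ltW.
  by move: dd; rewrite ui; lra.
by rewrite Tt lexx.
Qed.

(** This controls a small solution during the initial period in which the
    dilution is not yet close to its limit. *)
Lemma solution_growth (L C b e : R) : 0 <= C -> 0 <= L ->
  (forall i w (x : R), M w -> (forall j, w j ord0 <= x) -> f w i ord0 <= L * x) ->
  (forall t, 0 <= t <= b -> `|dilution n rho t| <= C) ->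
  0 < e -> (forall i y, K y -> phi y i ord0 < e) ->
  forall t y i, 0 <= t <= b -> K y -> u t y i ord0 < e * expR ((L + C + 1) * t).
Proof.
move=> C0 L0 hL hC e0 start t y i tb Ky; have /andP[t0 _] := tb.
set g := L + C + 1.
have E (s : R) : 1 * exp_profile 0 e g 0 s = e * expR (g * s).
  by rewrite /exp_profile subr0 add0r mul1r.
rewrite -E; apply: (@barrier_touching (fun=> 1) 0 e g 0 b) => //.
  by move=> {}i {}y {}Ky; rewrite add0r mul1r (solution_start u_sol)// start.
move=> {t0 tb y i Ky t}t y i /andP[t0 tb] Ky.
rewrite E subr0 mul1r => ui uj; pose X : R := e * expR (g * t).
have {}uj j z : K z -> u t z j ord0 <= X by exact: uj.
rewrite -/X in ui; have X0 : 0 < X by rewrite mulr_gt0// expR_gt0.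
have Mu := solution_invariant (ltW t0) Ky.
have fu : f (u t y) i ord0 <= L * X by apply: hL => // j; exact: uj.
have dis : disperse Om J (rho t) (fun z => u t z i ord0) y <= X.
  apply: disperse_le => //; [exact/rho_gt0/ltW|exact: ltW|by apply: bm; exact: ltW|].
  by move=> z /K_Om; exact: uj.
have dd : d ord0 i * (disperse Om J (rho t) (fun z => u t z i ord0) y - X) <= 0.
  by rewrite mulr_ge0_le0 ?(ltW (d_gt0 i))//; lra.
have tdil : `|dilution n rho t| <= C by apply: hC; rewrite ltW.
have : `|dilution n rho t * X| <= C * X by rewrite normrM (gtr0_norm X0) ler_pM2r.
rewrite ler_norml /rate ui => /andP[dE1 dE2].
have -> : e * (g * expR (g * t)) = L * X + C * X + X by rewrite /X /g; ring.
by move: dd; lra.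
Qed.

(** Dispersal and the other components can only increase the i-th component, so
    that at a fixed point it decays at most exponentially. *)
Lemma positive_persists i y T : 0 <= T -> K y -> 0 < phi y i ord0 ->
  0 < u T y i ord0.
Proof.
move=> T0 Ky phi0.
have [L L0 hL] := reaction_lipschitz.
have [C C0 hC] := dilution_bounded n T rho_gt0 rho_smooth.
pose g := d ord0 i + C + L + 1; pose e := phi y i ord0 / 2.
have e0 : 0 < e by rewrite divr_gt0.
pose h (_ : 'I_1) (t : R) (z : 'rV[R]_n) : R :=
  (-1) * exp_profile 0 e (- g) 0 t + 1 * u t z i ord0.
have hE k t z : h k t z = u t z i ord0 - e * expR (- g * t).
  by rewrite /h /exp_profile subr0 add0r; ring.
suff : 0 < h ord0 T y.
  rewrite hE subr_gt0; apply: lt_trans.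
  by rewrite mulr_gt0// expR_gt0.
have T00 : 0 <= T <= T by rewrite T0 lexx.
apply: (@first_touching _ _ _ [set y] 0 T h _ _ _ _ ord0 T y T00) => //.
- exact: compact_set1.
- move=> k; have : {within `[0, T]%classic `*` K, continuous (fun p : R * 'rV[R]_n => h k p.1 p.2)}.
    apply: barrier_continuous => //.
    move=> p; have c1 : {for p, continuous (fun _ : R * 'rV[R]_n => -1 : R)}.
      exact: cst_continuous.
    exact: (continuousM c1 (@continuous_fst_profile _ _ _ _ p)).
  by apply: continuous_subspaceW => -[s z] /= [sT ->].
- move=> k z ->; rewrite hE mulr0 expR0 mulr1 (solution_start u_sol i Ky) /e; lra.
move=> k t z /andP[t0 tT] -> h0 _.
exists ((-1) * (e * (- g * expR (- g * (t - 0)))) + 1 * rate t y i); last first.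
  exact: barrier_derive.
pose X : R := e * expR (- g * t); have X0 : 0 < X by rewrite mulr_gt0 ?expR_gt0.
have ui : u t y i ord0 = X by move: h0; rewrite hE -/X; lra.
have Mu := solution_invariant (ltW t0) Ky.
have uv j : 0 <= u t y j ord0 <= v j ord0 by move: j; exact/order_intervalP.
(* The reaction is nonnegative on the face where the i-th coordinate vanishes;
   replacing that coordinate by 0 costs a multiple of it. *)
pose w : 'cV[R]_m := \col_j if j == i then 0 else u t y j ord0.
have wE j : w j ord0 = if j == i then 0 else u t y j ord0 by rewrite mxE.
have wv j : 0 <= w j ord0 <= v j ord0.
  by rewrite wE; case: eqP => // _; rewrite lexx ltW.
have fw : 0 <= f w i ord0.
  apply: (reaction_ge0 v_gt0 f_C1 f_coop f0); first exact/order_intervalP.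
  by rewrite wE eqxx.
have : `|f (u t y) i ord0 - f w i ord0| <= L * X.
  apply: hL => j.
  - by have /andP[] := wv j => a b; apply/andP; split; lra.
  - by have /andP[] := uv j => a b; apply/andP; split; lra.
  - rewrite wE; case: eqP => [->|_]; last by rewrite subrr normr0 ltW.
    by rewrite subr0 ui gtr0_norm.
rewrite ler_norml => /andP[fu _].
have tdil : `|dilution n rho t| <= C by apply: hC; rewrite ltW.
have : `|dilution n rho t * X| <= C * X by rewrite normrM (gtr0_norm X0) ler_pM2r.
rewrite ler_norml => /andP[_ dE].
have dis : 0 <= disperse Om J (rho t) (fun z => u t z i ord0) y.
  apply: (disperse_ge0 J_kernel); [exact/rho_gt0/ltW|].
  by move=> z' /K_Om Kz; apply: u_ge0 => //; exact: ltW.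
have dd : 0 <= d ord0 i * disperse Om J (rho t) (fun z => u t z i ord0) y.
  by rewrite mulr_ge0// ltW.
rewrite subr0 /rate ui mul1r.
have -> : - 1 * (e * (- g * expR (- g * t))) = d ord0 i * X + C * X + L * X + X.
  by rewrite /X /g; ring.
by rewrite mulrBr; lra.
Qed.

(** A vanishing component is at a minimum in time, so that the two nonnegative
    contributions to its derivative both vanish. *)
Lemma zero_stationary t y i : 0 < t -> K y -> u t y i ord0 = 0 ->
  disperse Om J (rho t) (fun z => u t z i ord0) y = 0 /\ f (u t y) i ord0 = 0.
Proof.
move=> t0 Ky ui.
have t1 : (0 : R) <= t + 1 by lra.
have tin : t \in `]0, t + 1[ by rewrite in_itv/= t0/= ltrDl.
have Dt s : s \in `]0, t + 1[ -> derivable (fun s => u s y i ord0) s 1.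
  rewrite in_itv/= => /andP[s0 _].
  by have [] := solution_derive u_sol i s0 Ky.
have [|_ D0] := derive1_at_min t1 Dt tin _.
  move=> s; rewrite in_itv/= => /andP[s0 _]; rewrite ui.
  by apply: u_ge0 => //; exact: ltW.
have [_] := solution_derive u_sol i t0 Ky; rewrite D0 ui subr0 mulr0 subr0 => E.
have f_ge0 : 0 <= f (u t y) i ord0.
  by apply: (reaction_ge0 v_gt0 f_C1 f_coop f0) => //; apply: solution_invariant => //; exact: ltW.
have dis : 0 <= disperse Om J (rho t) (fun z => u t z i ord0) y.
  apply: (disperse_ge0 J_kernel); [exact/rho_gt0/ltW|].
  by move=> z /K_Om Kz; apply: u_ge0 => //; exact: ltW.
have di := d_gt0 i.
have dd : 0 <= d ord0 i * disperse Om J (rho t) (fun z => u t z i ord0) y.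
  by rewrite mulr_ge0// ltW.
have /eqP : d ord0 i * disperse Om J (rho t) (fun z => u t z i ord0) y = 0 by lra.
rewrite mulf_eq0 gt_eqF//= => /eqP dis0; split => //.
by move: E; rewrite dis0; lra.
Qed.

Hypothesis Om_connected : connected Om.

(** The zero set of a component is closed, and it is open in the closure of the
    domain since the kernel is positive near 0; this closure is connected. *)
Lemma zero_spreads t y i : 0 < t -> K y -> u t y i ord0 = 0 ->
  forall z, K z -> u t z i ord0 = 0.
Proof.
move=> t0 Ky ui; have t0' := ltW t0.
have [J_cont J_ge0 J0 _] := J_kernel.
have /nbhs_ballP[e /= e0 Je] : \forall x \near (0 : 'rV[R]_n), 0 < J x.
  by apply: (cvgr_gt _ (J_cont 0)).
have rt := rho_gt0 t0'; pose r := e / rho t; have r0 : 0 < r by rewrite divr_gt0.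
pose Z : set 'rV[R]_n := [set z | u t z i ord0 = 0].
have local_zero x : K x -> Z x -> K `&` ball x r `<=` Z.
  move=> Kx Zx z [Kz xz]; rewrite /Z/=; have [d0 _] := zero_stationary t0 Kx Zx.
  have := u_ge0 i t0' Kz; rewrite le_eqVlt => /orP[/eqP//|uz].
  have cs := @slice t i t0'.
  have /subspace_continuousP/(_ _ Kz) cu := cs.
  have : \forall z' \near within K (nbhs z), 0 < u t z' i ord0 by apply: (cvgr_gt _ cu).
  rewrite near_withinE => nz.
  have nx : \forall z' \near z, ball x r z'.
    by apply: open_nbhs_nbhs; split => //; exact: ball_open.
  have [z' [Oz' [xz' uz']]] := Kz _ (filterI nx nz).
  have {}uz' := uz' (K_Om Oz').
  have : u t z' i ord0 = 0.
    apply: (disperse_eq0 Om_open J_kernel rt (bm i t0') _ Oz' _ _ d0).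
    - by move=> z0 /K_Om Kz0; exact: u_ge0.
    - exact: (@solution_continuous_at _ _ _ _ _ _ _ _ Om_open _ _ u_sol t i z' t0' Oz').
    apply: Je; rewrite ball_rVE// => k; rewrite !mxE sub0r normrN normrM (gtr0_norm rt).
    by move: xz'; rewrite ball_rVE// => /(_ k); rewrite /r ltr_pdivlMr// mulrC.
  by move=> E; move: uz'; rewrite E ltxx.
pose Q := K `&` \bigcup_(x in K `&` Z) ball x r.
have QE : Q = K `&` Z.
  apply/seteqP; split => [z [Kz [x [Kx Zx] xz]]|z [Kz Zz]].
    by split => //; exact: (local_zero x).
  by split => //; exists z => //; exact: ballxx.
have QK : Q = K.
  apply: (connected_closure Om_connected).
  - by exists y; rewrite QE.
  - exists (\bigcup_(x in K `&` Z) ball x r) => //.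
    by apply: bigcup_open => x _; exact: ball_open.
  have /continuous_closedP/(_ _ (@closed_eq R 0)) := @slice t i t0'.
  move/closed_subspaceP => [V cV VE].
  by exists V => //; rewrite QE setIC [RHS]setIC VE.
by move=> z; rewrite -QK QE => -[].
Qed.

(** A component that vanishes somewhere vanishes everywhere, in particular at a
    point where another one is positive; there [reaction_face] gives a vanishing
    component with a positive reaction, which is not stationary. *)
Lemma strongly_positive : (exists2 y, K y & exists i, phi y i ord0 != 0) ->
  forall t y i, 0 < t -> K y -> 0 < u t y i ord0.
Proof.
move=> [y0 Ky0 [j phi_j]] t y i t0 Ky; have t0' := ltW t0.
rewrite lt_neqAle u_ge0// andbT eq_sym; apply/negP => /eqP ui.
have uj : u t y0 j ord0 != 0.
  rewrite gt_eqF// positive_persists//.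
  by have /order_intervalP/(_ j)/andP[h _] := phi_M Ky0; rewrite lt_neqAle eq_sym phi_j.
have [||l [ul]] := reaction_face v_gt0 f_C1 f_coop f0 (solution_invariant t0' Ky0).
- by exists j.
- by exists i; exact: zero_spreads ui _ Ky0.
by have [_ ->] := zero_stationary t0 Ky0 ul; rewrite ltxx.
Qed.

Lemma uniformly_positive t : 0 <= t ->
  (forall y i, K y -> 0 < u t y i ord0) ->
  exists2 a : R, 0 < a < 1 & forall y i, K y -> a * v i ord0 < u t y i ord0.
Proof.
move=> t0 pos.
have /choice[c hc] : forall i, exists c : R,
    0 < c /\ forall y, K y -> c <= u t y i ord0.
  move=> i; have [K0|/set0P K0] := eqVneq K set0.
    by exists 1; split => // y; rewrite K0.
  have [y yK ymin] := compact_EVT_min K0 compact_K (@slice t i t0).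
  exists (u t y i ord0); split => [|z Kz]; last by apply: ymin; rewrite inE.
  by apply: pos; rewrite inE in yK.
have : \forall a \near (0 : R)^'+, forall i, a < c i / v i ord0.
  apply: (@filter_forall _ _ (fun i (a : R) => a < c i / v i ord0) ((0 : R)^'+)) => i.
  by apply: nbhs_right_lt; rewrite divr_gt0//; have [] := hc i.
move=> hca; near (0 : R)^'+ => a.
have ha : forall i, a < c i / v i ord0 by near: a.
exists a; first by apply/andP; split.
move=> y i Ky; have [_ /(_ y Ky)] := hc i; apply: lt_le_trans.
by rewrite -ltr_pdivlMr.
Unshelve. all: by end_near. Qed.

(** A strict subsolution of the limiting kinetics is a barrier from below when
    it is multiplied by a bump in space, on which dispersal loses little, and by
    a factor that increases to 1. *)
Lemma lower_barrier p (s : 'rV[R]_n -> R) (gamma delta T a0 : R) :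
  M p -> (forall i, 0 < p i ord0) -> 0 < gamma -> 0 <= T -> 0 < a0 < 1 ->
  continuous s -> bounded_measurable Om s -> (forall y, 0 <= s y <= 1) ->
  (forall t y, T <= t -> (1 - delta) * s y <= disperse Om J (rho t) s y) ->
  (forall t i, T <= t ->
    gamma * p i ord0 <=
    f p i ord0 - dilution n rho t * p i ord0 - d ord0 i * delta * p i ord0) ->
  (forall t y i, T <= t -> K y -> 0 < u t y i ord0) ->
  (forall y i, K y -> a0 * p i ord0 < u T y i ord0) ->
  forall t y i, T <= t -> K y ->
    s y * p i ord0 * exp_profile 1 (a0 - 1) (- (gamma * a0)) T t < u t y i ord0.
Proof.
move=> Mp p0 g0 T0 /andP[a00 a01] s_cont bms s01 s_disp fp pos start t y i Tt Ky.
set al := exp_profile _ _ _ _.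
have alE (r : R) : al r = 1 - (1 - a0) * expR (- (gamma * a0) * (r - T)).
  by rewrite /al /exp_profile; ring.
pose h (i : 'I_m) (t : R) (y : 'rV[R]_n) : R :=
  - (s y * p i ord0) * al t + 1 * u t y i ord0.
suff : 0 < h i t y by rewrite /h; lra.
have tT : T <= t <= t by rewrite Tt lexx.
move: i t y Tt Ky tT => i b y Tb Ky tT.
apply: (@first_touching _ _ _ K T b h compact_K _ _ _ i b y tT Ky).
- move=> {}i; apply: barrier_continuous => // q.
  have c1 : {for q, continuous (fun q : R * 'rV[R]_n => s q.2)}.
    apply: (@continuous_comp _ _ _ snd s); [exact: cvg_snd|exact: s_cont].
  have c2 : {for q, continuous (fun _ : R * 'rV[R]_n => p i ord0 : R)}.
    exact: cst_continuous.
  have c3 := continuousN (continuousM c1 c2).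
  exact: (continuousM c3 (@continuous_fst_profile _ _ _ _ q)).
- move=> {}i {}y {}Ky; rewrite /h /al exp_profile_start.
  have := start y i Ky; have /andP[s0 s1] := s01 y.
  have : s y * (a0 * p i ord0) <= 1 * (a0 * p i ord0).
    by rewrite ler_wpM2r// mulr_ge0// ltW.
  by move: (p i ord0) (u T y i ord0) => P U; lra.
move=> {y i Ky Tb tT}i t y /andP[Tt tb] Ky h0 hj.
have t0 : 0 < t by exact: le_lt_trans Tt.
exists (- (s y * p i ord0) * ((a0 - 1) * (- (gamma * a0) * expR (- (gamma * a0) * (t - T))))
  + 1 * rate t y i); last exact: barrier_derive.
set X := expR _.
have X0 : 0 < X by exact: expR_gt0.
have X1 : X <= 1.
  rewrite -expR0 ler_expR mulNr oppr_le0 mulr_ge0 ?mulr_ge0 ?ltW//.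
  by rewrite subr_gt0.
have alX : al t = 1 - (1 - a0) * X by exact: alE.
have al0 : a0 <= al t.
  by rewrite alX; have : (1 - a0) * X <= (1 - a0) * 1; [rewrite ler_wpM2l// subr_ge0 ltW|lra].
have al1 : al t <= 1.
  by rewrite alX; have : 0 <= (1 - a0) * X; [rewrite mulr_ge0// ltW// subr_gt0|lra].
have alp : 0 < al t by exact: lt_le_trans al0.
have ui : u t y i ord0 = s y * p i ord0 * al t by move: h0; rewrite /h; lra.
have uj j z : K z -> s z * p j ord0 * al t <= u t z j ord0.
  by move=> Kz; have := hj j z Kz; rewrite /h; lra.
have /andP[sy0 sy1] := s01 y.
have sy : 0 < s y.
  rewrite lt_neqAle sy0 andbT eq_sym; apply/negP => /eqP sy.
  by have := pos t y i (ltW Tt) Ky; rewrite ui sy !mul0r ltxx.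
pose th := al t * s y.
have th0 : 0 < th by rewrite mulr_gt0.
have th1 : th <= 1 by rewrite mulr_ile1// ltW.
have Mu := solution_invariant (ltW t0) Ky.
have Mth : M (th *: p) by apply: orderI_scale => //; rewrite ltW.
have fu : th * f p i ord0 <= f (u t y) i ord0.
  apply: le_trans (reaction_sub v_gt0 f_C1 f_sub i _ Mp) _; first by rewrite th0.
  apply: (reaction_mono f_C1 f_coop) => //.
    by move=> j; rewrite mxE; have := uj j y Ky; rewrite /th; lra.
  by rewrite mxE ui /th; ring.
have rt := rho_gt0 (ltW t0).
have bms' : bounded_measurable Om (fun z => p i ord0 * al t * s z).
  have [ms [B sB]] := bms; split; first exact: measurable_funM.
  exists (`|p i ord0 * al t| * B) => z Oz; rewrite normrM ler_wpM2l//.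
  exact: sB.
have dis : p i ord0 * al t * ((1 - delta) * s y) <=
    disperse Om J (rho t) (fun z => u t z i ord0) y.
  apply: (@le_trans _ _ (disperse Om J (rho t) (fun z => p i ord0 * al t * s z) y)).
    rewrite (disperseZ Om_open J_kernel)//; apply: ler_wpM2l.
      by rewrite mulr_ge0// ltW.
    by apply: s_disp; exact: ltW.
  apply: (le_disperse Om_open J_kernel) => //; first by apply: bm; exact: ltW.
  by move=> z /K_Om Kz; have := uj i z Kz; lra.
have dd : 0 <= d ord0 i * (disperse Om J (rho t) (fun z => u t z i ord0) y
    - p i ord0 * al t * ((1 - delta) * s y)).
  by rewrite mulr_ge0 ?(ltW (d_gt0 i))// subr_ge0.
have : th * (gamma * p i ord0) <=
    th * (f p i ord0 - dilution n rho t * p i ord0 - d ord0 i * delta * p i ord0).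
  by rewrite ler_pM2l// fp// ltW.
have : s y * p i ord0 * gamma * (a0 * ((1 - a0) * X)) < s y * p i ord0 * gamma * al t.
  rewrite ltr_pM2l ?mulr_gt0//; apply: lt_le_trans al0.
  rewrite gtr_pMr//.
  by apply: (@le_lt_trans _ _ ((1 - a0) * 1)); [rewrite ler_wpM2l// subr_ge0 ltW|lra].
move: fu dd; rewrite /rate ui /th; lra.
Qed.

Lemma eventually_lt p (e : R) : M p -> (forall i, 0 < p i ord0) ->
  (forall i, net f kappa i p < 0) -> 0 < e ->
  \forall t \near +oo, forall y i, K y -> u t y i ord0 < p i ord0 + e.
Proof.
move=> Mp p0 np e0; have [g [T [g0 T0 hT]]] := supersolution_eventually p0 np.
have vp j : 0 <= v j ord0 / p j ord0 by rewrite divr_ge0// ltW.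
(* With this initial factor the barrier lies above v. *)
pose a0 : R := \sum_j v j ord0 / p j ord0.
have a00 : 0 <= a0 by apply: sumr_ge0.
have ub := upper_barrier Mp p0 (ltW g0) T0 a00 hT.
pose V : R := 1 + \sum_j p j ord0.
have pV i : p i ord0 <= V.
  rewrite /V (bigD1 i)//= addrCA lerDl addr_ge0// sumr_ge0// => j _; exact: ltW.
have V0 : 0 < V by rewrite ltr_pwDl// sumr_ge0// => j _; exact: ltW.
near=> t => y i Ky.
have Tt : T <= t by near: t; apply: nbhs_pinfty_ge; exact: num_real.
have : `|exp_profile 1 a0 (- g) T t - 1| < e / V.
  by near: t; apply: exp_profile_eventually => //; rewrite divr_gt0.
rewrite ltr_norml => /andP[_ h1].
apply: lt_le_trans (ub _ t y i Tt Ky) _.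
  move=> {}i {}y {}Ky; have /order_intervalP/(_ i)/andP[_ uv] := solution_invariant T0 Ky.
  apply: le_lt_trans uv _; rewrite -ltr_pdivrMr// /a0 (bigD1 i)//= addrCA ltrDl.
  by rewrite ltr_pwDl// sumr_ge0.
have : p i ord0 * (exp_profile 1 a0 (- g) T t - 1) <= V * (e / V).
  apply: (@le_trans _ _ (p i ord0 * (e / V))); first by rewrite ler_pM2l// ltW.
  by apply: ler_wpM2r => //; rewrite divr_ge0// ltW.
by rewrite mulrCA divff ?gt_eqF// mulr1; lra.
Unshelve. all: by end_near. Qed.

Hypothesis rho_pinfty : rho t @[t --> +oo] --> +oo.
Hypothesis J_centered : forall i : 'I_n, Rint_rV setT (fun x => J x * x ord0 i) = 0.
Hypothesis J_compact : compactly_supported J.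
Hypothesis phi_neq0 : exists2 y, K y & exists i, phi y i ord0 != 0.

Lemma eventually_gt (c : 'rV[R]_n) (a e : R) p : 0 < a ->
  (forall y, 0 < cap c a y -> Om y) -> M p -> (forall i, 0 < p i ord0) ->
  (forall i, 0 < net f kappa i p) -> 0 < e ->
  \forall t \near +oo, forall y i, K y ->
    (1 - e) * cap c a y * p i ord0 <= u t y i ord0.
Proof.
move=> a0 cap_Om Mp p0 np e0.
have [g [T1 [g0 T10 hT1]]] := subsolution_eventually p0 np.
have [R0 hR0] : exists R0 : R, forall (x : 'rV[R]_n) (i : 'I_n), J x != 0 -> `|x ord0 i| <= R0.
  have /compact_bounded[B [_ hB]] := J_compact.
  exists (B + 1) => x i Jx; apply: (@le_trans _ _ `|x|).
    rewrite [leRHS]/Num.Def.normr/= mx_normrE.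
    exact: (le_bigmax _ (fun ij : 'I_1 * 'I_n => `|x ij.1 ij.2|) (ord0, i)).
  by apply: (hB (B + 1)); [rewrite ltrDl|exact: subset_closure].
have [r1 hr1] := disperse_cap J_kernel a0 cap_Om J_centered hR0 g0.
have /cvgryPge/(_ r1) [A [_ hA]] := rho_pinfty.
pose T : R := Num.max 1 (Num.max T1 (A + 1)).
have T_gt0 : 0 < T by rewrite /T lt_max ltr01.
have TT1 : T1 <= T by rewrite /T !le_max lexx orbT.
have TA : A < T.
  by apply: (@lt_le_trans _ _ (A + 1)); [rewrite ltrDl|rewrite /T !le_max lexx !orbT].
have pos t y i : T <= t -> K y -> 0 < u t y i ord0.
  by move=> Tt; apply: strongly_positive => //; exact: lt_le_trans Tt.
have [b b01 hb] := uniformly_positive (ltW T_gt0) (fun y i => @pos T y i (lexx T)).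
have lb := @lower_barrier p (cap c a) g g T b Mp p0 g0 (ltW T_gt0) b01
  (@continuous_cap _ _ c a) (bounded_measurable_cap Om_open c a).
have := b01 => /andP[b0 b1].
near=> t => y i Ky.
have Tt : T <= t by near: t; apply: nbhs_pinfty_ge; exact: num_real.
have : `|exp_profile 1 (b - 1) (- (g * b)) T t - 1| < e.
  by near: t; apply: exp_profile_eventually => //; rewrite mulr_gt0.
rewrite ltr_norml => /andP[h1 _].
apply: le_trans (ltW (lb _ _ _ pos _ t y i Tt Ky)).
- rewrite -mulrA mulrC ler_wpM2l ?mulr_ge0 ?cap_ge0// ?ltW//; lra.
- by move=> z; rewrite cap_ge0 cap_le1.
- move=> s z Ts; apply: hr1; last by apply: rho_gt0; exact: le_trans (ltW T_gt0) Ts.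
  by apply: hA; exact: lt_le_trans Ts.
- by move=> s j Ts; apply: hT1; exact: le_trans Ts.
- move=> z j Kz; apply: le_lt_trans (hb z j Kz).
  by rewrite ler_pM2l//; have /order_intervalP/(_ j)/andP[_ ->] := Mp.
Unshelve. all: by end_near. Qed.

(** Around a point c of the domain, the bump centred at c is close to 1; a
    compact set is covered by finitely many such neighbourhoods. *)
Lemma uniform_limit (w_e : 'cV[R]_m) :
  (forall e : R, 0 < e -> exists p, [/\ M p, forall i, 0 < p i ord0,
    forall i, `|p i ord0 - w_e i ord0| < e & forall i, 0 < net f kappa i p]) ->
  (forall e : R, 0 < e -> exists p, [/\ M p, forall i, 0 < p i ord0,
    forall i, `|p i ord0 - w_e i ord0| < e & forall i, net f kappa i p < 0]) ->
  forall Q : set 'rV[R]_n, compact Q -> Q `<=` Om ->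
  forall eps : R, 0 < eps ->
    \forall t \near +oo, forall y, Q y -> `|u t y - w_e| < eps.
Proof.
move=> below above Q Qc QOm eps eps0.
have e4 : 0 < eps / 4 by rewrite divr_gt0.
have [p [Mp p0 pw np]] := below _ e4; have [q [Mq q0 qw nq]] := above _ e4.
have hi := eventually_lt Mq q0 nq e4.
pose V : R := 1 + \sum_j v j ord0.
have vV i : v i ord0 <= V.
  by rewrite /V (bigD1 i)//= addrCA lerDl addr_ge0// sumr_ge0// => j _; exact: ltW.
have V0 : 0 < V by rewrite ltr_pwDl// sumr_ge0// => j _; exact: ltW.
(* This choice ensures e < 1 and 2 e V <= eps / 4, so that (1 - e) ^ 2 p is
   within eps / 4 of p. *)
pose e : R := eps / (8 * V + eps).
have D0 : 0 < 8 * V + eps by rewrite addr_gt0// mulr_gt0.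
have e0 : 0 < e by rewrite divr_gt0.
have e1 : e < 1 by rewrite ltr_pdivrMr// mul1r ltrDr mulr_gt0.
have eV : 2 * e * V <= eps / 4.
  have : e * (8 * V + eps) = eps by rewrite /e divfK// gt_eqF.
  have : 0 <= e * eps by rewrite mulr_ge0// ltW.
  by move=> h1 h2; lra.
have lo : \forall t \near +oo, Q `<=`
    [set y | forall i, p i ord0 - eps / 4 <= u t y i ord0].
  have [/(_ Qc) cov _] := compact_near_coveringP Q.
  apply: cov => c Qc'.
  have /nbhs_ballP[a /= a0 aOm] : nbhs c Om.
    by apply: open_nbhs_nbhs; split => //; exact: QOm.
  have cap_Om y : 0 < cap c a y -> Om y.
    move=> capy; apply: aOm; rewrite ball_rVE// => i; rewrite distrC.
    move: capy; rewrite /cap lt_max ltxx/= /paraboloid subr_gt0.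
    rewrite ltr_pdivrMr ?exprn_gt0// mul1r => h.
    rewrite -(ltr_pXn2r (_ : (0 < 2)%N)) ?nnegrE ?(ltW a0)//.
    rewrite real_normK ?num_real//; apply: le_lt_trans h.
    by rewrite (bigD1 i)//= lerDl sumr_ge0// => j _; rewrite sqr_ge0.
  have near_c : \forall y \near c, 1 - e < cap c a y.
    apply: (cvgr_gt _ (@continuous_cap _ _ c a c)).
    apply: (@lt_le_trans _ _ (paraboloid c a c)); last exact: paraboloid_le_cap.
    rewrite /paraboloid big1 ?mul0r; first lra.
    by move=> i _; rewrite subrr expr0n.
  have := eventually_gt a0 cap_Om Mp p0 np e0.
  move=> ev; near=> y t => i.
  have capy : 1 - e < cap c a y by near: y.
  have Oy : Om y by apply: cap_Om; apply: lt_trans capy; lra.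
  have : forall y i, K y -> (1 - e) * cap c a y * p i ord0 <= u t y i ord0 by near: t.
  move=> /(_ y i (K_Om Oy)); apply: le_trans.
  have : (1 - e) * (1 - e) * p i ord0 <= (1 - e) * cap c a y * p i ord0.
    by rewrite ler_pM2r// ler_pM2l ?subr_gt0// ltW.
  have : e * p i ord0 <= e * V.
    rewrite ler_pM2l//; apply: le_trans (vV i).
    by have /order_intervalP/(_ i)/andP[] := Mp.
  have := mulr_gt0 (mulr_gt0 e0 e0) (p0 i).
  by move=> h1 h2 h3; lra.
near=> t => y Qy.
have hit : forall y i, K y -> u t y i ord0 < q i ord0 + eps / 4 by near: t.
have lot : Q `<=` [set y | forall i, p i ord0 - eps / 4 <= u t y i ord0] by near: t.
apply: (@le_lt_trans _ _ (eps / 2)); last lra.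
apply: cV_norm_le => [|i]; first by rewrite divr_ge0// ltW.
rewrite !mxE; have := hit y i (K_Om (QOm _ Qy)); have := lot y Qy i.
have := pw i; have := qw i; rewrite !ltr_norml ler_norml => /andP[a1 a2] /andP[b1 b2] c1 c2.
by apply/andP; split; lra.
Unshelve. all: by end_near. Qed.

End one_solution.

Hypothesis Om_connected : connected Om.
Hypothesis Om_neq0 : Om !=set0.
Let K_Om y : Om y -> K y. Proof. exact: subset_closure. Qed.

Hypothesis small_supersolution : forall e : R, 0 < e -> exists p,
  [/\ M p, forall i, 0 < p i ord0 < e & forall i, net f kappa i p < 0].

Lemma zero_attracts phi u : (forall y, K y -> M (phi y)) ->
  is_solution Om d rho J f phi u -> sup_norm Om (u t) @[t --> +oo] --> (0 : R).
Proof.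
move=> phi_M u_sol; apply/cvgrPdist_lt => e e0.
have e2 : 0 < e / 2 by rewrite divr_gt0.
have [p [Mp pe np]] := small_supersolution e2.
have p0 i : 0 < p i ord0 by have /andP[] := pe i.
have e4 : 0 < e / 4 by rewrite divr_gt0.
have hi := eventually_lt phi_M u_sol Mp p0 np e4.
near=> t.
have hit : forall y i, K y -> u t y i ord0 < p i ord0 + e / 4 by near: t.
have t0 : 0 <= t by near: t; apply: nbhs_pinfty_ge; exact: num_real.
rewrite sub0r normrN.
have h : forall y, K y -> `|u t y| <= 3 * e / 4.
  move=> y Ky; apply: cV_norm_le => [|i]; first lra.
  have /order_intervalP/(_ i)/andP[u0 _] := solution_invariant phi_M u_sol t0 Ky.
  by rewrite ger0_norm//; have := hit y i Ky; have /andP[_] := pe i; lra.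
have [y0 Oy0] := Om_neq0.
rewrite ger0_norm; last by apply: le_trans (le_sup_norm h (K_Om Oy0)).
by apply: le_lt_trans (sup_norm_le Om_neq0 h) _; lra.
Unshelve. all: by end_near. Qed.

(** The barrier [p] is effective only from a time [T] on. The solution is below
    it at time [T] if the initial value is small enough for the growth before
    [T]. *)
Lemma zero_stable (eps : R) : 0 < eps -> exists2 delta : R, 0 < delta &
  forall phi u, (forall y, K y -> M (phi y)) -> sup_norm Om phi < delta ->
    is_solution Om d rho J f phi u -> forall t, 0 <= t -> sup_norm Om (u t) < eps.
Proof.
move=> eps0; have e2 : 0 < eps / 2 by rewrite divr_gt0.
have [p [Mp pe np]] := small_supersolution e2.
have p0 i : 0 < p i ord0 by have /andP[] := pe i.
have [g [T [g0 T0 hT]]] := supersolution_eventually p0 np.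
have [L L0 hL] := reaction_lipschitz.
have [C C0 hC] := dilution_bounded n T rho_gt0 rho_smooth.
have hL' i w (x : R) : M w -> (forall j, w j ord0 <= x) -> f w i ord0 <= L * x.
  move=> /order_intervalP Mw wx.
  have : `|f w i ord0 - f 0 i ord0| <= L * x.
    apply: hL => j; rewrite ?mxE.
    - by rewrite lerN10 ltW// addr_gt0.
    - by have /andP[a b] := Mw j; apply/andP; split; lra.
    - by rewrite subr0 ger0_norm//; have /andP[] := Mw j.
  by rewrite f0 [X in _ - X]mxE subr0; apply: le_trans; exact: ler_norm.
pose X := expR ((L + C + 1) * T); have X0 : 0 < X by exact: expR_gt0.
have hdel : \forall e \near (0 : R)^'+, forall i, e < p i ord0 / X.
  apply: (@filter_forall _ _ (fun i (e : R) => e < p i ord0 / X) ((0 : R)^'+)) => i.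
  by apply: nbhs_right_lt; rewrite divr_gt0.
near (0 : R)^'+ => e.
have e0 : 0 < e by [].
have hdel' : forall i, e < p i ord0 / X by near: e.
exists e => // phi u phi_M phie u_sol t t0.
have phi_lt i y : K y -> phi y i ord0 < e.
  move=> Ky; apply: le_lt_trans phie; apply: le_trans (ler_norm _) _.
  apply: le_trans (cV_coord_le_norm _ _) _; apply: (@le_sup_norm _ _ _ _ _ `|v|) => // z Kz.
  apply: cV_norm_le => // j; have /order_intervalP/(_ j)/andP[a b] := phi_M z Kz.
  rewrite ger0_norm//; apply: le_trans b _; apply: le_trans (ler_norm _) _.
  exact: cV_coord_le_norm.
have eX i : e * X < p i ord0 by rewrite -ltr_pdivlMr.
have early t' y i : 0 <= t' <= T -> K y -> u t' y i ord0 < p i ord0.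
  move=> t'T Ky; apply: lt_trans (eX i).
  apply: lt_le_trans (solution_growth phi_M u_sol C0 L0 hL' hC e0 phi_lt i t'T Ky) _.
  rewrite ler_pM2l// ler_expR ler_wpM2l ?addr_ge0//.
  by have /andP[] := t'T.
have late t' y i : T <= t' -> K y -> u t' y i ord0 < p i ord0.
  move=> Tt' Ky; have TT : 0 <= T <= T by rewrite T0 lexx.
  have := upper_barrier phi_M u_sol Mp p0 (ltW g0) T0 (lexx 0) hT.
  move=> /(_ _ t' y i Tt' Ky); rewrite /exp_profile mul0r addr0 mulr1; apply.
  by move=> j z Kz; rewrite mul1r; exact: early.
have ut y i : K y -> u t y i ord0 < p i ord0.
  by move=> Ky; case: (leP T t) => tT; [exact: late|apply: early; rewrite ?t0 ?ltW].
have h y : K y -> `|u t y| <= eps / 2.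
  move=> Ky; apply: cV_norm_le => [|i]; first exact: ltW.
  have /order_intervalP/(_ i)/andP[u0 _] := solution_invariant phi_M u_sol t0 Ky.
  by rewrite ger0_norm//; have := ut y i Ky; have /andP[_] := pe i; lra.
by apply: le_lt_trans (sup_norm_le Om_neq0 h) _; lra.
Unshelve. all: by end_near. Qed.

End dynamics.

(** * The threshold *)
Section kinetics.
Context {R : realType} {m : nat}.
Variables (v : 'cV[R]_m) (f : 'cV[R]_m -> 'cV[R]_m).

Lemma positive_equilibriumP (n : nat) (k : R) w :
  positive_equilibrium n k v f w <-> equilibrium v f (n%:R * k) w.
Proof.
have E i : (- (n%:R * k) *: w + f w) i ord0 = net f (n%:R * k) i w.
  by rewrite !mxE /net mulNr addrC.
split => [[Mw [_ w0] fw]|[Mw w0 fw]]; split => //.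
- apply: contrapT => /forallNP h; apply: w0; apply/matrixP => i j.
  by rewrite ord1 mxE; apply/esym/eqP; move: (h i) => /negP/negPn.
- by move=> i; rewrite -E fw mxE.
- split; first by have [] := Mw.
  by move=> w0'; move: w0 => [j]; rewrite -w0' mxE eqxx.
- by apply/matrixP => i j; rewrite ord1 E fw mxE.
Qed.

Lemma shifted_cooperative (c : R) (B : 'M[R]_m) :
  cooperative B -> cooperative (- c *: 1%:M + B).
Proof.
move=> hB i j ij; rewrite !mxE (negbTE ij) mulr0 add0r; exact: hB.
Qed.

Lemma shifted_irreducible (c : R) (B : 'M[R]_m) :
  irreducible B -> irreducible (- c *: 1%:M + B).
Proof.
move=> hB S S0 ST; have [i [j [iS jS Bij]]] := hB S S0 ST.
exists i, j; split => //; rewrite !mxE.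
have -> : (i == j) = false by apply: contraNF jS => /eqP <-.
by rewrite mulr0 add0r.
Qed.

End kinetics.

Theorem theorem5p9 (R : realType) (m n : nat) (hm : (0 < m)%N) (hn : (0 < n)%N)
  (Omega0 : set 'rV[R]_n)
  (Omega0_domain : domain Omega0)
  (Omega0_bounded : bounded_set Omega0)
  (Omega0_simply_connected : simply_connected Omega0)
  (Omega0_smooth : smooth_boundary Omega0)
  (Omega0_convex : convex_set Omega0)
  (d : 'rV[R]_m) (d_gt0 : forall i, 0 < d ord0 i)
  (rho : R -> R)
  (rho_gt0 : forall t : R, 0 <= t -> 0 < rho t)
  (rho_smooth : ray_smooth rho)
  (rho0 : rho 0 = 1)
  (rho_pinfty : rho t @[t --> +oo] --> +oo)
  (k : R) (k_ge0 : 0 <= k)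
  (rho_rate : ray_derive rho t / rho t @[t --> +oo] --> k)
  (J : 'rV[R]_n -> R)
  (J_kernel : dispersal_kernel J)
  (J_compact : compactly_supported J)
  (J_centered : forall i, Rint_rV setT (fun x => J x * x ord0 i) = 0)
  (v : 'cV[R]_m) (v_int : interior nonneg_cone v)
  (f : 'cV[R]_m -> 'cV[R]_m)
  (f_reaction : reaction_term n rho v f) :
  let A := - (n%:R * k) *: 1%:M + Jacobian f 0 in
  (spectral_bound A <= 0 ->
     zero_globally_asymptotically_stable Omega0 d rho J f
       (X_interval Omega0 v)) /\
  (0 < spectral_bound A ->
     exists w_e : 'cV[R]_m,
       unique (positive_equilibrium n k v f) w_e /\
       forall (u0 : 'rV[R]_n -> 'cV[R]_m) (u : R -> 'rV[R]_n -> 'cV[R]_m),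
         X_interval Omega0 v u0 ->
         (exists2 y, closure Omega0 y & u0 y != 0) ->
         is_solution Omega0 d rho J f u0 u ->
         forall K : set 'rV[R]_n, compact K -> K `<=` Omega0 ->
         forall eps : R, 0 < eps ->
           \forall t \near +oo, forall y, K y -> `|u t y - w_e| < eps).
Proof.
move=> A.
have [f_C1 f_coop f0 [sigma sigma_gt0 f_top'] f_sub] := f_reaction.
have v_gt0 : forall i, 0 < v i ord0 by apply/interior_nonneg_coneP.
have [Om_open Om_connected Om_neq0] := Omega0_domain.
pose kappa : R := n%:R * k.
have f_top (i : 'I_m) (t : R) w : 0 <= t -> order_interval v w ->
    w i ord0 = v i ord0 ->
    f w i ord0 - dilution n rho t * v i ord0 <= - sigma.
  by rewrite /dilution -[n%:R * _ / _]mulrA; exact: f_top'.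
have dil : dilution n rho t @[t --> +oo] --> kappa by exact: dilution_cvg.
have M0 : order_interval v 0.
  by apply/order_intervalP => i; rewrite mxE lexx ltW.
have [coop0 irr0] := f_coop 0 M0.
have A_coop : cooperative A by exact: shifted_cooperative.
have A_irr : irreducible A by exact: shifted_irreducible.
have [lambda [psi [psi_gt0 Apsi]]] := perron hm A_coop A_irr.
have sA : spectral_bound A = lambda by exact: spectral_boundE Apsi.
have psi_eigen i : (Jacobian f 0 *m psi) i ord0 = (lambda + kappa) * psi i ord0.
  have := congr1 (fun B : 'cV[R]_m => B i ord0) Apsi.
  rewrite mulmxDl -scalemxAl mul1mx !mxE -/kappa => h.
  by rewrite mulrDl -h; ring.
rewrite sA; split => [l0|l0].
  have small (e : R) : 0 < e -> exists p, [/\ order_interval v p,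
      forall i, 0 < p i ord0 < e & forall i, net f kappa i p < 0].
    by move=> e0; exact: (subcritical_barrier v_gt0 f_C1 f_coop f0 f_sub psi_gt0 psi_eigen l0 e0).
  split.
    by move=> phi u [_ phi_M] u_sol; exact: (zero_attracts Om_open Omega0_bounded d_gt0 rho_gt0
      rho_smooth J_kernel v_gt0 f_C1 f_coop f0 f_sub sigma_gt0 f_top dil
      Om_neq0 small phi_M u_sol).
  move=> eps eps0.
  have [delta delta0 h] := zero_stable Om_open Omega0_bounded d_gt0 rho_gt0
      rho_smooth J_kernel v_gt0 f_C1 f_coop f0 f_sub sigma_gt0 f_top dil Om_neq0 small eps0.
  by exists delta => // phi u [_ phi_M]; exact: h.
have net_top i w : order_interval v w -> w i ord0 = v i ord0 -> net f kappa i w < 0.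
  move=> Mw wv; rewrite /net wv.
  have e0 : 0 < sigma / v i ord0 by rewrite divr_gt0.
  have [T T0 hT] := eventually_dilution dil e0.
  have := hT T (lexx T); rewrite ltr_norml => /andP[h _].
  have : - (sigma / v i ord0) * v i ord0 < (kappa - dilution n rho T) * v i ord0.
    by rewrite ltr_pM2r.
  by rewrite mulNr divfK ?gt_eqF//; have := f_top i T w T0 Mw wv; lra.
have [w_e [[w_eq w_uniq] below above]] := unique_equilibrium v_gt0 f_C1 f_coop f0 f_sub
  psi_gt0 psi_eigen net_top hm l0.
exists w_e; split.
  split; first exact/positive_equilibriumP.
  by move=> w /positive_equilibriumP; exact: w_uniq.
move=> u0 u [_ u0_M] u0_neq0 u_sol K K_compact K_Om eps eps0.
apply: (uniform_limit Om_open Omega0_bounded d_gt0 rho_gt0 rho_smooth J_kernel v_gt0 f_C1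
  f_coop f0 f_sub sigma_gt0 f_top dil u0_M u_sol Om_connected rho_pinfty J_centered
  J_compact _ below above K_compact K_Om eps0).
have [y Ky u0y] := u0_neq0; exists y => //.
apply: contrapT => /forallNP h; move: u0y => /eqP; apply.
by apply/matrixP => i j; rewrite ord1 mxE; move: (h i) => /negP/negPn/eqP.
Qed.
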